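(* Let $M$ be a semi-simple Frobenius manifold of dimension $3$ with unity $e$, and let $S\subset M$ be a surface transverse to $e$, endowed with its booklet 3-web. Let $\alpha:I\to S$ be a curve, $0\in I$, $\alpha(0)=p$, which does not pass through singular points of the booklet 3-web, and let $e_1,e_2,e_3$ be the idempotent frame of $TM$ along $\alpha$. Let $v=\eta^1e_1+\eta^2e_2+\eta^3e_3\in T_pS$. Consider the vector field $\eta=\eta^1e_1+\eta^2e_2+\eta^3e_3$ of $TM$ along $\alpha$ whose coordinates $\eta^i$ are kept constant. Then the projection of $\eta$ into $T_{\alpha(t)}S$ along $e$ is the parallel transport of $v$ along $\alpha$ defined by the Chern connection of the booklet 3-web.
   Context: A Frobenius manifold is a complex analytic manifold $M$ equipped with the following analytic objects: a commutative and associative multiplication $\cdot$ on each $T_pM$; a flat non-degenerate symmetric bilinear inner product $\langle\ ,\ \rangle$ on $TM$ with $\langle u\cdot v,w\rangle=\langle u,v\cdot w\rangle$; a unity vector field $e$ ($e\cdot v=v$) with $\nabla e=0$; an Euler vector field $E$ with $\nabla(\nabla E)=0$; such that the flow of $E$ rescales the multiplication and the inner product (their Lie derivatives along $E$ are constant multiples of them), and, with $c(u,v,w):=\langle u\cdot v,w\rangle$, the 4-tensor $(\nabla_z c)(u,v,w)$ is symmetric in all arguments. Here $\nabla$ is the Levi-Civita connection of $\langle\ ,\ \rangle$. It is semi-simple if $T_pM$ is a semi-simple algebra for all $p$ in some non-empty open set; at such points there is locally a frame of idempotent vector fields $e_1,e_2,e_3$, $e_i\cdot e_j=\delta_{ij}e_i$,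 with $e=e_1+e_2+e_3$. Booklet 3-web. For a surface $S$ transverse to $e$, the three planes spanned by $\{e,e_i\}$, $i=1,2,3$, cut three directions on $T_pS$; the integral curves of the three direction fields form the booklet 3-web. Regular points are those where the web directions are pairwise transverse (i.e. where the algebra is semi-simple); the other points are singular. Chern connection. Near a regular point, a 3-web on a surface is given by 1-forms $\sigma_1,\sigma_2,\sigma_3$ (the leaves of the $i$-th family being the integral curves of $\sigma_i=0$) normalized by $\sigma_1+\sigma_2+\sigma_3=0$. Set $\Omega=\sigma_1\wedge\sigma_2=\sigma_2\wedge\sigma_3=\sigma_3\wedge\sigma_1$ and $d\sigma_i=h_i\Omega$. The Chern connection form is $\gamma=h_2\sigma_1-h_1\sigma_2=h_3\sigma_2-h_2\sigma_3=h_1\sigma_3-h_3\sigma_1$; it satisfies $d\sigma_i=\gamma\wedge\sigma_i$. Let $v_1,v_2,v_3$ be the vector fields tangent to the web leaves, $\sigma_i(v_i)=0$, with $v_1+v_2+v_3=0$, normalized correspondingly to $\sigma_i$ by $\sigma_1(v_2)=\sigma_2(v_3)=\sigma_3(v_1)=1$. A vector field $\xi=\xi^1v_1+\xi^2v_2$ is parallel along a curve with respect to the Chern connection iff the forms $\Gamma^1=d\xi^1-\gamma\xi^1$ and $\Gamma^2=d\xi^2-\gamma\xi^2$ vanish along the curve. (This does not depend on the choice of normalized $\sigma_i$: replacing $\sigma_i$ by $\lambda\sigma_i$ replaces $\gamma$ by $\gamma+d\ln\lambda$ and $v_i$ by $\lambda^{-1}v_i$.) *)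

(* Defs.v *)
From mathcomp Require Import all_boot all_order all_algebra complex.
From mathcomp Require Import all_classical all_reals all_analysis.

Set Implicit Arguments.
Unset Strict Implicit.
Unset Printing Implicit Defensive.

Import Order.TTheory GRing.Theory Num.Theory.
Import numFieldNormedType.Exports.
Local Open Scope classical_set_scope.
Local Open Scope ring_scope.

(* The complex numbers over [R], as a normed space over themselves; thus
   [differentiable f x] is complex Frechet differentiability. *)
Notation Cplx R := ((complex R)^o).

Section ComplexCalculus.
Context {R : realType}.
Local Notation C := (Cplx R).

Definition holomorphic n (W : normedModType C) (U : set 'rV[C]_n)
    (f : 'rV[C]_n -> W) :=
  forall x, U x -> differentiable f x.

Definition pd n (i : 'I_n) (f : 'rV[C]_n -> C) (x : 'rV[C]_n) : C :=
  'D_(delta_mx 0 i : 'rV[C]_n) f x.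

(* [f] has derivative [w] at [t] in a real variable ranging over [I]
   (one-sided if [t] is an endpoint of [I]). *)
Definition has_deriv (W : normedModType C) (I : set R) (f : R -> W) (t : R)
    (w : W) :=
  (fun s => (((s - t)%:C)%C : C)^-1 *: (f s - f t)) @ within I (t^') --> w.

End ComplexCalculus.

Section Tensors.
Context {R : realType} (n : nat).
Local Notation C := (Cplx R).
Implicit Types (g : 'rV[C]_n -> 'M[C]_n) (X : 'rV[C]_n -> 'rV[C]_n)
  (m : 'rV[C]_n -> 'I_n -> 'I_n -> 'I_n -> C) (x u v w : 'rV[C]_n).

Definition inner g x u v : C := (u *m g x *m v^T) 0 0.

(* [m x i j k] is the [k]-th component of the product of the [i]-th and
   [j]-th coordinate vector fields. *)
Definition prodv m x u v : 'rV[C]_n :=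
  \row_k \sum_i \sum_j u 0 i * v 0 j * m x i j k.

(* Gamma^k_{ij} of the Levi-Civita connection *)
Definition christoffel g x (k i j : 'I_n) : C :=
  2^-1 * \sum_l invmx (g x) k l *
    (pd i (fun y => g y j l) x + pd j (fun y => g y i l) x
     - pd l (fun y => g y i j) x).

(* R^l_{kij} *)
Definition curvature g x (l k i j : 'I_n) : C :=
  pd i (fun y => christoffel g y l j k) x
  - pd j (fun y => christoffel g y l i k) x
  + \sum_p (christoffel g x l i p * christoffel g x p j k
            - christoffel g x l j p * christoffel g x p i k).

(* (nabla_i X)^k *)
Definition nabla_vec g X x (i k : 'I_n) : C :=
  pd i (fun y => X y 0 k) x + \sum_j christoffel g x k i j * X x 0 j.

(* (nabla_i (nabla X))_j^k *)
Definition nabla2_vec g X x (i j k : 'I_n) : C :=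
  pd i (fun y => nabla_vec g X y j k) x
  + \sum_l (christoffel g x k i l * nabla_vec g X x j l
            - christoffel g x l i j * nabla_vec g X x l k).

(* c(d_i, d_j, d_k) = < d_i . d_j, d_k > *)
Definition c3 g m x (i j k : 'I_n) : C := \sum_l m x i j l * g x l k.

(* (nabla_l c)_{ijk} *)
Definition nabla_c3 g m x (l i j k : 'I_n) : C :=
  pd l (fun y => c3 g m y i j k) x
  - \sum_p (christoffel g x p l i * c3 g m x p j k
            + christoffel g x p l j * c3 g m x i p k
            + christoffel g x p l k * c3 g m x i j p).

(* Lie derivatives along X of the metric and of the multiplication *)
Definition lie_metric X g x (i j : 'I_n) : C :=
  \sum_l (X x 0 l * pd l (fun y => g y i j) x
          + g x l j * pd i (fun y => X y 0 l) x
          + g x i l * pd j (fun y => X y 0 l) x).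

Definition lie_mult X m x (i j k : 'I_n) : C :=
  \sum_l (X x 0 l * pd l (fun y => m y i j k) x
          - m x i j l * pd l (fun y => X y 0 k) x
          + m x l j k * pd i (fun y => X y 0 l) x
          + m x i l k * pd j (fun y => X y 0 l) x).

(* Every ideal is a direct summand; for a commutative algebra, this is
   semi-simplicity as a module over itself. *)
Definition is_ideal (mul : 'rV[C]_n -> 'rV[C]_n -> 'rV[C]_n)
    (J : {vspace 'rV[C]_n}) :=
  forall u v, v \in J -> mul u v \in J.

Definition semisimple_algebra (mul : 'rV[C]_n -> 'rV[C]_n -> 'rV[C]_n) :=
  forall J, is_ideal mul J ->
    exists J', [/\ is_ideal mul J', (J + J')%VS = fullv
                 & (J :&: J')%VS = 0%VS].

End Tensors.

Record cmanifold (R : realType) (n : nat) := CManifold {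
  cm_space :> topologicalType;
  cm_hausdorff : hausdorff_space cm_space;
  cm_countable : @second_countable cm_space;
  chart : Type;
  cdom : chart -> set cm_space;
  cmap : chart -> cm_space -> 'rV[Cplx R]_n;
  cinv : chart -> 'rV[Cplx R]_n -> cm_space;
  cdom_open : forall a, open (cdom a);
  cimg_open : forall a, open (cmap a @` cdom a);
  cmapK : forall a p, cdom a p -> cinv a (cmap a p) = p;
  cmap_cont : forall a p, cdom a p -> {for p, continuous (cmap a)};
  cinv_cont : forall a p, cdom a p -> {for cmap a p, continuous (cinv a)};
  chart_cover : forall p, exists a, cdom a p;
  transition_holo : forall a b p, cdom a p -> cdom b p ->
    differentiable (cmap b \o cinv a) (cmap a p)
}.

Section Manifolds.
Context {R : realType} {n : nat} (M : cmanifold R n).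
Local Notation C := (Cplx R).

Definition jac (a b : chart M) (p : M) (u : 'rV[C]_n) : 'rV[C]_n :=
  'd (cmap b \o cinv a) (cmap a p) u.

(* A tangent vector at [p] is the family of its components in the charts
   around [p]; components in charts not containing [p] are meaningless and
   ignored by [teq]. *)
Definition tvec := chart M -> 'rV[C]_n.

Definition teq (p : M) (u v : tvec) := forall a, cdom a p -> u a = v a.

Definition tangent (p : M) (u : tvec) :=
  forall a b, cdom a p -> cdom b p -> u b = jac a b p (u a).

(* [X] has, in each chart, components depending on the coordinates (not on the
   point of [M]). *)
Definition field_at (X : chart M -> 'rV[C]_n -> 'rV[C]_n) (p : M) : tvec :=
  fun a => X a (cmap a p).

End Manifolds.

Record frobenius (R : realType) (n : nat) (M : cmanifold R n) := Frobenius {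
  fr_mult : chart M -> 'rV[Cplx R]_n -> 'I_n -> 'I_n -> 'I_n -> Cplx R;
  fr_metric : chart M -> 'rV[Cplx R]_n -> 'M[Cplx R]_n;
  fr_unit : chart M -> 'rV[Cplx R]_n -> 'rV[Cplx R]_n;
  fr_euler : chart M -> 'rV[Cplx R]_n -> 'rV[Cplx R]_n;
  fr_mult_holo : forall a i j k,
    holomorphic (cmap a @` cdom a) (fun x => fr_mult a x i j k);
  fr_metric_holo : forall a i j,
    holomorphic (cmap a @` cdom a) (fun x => fr_metric a x i j);
  fr_unit_holo : forall a, holomorphic (cmap a @` cdom a) (fr_unit a);
  fr_euler_holo : forall a, holomorphic (cmap a @` cdom a) (fr_euler a);
  fr_mult_tensor : forall a b p, cdom a p -> cdom b p -> forall u v,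
    prodv (fr_mult b) (cmap b p) (jac a b p u) (jac a b p v)
    = jac a b p (prodv (fr_mult a) (cmap a p) u v);
  fr_metric_tensor : forall a b p, cdom a p -> cdom b p -> forall u v,
    inner (fr_metric b) (cmap b p) (jac a b p u) (jac a b p v)
    = inner (fr_metric a) (cmap a p) u v;
  fr_unit_tensor : forall p, tangent p (field_at fr_unit p);
  fr_euler_tensor : forall p, tangent p (field_at fr_euler p);
  fr_multC : forall a x, (cmap a @` cdom a) x -> forall u v,
    prodv (fr_mult a) x u v = prodv (fr_mult a) x v u;
  fr_multA : forall a x, (cmap a @` cdom a) x -> forall u v w,
    prodv (fr_mult a) x u (prodv (fr_mult a) x v w)
    = prodv (fr_mult a) x (prodv (fr_mult a) x u v) w;
  fr_metric_sym : forall a x, (cmap a @` cdom a) x ->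
    (fr_metric a x)^T = fr_metric a x;
  fr_metric_nondeg : forall a x, (cmap a @` cdom a) x ->
    fr_metric a x \in unitmx;
  fr_metric_flat : forall a x, (cmap a @` cdom a) x -> forall l k i j,
    curvature (fr_metric a) x l k i j = 0;
  fr_invariant : forall a x, (cmap a @` cdom a) x -> forall u v w,
    inner (fr_metric a) x (prodv (fr_mult a) x u v) w
    = inner (fr_metric a) x u (prodv (fr_mult a) x v w);
  fr_unitP : forall a x, (cmap a @` cdom a) x -> forall v,
    prodv (fr_mult a) x (fr_unit a x) v = v;
  fr_unit_flat : forall a x, (cmap a @` cdom a) x -> forall i k,
    nabla_vec (fr_metric a) (fr_unit a) x i k = 0;
  fr_euler_affine : forall a x, (cmap a @` cdom a) x -> forall i j k,
    nabla2_vec (fr_metric a) (fr_euler a) x i j k = 0;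
  fr_euler_mult : exists d : Cplx R, forall a x, (cmap a @` cdom a) x ->
    forall i j k,
      lie_mult (fr_euler a) (fr_mult a) x i j k = d * fr_mult a x i j k;
  fr_euler_metric : exists D : Cplx R, forall a x, (cmap a @` cdom a) x ->
    forall i j,
      lie_metric (fr_euler a) (fr_metric a) x i j = D * fr_metric a x i j;
  (* invariance of (nabla c) under the adjacent transpositions of its four
     arguments *)
  fr_potential : forall a x, (cmap a @` cdom a) x -> forall l i j k,
    nabla_c3 (fr_metric a) (fr_mult a) x l i j k
      = nabla_c3 (fr_metric a) (fr_mult a) x i l j k
    /\ nabla_c3 (fr_metric a) (fr_mult a) x l i j k
      = nabla_c3 (fr_metric a) (fr_mult a) x l j i k
    /\ nabla_c3 (fr_metric a) (fr_mult a) x l i j k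
      = nabla_c3 (fr_metric a) (fr_mult a) x l i k j
}.

Section FrobeniusTheory.
Context {R : realType} {n : nat} {M : cmanifold R n} (F : frobenius M).
Local Notation C := (Cplx R).

Definition semisimple_at (p : M) :=
  forall a, cdom a p -> semisimple_algebra (prodv (fr_mult F a) (cmap a p)).

Definition semisimple_frobenius :=
  exists U : set M, [/\ open U, U !=set0 & forall p, U p -> semisimple_at p].

Definition idempotent_frame (p : M) (f : 'I_n -> tvec M) :=
  (forall i, tangent p (f i)) /\
  forall a, cdom a p ->
    (forall i j, prodv (fr_mult F a) (cmap a p) (f i a) (f j a)
                 = if i == j then f i a else 0)
    /\ (\matrix_i f i a) \in unitmx.

(* The idempotents are labelled continuously along the curve. *)
Definition idempotent_frame_along (I : set R) (alpha : R -> M)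
    (f : 'I_n -> R -> tvec M) :=
  (forall t, I t -> idempotent_frame (alpha t) (fun i => f i t)) /\
  forall i t a, I t -> cdom a (alpha t) ->
    (fun s => f i s a) @ within I (nbhs t) --> f i t a.

End FrobeniusTheory.

Section Curves.
Context {R : realType} {n : nat} {M : cmanifold R n}.

Definition curve (I : set R) (alpha : R -> M) :=
  forall t, I t ->
    alpha @ within I (nbhs t) --> alpha t /\
    forall a, cdom a (alpha t) ->
      exists w, has_deriv I (cmap a \o alpha) t w.

End Curves.

Section Surfaces.
Context {R : realType} {M : cmanifold R 3}.
Local Notation C := (Cplx R).
Implicit Types (S : set M) (D : set 'rV[C]_2) (psi : 'rV[C]_2 -> M).

Definition push psi (x w : 'rV[C]_2) : tvec M :=
  fun a => 'd (cmap a \o psi) x w.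

(* Holomorphic parametrization of an open piece of [S]: a homeomorphism of [D]
   onto an open subset of [S], which is an immersion into [M]. *)
Definition local_param S D psi :=
  [/\ open D,
      {in D &, injective psi},
      forall x, D x -> {for x, continuous psi},
      forall D', open D' -> D' `<=` D ->
        exists U : set M, open U /\ psi @` D' = S `&` U
    & forall x a, D x -> cdom a (psi x) ->
        differentiable (cmap a \o psi) x /\
        forall w, push psi x w a = 0 -> w = 0].

Definition surface S :=
  forall p, S p -> exists D psi, local_param S D psi /\ (psi @` D) p.

Definition surf_tangent S (p : M) (u : tvec M) :=
  exists D psi x w,
    [/\ local_param S D psi, D x, psi x = p & teq p u (push psi x w)].

End Surfaces.

(* Exterior calculus in two variables. A 1-form is the row of its coefficients,
   a 2-form is its coefficient with respect to dx^0 /\ dx^1. *)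
Section Forms.
Context {R : realType}.
Local Notation C := (Cplx R).
Implicit Types (s : 'rV[C]_2 -> 'rV[C]_2) (x a b w : 'rV[C]_2).

Definition ev a w : C := (a *m w^T) 0 0.

Definition wedge a b : C := a 0 0 * b 0 1 - a 0 1 * b 0 0.

Definition extd s x : C :=
  pd 0 (fun y => s y 0 1) x - pd 1 (fun y => s y 0 0) x.

(* Three-element families are indexed by ['I_3]; index 0, 1, 2 here stands for
   the usual 1, 2, 3. *)
Definition web_h (sigma : 'I_3 -> 'rV[C]_2 -> 'rV[C]_2) (i : 'I_3) x : C :=
  extd (sigma i) x / wedge (sigma 0 x) (sigma 1 x).

Definition chern_form (sigma : 'I_3 -> 'rV[C]_2 -> 'rV[C]_2) x : 'rV[C]_2 :=
  web_h sigma 1 x *: sigma 0 x - web_h sigma 0 x *: sigma 1 x.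

End Forms.

Section Booklet.
Context {R : realType} {M : cmanifold R 3} (F : frobenius M) (S : set M).
Local Notation C := (Cplx R).

Definition transverse_to_unit :=
  surface S /\
  forall p, S p -> ~ surf_tangent S p (field_at (fr_unit F) p).

Definition regular_point (p : M) := S p /\ semisimple_at F p.

(* [u] lies in the plane spanned by the unity and [f i]. *)
Definition booklet_plane (p : M) (f : 'I_3 -> tvec M) (i : 'I_3)
    (u : tvec M) :=
  exists c d : C,
    teq p u (fun a => c *: field_at (fr_unit F) p a + d *: f i a).

(* A normalized description, in the local coordinates [psi] of [S], of the
   booklet 3-web: forms sigma_i with sum 0 whose kernels are the web
   directions, and the corresponding normalized fields v_i. In ['I_3],
   [i + 1] is the cyclic successor of [i]. *)
Definition web_presentation (D : set 'rV[C]_2) (psi : 'rV[C]_2 -> M)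
    (sigma v : 'I_3 -> 'rV[C]_2 -> 'rV[C]_2) :=
  [/\ local_param S D psi,
      forall i, holomorphic D (sigma i),
      forall x, D x -> exists f, idempotent_frame F (psi x) f /\
        forall i w, ev (sigma i x) w = 0 <->
                    booklet_plane (psi x) f i (push psi x w),
      forall x, D x -> \sum_i sigma i x = 0
    & forall x, D x ->
        [/\ forall i, ev (sigma i x) (v i x) = 0,
            \sum_i v i x = 0
          & forall i, ev (sigma i x) (v (i + 1) x) = 1]].

(* Vanishing at [t], along [alpha], of the forms d xi^i - gamma xi^i, i = 1, 2,
   where xi = xi^1 v_1 + xi^2 v_2; here [x] is [alpha] read in the local
   coordinates of [S]. *)
Definition chern_forms_vanish (psi : 'rV[C]_2 -> M) (D : set 'rV[C]_2)
    (sigma v : 'I_3 -> 'rV[C]_2 -> 'rV[C]_2) (I : set R) (alpha : R -> M)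
    (xi : R -> tvec M) (t : R) :=
  exists (x : R -> 'rV[C]_2) (xi1 xi2 : R -> C) (x' : 'rV[C]_2),
    (\forall s \near within I (nbhs t),
        [/\ D (x s), psi (x s) = alpha s
          & teq (alpha s) (xi s)
              (push psi (x s) (xi1 s *: v 0 (x s) + xi2 s *: v 1 (x s)))]) /\
    [/\ has_deriv I x t x',
        has_deriv I xi1 t (ev (chern_form sigma (x t)) x' * xi1 t)
      & has_deriv I xi2 t (ev (chern_form sigma (x t)) x' * xi2 t)].

(* The Chern connection does not depend on the normalized description of the
   web; parallelism is required for all of them, and there must be one. *)
Definition chern_parallel (I : set R) (alpha : R -> M) (xi : R -> tvec M) :=
  forall t, I t ->
    (exists D psi sigma v,
        web_presentation D psi sigma v /\ (psi @` D) (alpha t)) /\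
    (forall D psi sigma v,
        web_presentation D psi sigma v -> (psi @` D) (alpha t) ->
        chern_forms_vanish psi D sigma v I alpha xi t).

Definition chern_parallel_transport (I : set R) (alpha : R -> M) (v : tvec M)
    (xi : R -> tvec M) :=
  teq (alpha 0) (xi 0) v /\ chern_parallel I alpha xi.

(* [u'] is the projection of [u] into the tangent plane of [S] at [p] along
   the unity. *)
Definition projection_along_unit (p : M) (u u' : tvec M) :=
  surf_tangent S p u' /\
  exists c : C, teq p u (fun a => u' a + c *: field_at (fr_unit F) p a).

End Booklet.

(* Main.v *)
From HB Require Import structures.
Require Import Defs.
From mathcomp Require Import all_boot all_order all_algebra complex.
From mathcomp Require Import all_classical all_reals all_analysis.
From mathcomp Require Import ring lra.
Set Implicit Arguments.
Unset Strict Implicit.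
Unset Printing Implicit Defensive.
Import Order.TTheory GRing.Theory Num.Theory.
Import numFieldNormedType.Exports.
Local Open Scope classical_set_scope.
Local Open Scope ring_scope.

(** The three coordinate forms theta^i dual to the idempotent frame are closed.
    Indeed theta^i is a character of the tangent algebra, and contracting the
    symmetric tensor nabla c with theta^i and with e_i leaves the covariant
    derivative of theta^i, so that this derivative is symmetric and
    d theta^i = 0 ([character_derivative_sym], [canonical_coframe]).

    Each theta^i takes the value 1 on the unity. Hence a vector lies in the
    plane of the unity and e_i iff its two other components agree
    ([booklet_plane_coframe]), and the web on the surface is given by the
    pull-backs of theta^{i+1} - theta^{i+2}. These have sum zero and are
    independent because the surface is transverse to the unity
    ([transverse_independent]); being closed, they have h_i = 0, and the Chern
    form that they define is zero. They do not see the unity either: on the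
    projection of eta they take the values eta^{i+1} - eta^{i+2}. So its
    coordinates with respect to the dual fields v_i are constant, which is
    parallelism.

    Any other normalized description of the web is obtained, locally, by
    relabelling the idempotents and multiplying the three forms by one function
    lambda ([presentation_scaled]); this turns the Chern form into
    d lambda / lambda ([chern_form_scaled]) and multiplies the coordinates of
    the field by lambda, so that parallelism persists
    ([projection_forms_vanish]).

    Three general facts support this. Closedness of a pull-back
    requires that partial derivatives of a holomorphic function be
    differentiable and commute ([holo_pd], [holo_pdC]); as holomorphy means
    complex differentiability at each point, this rests on the theorems of
    Goursat and Cauchy, here for squares. The idempotents at a point extend to
    idempotents depending holomorphically on the point ([frame_extends]), by
    following the eigenvalue 1 of the multiplication by an idempotent. Tangent
    vectors and velocities are transferred between parametrizations of
    the surface by [lift_near] and [quotient_immersion]: a parametrization is a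
    homeomorphism onto its image and an immersion, so that difference quotients
    on the surface lift to difference quotients of the parameters. *)

(** * Integrals of complex functions along segments *)
Section Segment.
Context {R : realType}.
Local Notation C := (complex R).
Local Notation N := (@Normc.normc R).
Local Notation Re := (@complex.Re R).
Local Notation Im := (@complex.Im R).
Implicit Types (a b c M : R) (u v : R -> C) (z w : C).

Lemma normcE0 z : `|z| = (N z)%:C%C.
Proof. by []. Qed.

Lemma normc_ge0 z : 0 <= N z.
Proof. by case: z => x y /=; rewrite sqrtr_ge0. Qed.

Lemma normcD z w : N (z + w) <= N z + N w.
Proof. exact: le_normcD. Qed.

Lemma normc_sum (I : finType) (g : I -> C) : N (\sum_i g i) <= \sum_i N (g i).
Proof.
elim/big_rec2: _ => [|i a b _ ab]; first by rewrite Normc.normc0.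
by apply: le_trans (normcD _ _) _; rewrite lerD2l.
Qed.

Lemma normcB z w : N (z - w) <= N z + N w.
Proof. by rewrite -(normcN w); exact: le_normcD. Qed.

Lemma normc_dist z w : N (z - w) = N (w - z).
Proof. by rewrite -normcN opprB. Qed.

Lemma normc_Re z : `|Re z| <= N z.
Proof. by rewrite -lecR; exact: normc_ge_Re. Qed.

Lemma normc_Im z : `|Im z| <= N z.
Proof.
by case: z => x y /=; rewrite -sqrtr_sqr ler_wsqrtr// lerDr sqr_ge0.
Qed.

Lemma normc_le z : N z <= `|Re z| + `|Im z|.
Proof.
case: z => x y /=; rewrite -[leRHS]ger0_norm ?addr_ge0// -sqrtr_sqr ler_wsqrtr//.
rewrite sqrrD !real_normK ?num_real//.
by have := mulr_ge0 (normr_ge0 x) (normr_ge0 y); lra.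
Qed.

Lemma normc_real (x : R) : N x%:C%C = `|x|.
Proof. by rewrite /= expr0n /= addr0 sqrtr_sqr. Qed.

Lemma normc_i : N 'i%C = 1.
Proof. by rewrite /= expr0n /= add0r expr1n sqrtr1. Qed.

Lemma normc_eq0 z : (N z == 0) = (z == 0).
Proof.
apply/eqP/eqP => [/Normc.eq0_normc//|->]; exact: Normc.normc0.
Qed.

Lemma normc_gt0 z : (0 < N z) = (z != 0).
Proof. by rewrite lt0r normc_eq0 normc_ge0 andbT. Qed.

Definition seg_continuous a b u := forall t : R, a <= t <= b ->
  forall e, 0 < e -> exists2 d, 0 < d &
    forall s : R, `|s - t| < d -> N (u s - u t) < e.

Definition seg_int a b u : C :=
  ((\int[lebesgue_measure]_(t in `[a, b]) Re (u t))
   +i* (\int[lebesgue_measure]_(t in `[a, b]) Im (u t)))%C.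

Lemma seg_integrable a b (f : R -> R) :
  (forall t : R, a <= t <= b -> forall e, 0 < e -> exists2 d, 0 < d &
    forall s : R, `|s - t| < d -> `|f s - f t| < e) ->
  lebesgue_measure.-integrable `[a, b] (EFin \o f).
Proof.
move=> fc; apply: continuous_compact_integrable; first exact: segment_compact.
apply: continuous_in_subspaceT => t /set_mem /=; rewrite in_itv /= => tab.
apply/cvgrPdist_lt => e e0; have [d d0 dP] := fc t tab e e0.
near=> s; rewrite distrC; apply: dP; rewrite distrC.
by near: s; apply/nbhs_ballP; exists d.
Unshelve. all: by end_near. Qed.

Lemma seg_integrable_comp a b u (h : C -> R) :
  (forall z w, `|h z - h w| <= N (z - w)) -> seg_continuous a b u ->
  lebesgue_measure.-integrable `[a, b] (EFin \o (h \o u)).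
Proof.
move=> hN uc; apply: seg_integrable => t tab e e0; have [d d0 dP] := uc t tab e e0.
by exists d => // s st; apply: le_lt_trans (dP s st); exact: hN.
Qed.

Lemma seg_continuous_Re a b u : seg_continuous a b u ->
  lebesgue_measure.-integrable `[a, b] (EFin \o (Re \o u)).
Proof.
apply: (@seg_integrable_comp a b u Re) => z w.
by have := normc_Re (z - w); rewrite raddfB.
Qed.

Lemma seg_continuous_Im a b u : seg_continuous a b u ->
  lebesgue_measure.-integrable `[a, b] (EFin \o (Im \o u)).
Proof.
apply: (@seg_integrable_comp a b u Im) => z w.
by have := normc_Im (z - w); rewrite raddfB.
Qed.

Lemma seg_continuousZ a b u z :
  seg_continuous a b u -> seg_continuous a b (fun t => z * u t).
Proof.
move=> uc t tab e e0.
have z0 : 0 < N z + 1 by rewrite ltr_pwDr// normc_ge0.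
have [d d0 dP] := uc t tab (e / (N z + 1)) (divr_gt0 e0 z0).
exists d => // s /dP h; rewrite -mulrBr Normc.normcM.
rewrite ltr_pdivlMr// mulrDr mulr1 mulrC in h.
by have := normc_ge0 (u s - u t); lra.
Qed.

Lemma seg_continuousD a b u v : seg_continuous a b u -> seg_continuous a b v ->
  seg_continuous a b (fun t => u t + v t).
Proof.
move=> uc vc t tab e e0.
have [d d0 dP] := uc t tab (e / 2) ltac:(lra).
have [d' d'0 d'P] := vc t tab (e / 2) ltac:(lra).
exists (Num.min d d'); first by rewrite lt_min d0.
move=> s; rewrite lt_min => /andP[/dP h /d'P h'].
rewrite opprD addrACA; apply: le_lt_trans (normcD _ _) _; lra.
Qed.

Lemma seg_int_eq a b u v : (forall t : R, a <= t <= b -> u t = v t) ->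
  seg_int a b u = seg_int a b v.
Proof.
move=> uv; rewrite /seg_int; congr (_ +i* _)%C; apply: eq_Rintegral => t;
  by move=> /set_mem /=; rewrite in_itv /= => /uv ->.
Qed.

Lemma seg_intD a b u v : seg_continuous a b u -> seg_continuous a b v ->
  seg_int a b (fun t => u t + v t) = seg_int a b u + seg_int a b v.
Proof.
move=> uc vc; rewrite /seg_int; apply/eqP; rewrite eq_complex /=.
rewrite -RintegralD; [|by []|exact: seg_continuous_Re..].
rewrite -RintegralD; [|by []|exact: seg_continuous_Im..].
by apply/andP; split; apply/eqP; apply: eq_Rintegral => t _;
  case: (u t) (v t) => ? ? [].
Qed.

Lemma seg_intZ a b u z : seg_continuous a b u ->
  seg_int a b (fun t => z * u t) = z * seg_int a b u.
Proof.
move=> uc; rewrite /seg_int; case: z => x y; apply/eqP; rewrite eq_complex /=.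
have uR := seg_continuous_Re uc; have uI := seg_continuous_Im uc.
have RZ (f : R -> R) r : lebesgue_measure.-integrable `[a, b] (EFin \o f) ->
    lebesgue_measure.-integrable `[a, b] (EFin \o (fun t => r * f t)).
  by move=> fi; exact: (integrableZl _ r fi).
rewrite -!RintegralZl// -?RintegralB -?RintegralD//; try exact: RZ.
by apply/andP; split; apply/eqP; apply: eq_Rintegral => t _;
  case: (u t) => ? ? /=.
Qed.

Lemma seg_intB a b u v : seg_continuous a b u -> seg_continuous a b v ->
  seg_int a b (fun t => u t - v t) = seg_int a b u - seg_int a b v.
Proof.
move=> uc vc; rewrite -mulN1r -seg_intZ// -seg_intD//; last first.
  exact: seg_continuousZ.
by apply: seg_int_eq => t _; rewrite mulN1r.
Qed.

Lemma fine_measure_seg a b : a <= b ->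
  fine (lebesgue_measure (`[a, b] : set R)) = b - a.
Proof.
move=> ab; rewrite lebesgue_measure_itv /= lte_fin.
by move: ab; rewrite le_eqVlt => /predU1P[->|->]; rewrite ?ltxx ?subrr.
Qed.

Lemma seg_int_cst a b z : a <= b -> seg_int a b (fun=> z) = (b - a)%:C%C * z.
Proof.
move=> ab; rewrite /seg_int !Rintegral_cst// !fine_measure_seg//.
by case: z => x y /=; apply/eqP; rewrite eq_complex /=; apply/andP; split;
  apply/eqP; ring.
Qed.

Lemma seg_int_cat a b c u : a <= c <= b -> seg_continuous a b u ->
  seg_int a b u = seg_int a c u + seg_int c b u.
Proof.
move=> /andP[ac cb] uc; rewrite /seg_int.
have h (f : R -> R) : lebesgue_measure.-integrable `[a, b] (EFin \o f) ->
    \int[lebesgue_measure]_(t in `[a, b]) f t =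
    \int[lebesgue_measure]_(t in `[a, c]) f t +
    \int[lebesgue_measure]_(t in `[c, b]) f t.
  move=> fi; rewrite -(@Rintegral_itv_obnd_cbnd _ c).
    by rewrite -(@Rintegral_itvB _ f (BLeft a) (BRight b) c) ?bnd_simp// addrC subrK.
  apply: integrableS fi => //; apply: subset_itvr; by rewrite bnd_simp.
apply/eqP; rewrite eq_complex /=; apply/andP; split; apply/eqP; apply: h.
  exact: (seg_continuous_Re uc).
exact: (seg_continuous_Im uc).
Qed.

Lemma seg_int_bound a b u (M : R) : a <= b -> seg_continuous a b u ->
  (forall t : R, a <= t <= b -> N (u t) <= M) ->
  N (seg_int a b u) <= 2 * M * (b - a).
Proof.
move=> ab uc uM; apply: le_trans (normc_le _) _ => /=.
have h (f : R -> R) : lebesgue_measure.-integrable `[a, b] (EFin \o f) ->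
    (forall t : R, a <= t <= b -> `|f t| <= M) ->
    `|\int[lebesgue_measure]_(t in `[a, b]) f t| <= M * (b - a).
  move=> fi fM; apply: le_trans (le_normr_Rintegral _ fi) _ => //.
  rewrite -(fine_measure_seg ab) -Rintegral_cst//; apply: le_Rintegral => //.
  - exact: (integrable_norm fi).
  - apply: seg_integrable => t _ e e0; exists 1 => // s _.
    by rewrite subrr normr0.
have hR := h _ (seg_continuous_Re uc) (fun t tab => le_trans (normc_Re _) (uM t tab)).
have hI := h _ (seg_continuous_Im uc) (fun t tab => le_trans (normc_Im _) (uM t tab)).
by apply: le_trans (lerD hR hI) _; rewrite -mulrA mulr_natl.
Qed.

End Segment.

(** * Complex differentiability with real moduli *)
Section Bridge.
Context {R : realType}.
Local Notation C := (Cplx R).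
Local Notation N := (@Normc.normc R).

Definition cderiv_at (f : C -> C) (z l : C) := forall e : R, 0 < e -> exists2 d : R, 0 < d &
  forall w, N (w - z) < d -> N (f w - f z - l * (w - z)) <= e * N (w - z).

Definition cdiff_at (f : C -> C) z := exists l, cderiv_at f z l.

Definition ccont_at (f : C -> C) (z : C) := forall e : R, 0 < e -> exists2 d : R, 0 < d &
  forall w, N (w - z) < d -> N (f w - f z) < e.

Lemma cplx_pos (e : C) : 0 < e -> exists2 d : R, 0 < d & e = d%:C%C.
Proof.
move=> e0; exists (complex.Re e); first by move: e0; rewrite ltcE => /andP[].
by rewrite RRe_real// realE (ltW e0).
Qed.

(** In a normed space over the complex numbers, the radii of balls and the values
    of the norm are complex; every estimate of this file is made with real ones. *)
Lemma near_cplx (V : normedModType C) (x : V) (P : V -> Prop) :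
  (\forall y \near x, P y) <->
  exists2 d : R, 0 < d & forall y, `|y - x| < d%:C%C -> P y.
Proof.
split=> [/nbhs_ballP[e /cplx_pos[d d0 ->] eP]|[d d0 dP]].
  exists d => // y yx; apply: eP; rewrite -ball_normE /=.
  by rewrite distrC.
apply/nbhs_ballP; exists (d%:C%C); first by rewrite /= ltcR.
by move=> y; rewrite -ball_normE /= distrC; exact: dP.
Qed.

Lemma near_diff (V W : normedModType C) (f : V -> W) (x : V) :
  differentiable f x -> forall e : R, 0 < e ->
  \forall y \near x, `|f y - f x - 'd f x (y - x)| <= e%:C%C * `|y - x|.
Proof.
move=> /diff_locally /eqaddoP fx e e0.
have e0' : 0 < (e%:C%C : C) by rewrite ltcR.
have /near_cplx[d d0 dP] : \forall h \near (0 : V),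
  `|(f \o shift x - (cst (f x) + 'd f x)) h| <= e%:C%C * `|h| := fx _ e0'.
apply/near_cplx; exists d => // y yx.
have := dP (y - x); rewrite subr0 => /(_ yx).
by rewrite !fctE /= subrK opprD addrA.
Qed.

Lemma diff_near (V W : normedModType C) (f : V -> W) (x : V)
    (L : {linear V -> W}) : continuous L ->
  (forall e : R, 0 < e ->
    \forall y \near x, `|f y - f x - L (y - x)| <= e%:C%C * `|y - x|) ->
  differentiable f x /\ 'd f x = L :> (V -> W).
Proof.
move=> Lc fL.
have h : f \o shift x = cst (f x) + L +o_ 0 id.
  apply/eqaddoP => e /cplx_pos[d d0 ->].
  have /near_cplx[r r0 rP] := fL d d0.
  apply/near_cplx; exists r => // y; rewrite subr0 => yr.
  have := rP (y + x); rewrite addrK => /(_ yr).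
  by rewrite !fctE /= opprD addrA.
have E := diff_unique Lc h; split=> //.
by apply/diff_locallyP; rewrite E.
Qed.

Lemma near_eq_diff (V W : normedModType C) (f g : V -> W) (x : V) :
  differentiable f x -> (\forall y \near x, f y = g y) ->
  differentiable g x /\ 'd g x = 'd f x :> (V -> W).
Proof.
move=> fd fg; apply: diff_near => [|e e0]; first exact: diff_continuous.
have fx : f x = g x by exact: nbhs_singleton fg.
near=> y; rewrite -(near fg y)// -fx.
by near: y; exact: (near_diff fd e0).
Unshelve. all: by end_near. Qed.

Lemma differentiable_bigsum (V : normedModType C) (I : finType) (g : I -> V -> C) (x : V) :
  (forall i, differentiable (g i) x) -> differentiable (fun y => \sum_i g i y) x.
Proof.
move=> gd; have -> : (fun y => \sum_i g i y) = \sum_i g i.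
  by apply/funext => y; rewrite fct_sumE.
elim/big_ind: _ => [|h k hd kd|i _]; [exact: differentiable_cst|exact: differentiableD|].
exact: gd.
Qed.

Lemma cdiff_differentiable (f : C -> C) (z : C) :
  cdiff_at f z <-> differentiable f z.
Proof.
split=> [[l fl]|fd].
  have fL e : 0 < e -> \forall y \near z, `|f y - f z - ( *:%R^~ l : C -> C) (y - z)| <= e%:C%C * `|y - z|.
    move=> e0; apply/near_cplx; have [d d0 dP] := fl e e0.
    exists d => // y; rewrite !normcE0 ltcR => /dP.
    by rewrite -rmorphM lecR /= mulrC.
  have sc : linear ( *:%R^~ l : C -> C) by move=> k x y; rewrite scalerDl scalerA.
  pose scM := GRing.isLinear.Build _ _ _ _ _ sc.
  pose L : {linear C -> C} := HB.pack ( *:%R^~ l : C -> C) scM.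
  have Lc : continuous L by exact: (@scalel_continuous _ C l).
  by have [] := @diff_near _ _ f z L Lc fL.
exists ('d f z 1) => e e0; have /near_cplx[d d0 dP] := near_diff fd e0.
exists d => // w wz; have := dP w; rewrite !normcE0 ltcR => /(_ wz).
rewrite -rmorphM lecR; congr (N (_ - _) <= _).
by rewrite -[in LHS](mulr1 (w - z)) linearZ /= mulrC.
Qed.

Lemma ccont_continuous (f : C -> C) (z : C) :
  ccont_at f z <-> {for z, continuous f}.
Proof.
split=> [fc|/(@cvgrPdist_lt _ C _ (nbhs z)) fc e e0].
  apply/(@cvgrPdist_lt _ C _ (nbhs z)) => e /cplx_pos[d d0 ->]; have [r r0 rP] := fc d d0.
  apply/(@near_cplx C z); exists r => // y; rewrite !normcE0 !ltcR => /rP.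
  by rewrite normc_dist.
have e0' : 0 < (e%:C%C : C) by rewrite ltcR.
have /(@near_cplx C z)[d d0 dP] := fc _ e0'; exists d => // w wz.
have := dP w; rewrite !normcE0 !ltcR => /(_ wz).
by rewrite normc_dist.
Qed.

Lemma cdiff_cont (f : C -> C) (z : C) : cdiff_at f z -> ccont_at f z.
Proof.
by move=> /cdiff_differentiable fd; apply/ccont_continuous/differentiable_continuous.
Qed.

Lemma ccont_cst (l z : C) : ccont_at (fun=> l) z.
Proof. by move=> e e0; exists 1 => // w _; rewrite subrr Normc.normc0. Qed.

Lemma ccont_id (z : C) : ccont_at id z. Proof. by move=> e; exists e. Qed.

Lemma ccontD (f g : C -> C) (z : C) : ccont_at f z -> ccont_at g z ->
  ccont_at (fun w => f w + g w) z.
Proof.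
move=> /ccont_continuous fc /ccont_continuous gc; apply/ccont_continuous.
exact: (cvgD fc gc).
Qed.

Lemma ccontM (f g : C -> C) (z : C) : ccont_at f z -> ccont_at g z ->
  ccont_at (fun w => f w * g w) z.
Proof.
move=> /ccont_continuous fc /ccont_continuous gc; apply/ccont_continuous.
exact: (cvgM fc gc).
Qed.

Lemma ccontZ (f : C -> C) (l z : C) : ccont_at f z -> ccont_at (fun w => l * f w) z.
Proof. exact: (ccontM (ccont_cst l z)). Qed.

Lemma cdiffM (f g : C -> C) (z : C) : cdiff_at f z -> cdiff_at g z ->
  cdiff_at (fun w => f w * g w) z.
Proof.
move=> /cdiff_differentiable fd /cdiff_differentiable gd.
by apply/cdiff_differentiable; exact: (differentiableM fd gd).
Qed.

Lemma cdiffD (f g : C -> C) (z : C) : cdiff_at f z -> cdiff_at g z ->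
  cdiff_at (fun w => f w + g w) z.
Proof.
move=> /cdiff_differentiable fd /cdiff_differentiable gd.
by apply/cdiff_differentiable; exact: (differentiableD fd gd).
Qed.

Lemma cdiffV (f : C -> C) (z : C) : cdiff_at f z -> f z != 0 ->
  cdiff_at (fun w => (f w)^-1) z.
Proof.
move=> /cdiff_differentiable fd f0.
by apply/cdiff_differentiable; exact: (differentiableV fd f0).
Qed.

Lemma cdiff_cst (l z : C) : cdiff_at (fun=> l) z.
Proof. by apply/cdiff_differentiable; exact: differentiable_cst. Qed.

Lemma cdiff_id (z : C) : cdiff_at id z.
Proof. by apply/cdiff_differentiable; exact: ex_diff. Qed.

End Bridge.

(** * The theorem of Goursat *)
Section Rectangle.
Context {R : realType}.
Local Notation C := (complex R).
Local Notation N := (@Normc.normc R).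
Local Notation Re := (@complex.Re R).
Local Notation Im := (@complex.Im R).
Local Notation "x :+ y" := (Complex (x : R) (y : R)) (at level 50).
Implicit Types (f g : C -> C) (z w l : C) (x y e d : R).

Definition rect x1 x2 y1 y2 z := (x1 <= Re z <= x2) && (y1 <= Im z <= y2).

Definition rect_bd x1 x2 y1 y2 z := rect x1 x2 y1 y2 z &&
  [|| Re z == x1, Re z == x2, Im z == y1 | Im z == y2].

Definition bd_cont f x1 x2 y1 y2 :=
  forall z, rect_bd x1 x2 y1 y2 z -> ccont_at f z.

Definition rect_int f x1 x2 y1 y2 : C :=
  seg_int x1 x2 (fun t => f (t :+ y1)) - seg_int x1 x2 (fun t => f (t :+ y2))
  + 'i%C * (seg_int y1 y2 (fun t => f (x2 :+ t))
            - seg_int y1 y2 (fun t => f (x1 :+ t))).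

Lemma normc_hdist (s t y : R) : N ((s :+ y) - (t :+ y)) = `|s - t|.
Proof. by rewrite /= subrr expr0n addr0 sqrtr_sqr. Qed.

Lemma normc_vdist (x s t : R) : N ((x :+ s) - (x :+ t)) = `|s - t|.
Proof. by rewrite /= subrr expr0n add0r sqrtr_sqr. Qed.

Lemma seg_continuous_h f x1 x2 y :
  (forall t, x1 <= t <= x2 -> ccont_at f (t :+ y)) ->
  seg_continuous x1 x2 (fun t => f (t :+ y)).
Proof.
move=> fc t tx e e0; have [d d0 dP] := fc t tx e e0.
by exists d => // s st; apply: dP; rewrite normc_hdist.
Qed.

Lemma seg_continuous_v f x y1 y2 :
  (forall t, y1 <= t <= y2 -> ccont_at f (x :+ t)) ->
  seg_continuous y1 y2 (fun t => f (x :+ t)).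
Proof.
move=> fc t tx e e0; have [d d0 dP] := fc t tx e e0.
by exists d => // s st; apply: dP; rewrite normc_vdist.
Qed.

Section OneRectangle.
Variables (x1 x2 y1 y2 : R) (x12 : x1 <= x2) (y12 : y1 <= y2).
Local Notation bdc f := (bd_cont f x1 x2 y1 y2).
Local Notation RI f := (rect_int f x1 x2 y1 y2).
Local Notation bd := (rect_bd x1 x2 y1 y2).

Lemma bd_bottom t : x1 <= t <= x2 -> bd (t :+ y1).
Proof. by move=> h; rewrite /rect_bd /rect /= h lexx y12 eqxx !orbT. Qed.

Lemma bd_top t : x1 <= t <= x2 -> bd (t :+ y2).
Proof. by move=> h; rewrite /rect_bd /rect /= h lexx y12 eqxx !orbT. Qed.

Lemma bd_left t : y1 <= t <= y2 -> bd (x1 :+ t).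
Proof. by move=> h; rewrite /rect_bd /rect /= h lexx x12 eqxx. Qed.

Lemma bd_right t : y1 <= t <= y2 -> bd (x2 :+ t).
Proof. by move=> h; rewrite /rect_bd /rect /= h lexx x12 eqxx orbT. Qed.

Lemma bd_cont_sides f : bdc f ->
  [/\ seg_continuous x1 x2 (fun t => f (t :+ y1)),
      seg_continuous x1 x2 (fun t => f (t :+ y2)),
      seg_continuous y1 y2 (fun t => f (x1 :+ t)) &
      seg_continuous y1 y2 (fun t => f (x2 :+ t))].
Proof.
move=> fc; split.
- by apply: seg_continuous_h => t h; apply/fc/bd_bottom.
- by apply: seg_continuous_h => t h; apply/fc/bd_top.
- by apply: seg_continuous_v => t h; apply/fc/bd_left.
- by apply: seg_continuous_v => t h; apply/fc/bd_right.
Qed.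

Lemma rect_int_eq f g : (forall z, bd z -> f z = g z) -> RI f = RI g.
Proof.
move=> fg; rewrite /rect_int; congr (_ - _ + _ * (_ - _));
  apply: seg_int_eq => t h; apply: fg.
- exact: bd_bottom.
- exact: bd_top.
- exact: bd_right.
- exact: bd_left.
Qed.

Lemma rect_intD f g : bdc f -> bdc g -> RI (fun z => f z + g z) = RI f + RI g.
Proof.
move=> /bd_cont_sides[? ? ? ?] /bd_cont_sides[? ? ? ?].
by rewrite /rect_int !seg_intD//; ring.
Qed.

Lemma rect_intZ f l : bdc f -> RI (fun z => l * f z) = l * RI f.
Proof.
by move=> /bd_cont_sides[? ? ? ?]; rewrite /rect_int !seg_intZ//; ring.
Qed.

Lemma rect_int_bound f (M : R) : bdc f -> (forall z, bd z -> N (f z) <= M) ->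
  N (RI f) <= 4 * M * ((x2 - x1) + (y2 - y1)).
Proof.
move=> /bd_cont_sides[c1 c2 c3 c4] fM.
have b1 := seg_int_bound x12 c1 (fun t h => fM _ (bd_bottom h)).
have b2 := seg_int_bound x12 c2 (fun t h => fM _ (bd_top h)).
have b3 := seg_int_bound y12 c3 (fun t h => fM _ (bd_left h)).
have b4 := seg_int_bound y12 c4 (fun t h => fM _ (bd_right h)).
rewrite /rect_int; apply: le_trans (normcD _ _) _.
rewrite Normc.normcM normc_i mul1r.
apply: le_trans (lerD (normcB _ _) (normcB _ _)) _.
apply: le_trans (lerD (lerD b1 b2) (lerD b4 b3)) _.
by rewrite le_eqVlt; apply/orP; left; apply/eqP; ring.
Qed.

Lemma rect_int_cst l : RI (fun=> l) = 0.
Proof. by rewrite /rect_int !seg_int_cst//; ring. Qed.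

Lemma rect_int_id : RI id = 0.
Proof.
have c f z : f = id -> ccont_at f z by move=> ->; exact: ccont_id.
have [c1 c2 c3 c4] : [/\ seg_continuous x1 x2 (fun t => t :+ y1),
      seg_continuous x1 x2 (fun t => t :+ y2),
      seg_continuous y1 y2 (fun t => x1 :+ t) &
      seg_continuous y1 y2 (fun t => x2 :+ t)].
  by apply: (@bd_cont_sides id) => z _; exact: c.
rewrite /rect_int -!seg_intB//.
rewrite (@seg_int_eq _ _ _ _ (fun=> 0 :+ (y1 - y2))); last first.
  by move=> t _; apply/eqP; rewrite eq_complex /= subrr !eqxx.
rewrite [X in _ + 'i%C * X](@seg_int_eq _ _ _ _ (fun=> (x2 - x1) :+ 0)); last first.
  by move=> t _; apply/eqP; rewrite eq_complex /= subrr !eqxx.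
rewrite !seg_int_cst//; apply/eqP; rewrite eq_complex /=.
by apply/andP; split; apply/eqP; ring.
Qed.

End OneRectangle.

Lemma rect_int_split_x f x1 c x2 y1 y2 : x1 <= c <= x2 -> y1 <= y2 ->
  bd_cont f x1 x2 y1 y2 ->
  rect_int f x1 x2 y1 y2 = rect_int f x1 c y1 y2 + rect_int f c x2 y1 y2.
Proof.
move=> cx y12 fc; have x12 : x1 <= x2 by lra.
have [c1 c2 c3 c4] := bd_cont_sides x12 y12 fc.
rewrite /rect_int (seg_int_cat cx c1) (seg_int_cat cx c2); ring.
Qed.

Lemma rect_int_split_y f x1 x2 y1 c y2 : x1 <= x2 -> y1 <= c <= y2 ->
  bd_cont f x1 x2 y1 y2 ->
  rect_int f x1 x2 y1 y2 = rect_int f x1 x2 y1 c + rect_int f x1 x2 c y2.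
Proof.
move=> x12 cy fc; have y12 : y1 <= y2 by lra.
have [c1 c2 c3 c4] := bd_cont_sides x12 y12 fc.
rewrite /rect_int (seg_int_cat cy c3) (seg_int_cat cy c4); ring.
Qed.

End Rectangle.

Section Goursat.
Context {R : realType}.
Local Notation C := (complex R).
Local Notation N := (@Normc.normc R).
Local Notation "x :+ y" := (Complex (x : R) (y : R)) (at level 50).
Implicit Types (f g : C -> C) (z w l : C) (x y e d : R).

Lemma nested_intervals (a b : nat -> R) :
  (forall n, a n <= a n.+1) -> (forall n, b n.+1 <= b n) ->
  (forall n, a n <= b n) -> exists X : R, forall n, a n <= X <= b n.
Proof.
move=> ai bd ab.
have am n m : (n <= m)%N -> a n <= a m.
  elim: m => [|m IH]; first by rewrite leqn0 => /eqP->.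
  by rewrite leq_eqVlt => /predU1P[->//|/IH h]; exact: le_trans h (ai m).
have bm n m : (n <= m)%N -> b m <= b n.
  elim: m => [|m IH]; first by rewrite leqn0 => /eqP->.
  by rewrite leq_eqVlt => /predU1P[->//|/IH h]; exact: le_trans (bd m) h.
have anb n m : a n <= b m.
  have [h|/ltnW h] := leqP n m; first exact: le_trans (am _ _ h) (ab m).
  exact: le_trans (ab n) (bm _ _ h).
exists (sup (range a)) => n; apply/andP; split.
  apply: ub_le_sup; last by exists n.
  by exists (b 0) => _ [m _ <-].
by apply: ge_sup; [exists (a 0); exists 0 | move=> _ [m _ <-]].
Qed.

Lemma cdiff_bd_cont f x1 x2 y1 y2 :
  (forall z, rect x1 x2 y1 y2 z -> cdiff_at f z) -> bd_cont f x1 x2 y1 y2.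
Proof. by move=> fd z /andP[/fd + _]; exact: cdiff_cont. Qed.

Lemma rect_sub x1 x2 y1 y2 x1' x2' y1' y2' z :
  x1 <= x1' -> x2' <= x2 -> y1 <= y1' -> y2' <= y2 ->
  rect x1' x2' y1' y2' z -> rect x1 x2 y1 y2 z.
Proof.
by rewrite /rect => ? ? ? ? /andP[/andP[? ?] /andP[? ?]];
   apply/andP; split; apply/andP; split; lra.
Qed.

(** The boundary integrals of the four quarters add up to that of the
    rectangle, so they cannot all be smaller than a quarter of it. *)
Lemma rect_quarter f x y (w h A : R) : 0 <= w -> 0 <= h ->
  (forall z, rect x (x + w) y (y + h) z -> cdiff_at f z) ->
  A <= N (rect_int f x (x + w) y (y + h)) ->
  exists x' y', [/\ x' = x \/ x' = x + w / 2, y' = y \/ y' = y + h / 2 &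
    A <= 4 * N (rect_int f x' (x' + w / 2) y' (y' + h / 2))].
Proof.
move=> w0 h0 fd AN.
have bc x1 x2 y1 y2 : x <= x1 -> x2 <= x + w -> y <= y1 -> y2 <= y + h ->
    bd_cont f x1 x2 y1 y2.
  by move=> ? ? ? ?; apply: cdiff_bd_cont => z zr; apply: fd; exact: rect_sub zr.
have ew : x + w = x + w / 2 + w / 2 by lra.
have eh : y + h = y + h / 2 + h / 2 by lra.
have E : rect_int f x (x + w) y (y + h) =
    rect_int f x (x + w / 2) y (y + h / 2)
    + rect_int f x (x + w / 2) (y + h / 2) (y + h / 2 + h / 2)
    + (rect_int f (x + w / 2) (x + w / 2 + w / 2) y (y + h / 2)
    + rect_int f (x + w / 2) (x + w / 2 + w / 2) (y + h / 2) (y + h / 2 + h / 2)).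
  rewrite -ew -eh (@rect_int_split_x _ _ _ (x + w / 2)); [|lra|lra|by apply: bc; lra].
  rewrite (@rect_int_split_y _ _ _ _ _ (y + h / 2) (y + h));
    [|lra|lra|by apply: bc; lra].
  by congr (_ + _); rewrite (@rect_int_split_y _ _ _ _ _ (y + h / 2) (y + h));
    [|lra|lra|by apply: bc; lra].
move: AN; rewrite E => AN.
have := le_trans AN (le_trans (normcD _ _) (lerD (normcD _ _) (normcD _ _))).
move=> A4; apply: contrapT => no.
have q x' y' : x' = x \/ x' = x + w / 2 -> y' = y \/ y' = y + h / 2 ->
    4 * N (rect_int f x' (x' + w / 2) y' (y' + h / 2)) < A.
  by move=> x'E y'E; rewrite ltNge; apply/negP => ?; apply: no; exists x', y'.
have := q _ _ (or_introl erefl) (or_introl erefl).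
have := q _ _ (or_introl erefl) (or_intror erefl).
have := q _ _ (or_intror erefl) (or_introl erefl).
have := q _ _ (or_intror erefl) (or_intror erefl).
move: (N (rect_int _ x (x + w / 2) y _)) (N (rect_int _ (x + w / 2) _ y _)) A4.
move: (N (rect_int _ _ _ (y + h / 2) _)) (N (rect_int _ (x + w / 2) _ (y + h / 2) _)).
clear => a1 a2 a3 a4; lra.
Qed.

(** If the boundary integral did not vanish, repeated quartering would produce
    rectangles, shrinking to a point, whose boundary integrals decrease at most
    like their areas. At that point the function agrees with an affine one,
    whose boundary integrals vanish, up to an error of smaller order. *)
Theorem goursat f x1 x2 y1 y2 : x1 <= x2 -> y1 <= y2 ->
  (forall z, rect x1 x2 y1 y2 z -> cdiff_at f z) -> rect_int f x1 x2 y1 y2 = 0.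
Proof.
move=> x12 y12 fd; apply/eqP; rewrite -normc_eq0 eq_le normc_ge0 andbT leNgt.
apply/negP => A0; set A := N _ in A0.
pose w := x2 - x1; pose h := y2 - y1.
have w0 : 0 <= w by rewrite subr_ge0.
have h0 : 0 <= h by rewrite subr_ge0.
pose P n (p : R * R) := [/\ x1 <= p.1, p.1 + w / 2 ^+ n <= x2, y1 <= p.2,
  p.2 + h / 2 ^+ n <= y2 &
  A <= 4 ^+ n * N (rect_int f p.1 (p.1 + w / 2 ^+ n) p.2 (p.2 + h / 2 ^+ n))].
have wn0 n (v : R) : 0 <= v -> 0 <= v / 2 ^+ n.
  by move=> v0; rewrite divr_ge0// exprn_ge0.
have half n (v : R) : v / 2 ^+ n.+1 = v / 2 ^+ n / 2.
  by rewrite exprSr invfM mulrA.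
have step (np : nat * (R * R)) : exists q : R * R, P np.1 np.2 ->
    [/\ P np.1.+1 q, np.2.1 <= q.1, q.1 + w / 2 ^+ np.1.+1 <= np.2.1 + w / 2 ^+ np.1,
        np.2.2 <= q.2 & q.2 + h / 2 ^+ np.1.+1 <= np.2.2 + h / 2 ^+ np.1].
  case: np => n p /=; have [Pn|] := pselect (P n p); last by exists p.
  case: Pn => p1 p2 p3 p4 p5.
  have d4 : (0 : R) < 4 ^+ n by rewrite exprn_gt0.
  move: p5; rewrite mulrC -ler_pdivrMr// => p5.
  have wn := wn0 n w w0; have hn := wn0 n h h0.
  have fq z : rect p.1 (p.1 + w / 2 ^+ n) p.2 (p.2 + h / 2 ^+ n) z -> cdiff_at f z.
    by move=> zr; apply: fd; exact: rect_sub zr.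
  have [x' [y' [x'E y'E qP]]] := rect_quarter wn hn fq p5.
  exists (x', y') => _; rewrite /P /= !half; move: qP.
  rewrite ler_pdivrMr// mulrAC -exprS => qP.
  have corner (a a' v : R) : 0 <= v -> a' = a \/ a' = a + v / 2 ->
      a <= a' /\ a' + v / 2 <= a + v.
    by clear => v0 [->|->]; split; lra.
  have [c1 c2] := corner _ _ _ wn x'E; have [c3 c4] := corner _ _ _ hn y'E.
  split => //; split => //.
  - exact: le_trans p1 c1.
  - exact: le_trans c2 p2.
  - exact: le_trans p3 c3.
  - exact: le_trans c4 p4.
have [nx nxP] := choice step.
pose s := fix s n := if n is m.+1 then nx (m, s m) else (x1, y1).
have sP n : P n (s n).
  elim: n => [|n IH]; last by have [] := nxP (n, s n) IH.
  by rewrite /P /= !expr0 !divr1 mul1r /w /h !subrKC; split => //; rewrite lexx.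
have sQ n := nxP (n, s n) (sP n).
have [X XP] : exists X : R, forall n, (s n).1 <= X <= (s n).1 + w / 2 ^+ n.
  apply: nested_intervals => n; rewrite ?lerDl ?wn0//.
  - by have [] := sQ n.
  - by have [] := sQ n.
have [Y YP] : exists X : R, forall n, (s n).2 <= X <= (s n).2 + h / 2 ^+ n.
  apply: nested_intervals => n; rewrite ?lerDl ?wn0//.
  - by have [] := sQ n.
  - by have [] := sQ n.
have z0r : rect x1 x2 y1 y2 (X :+ Y).
  have := XP 0; have := YP 0; rewrite /rect /= !expr0 !divr1 /w /h !subrKC => -> ->//.
have [l fl] := fd _ z0r.
pose S := w + h; have S0 : 0 <= S by rewrite addr_ge0.
(* The boundary integrals of the rectangles are eventually at most
   e * 4 * S ^+ 2 / 4 ^+ n, against the lower bound A / 4 ^+ n. *)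
have T0 : 0 < 4 * S ^+ 2 + 1 by rewrite ltr_wpDl// mulr_ge0// sqr_ge0.
have [d d0 dP] := fl (A / (4 * S ^+ 2 + 1)) (divr_gt0 A0 T0).
set e := A / _ in dP; have e0 : 0 < e by rewrite divr_gt0.
have [n Sn] : exists n, S / 2 ^+ n < d.
  pose n := Num.bound (S / d); exists n.
  rewrite ltr_pdivrMr ?exprn_gt0// -ltr_pdivrMl// mulrC.
  apply: lt_le_trans (archi_boundP _) _; first by rewrite divr_ge0// ltW.
  by rewrite -natrX ler_nat ltnW// ltn_expl.
have [p1 p2 p3 p4 p5] := sP n; have := XP n; have := YP n.
set x := (s n).1 in p1 p2 p5 *; set y := (s n).2 in p3 p4 p5 *.
set wn := w / _ in p2 p5 *; set hn := h / _ in p4 p5 *.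
have wn1 : 0 <= wn by exact: wn0.
have hn1 : 0 <= hn by exact: wn0.
have SE : S / 2 ^+ n = wn + hn by rewrite /S mulrDl.
move=> Yy Xx.
pose g z := f z - f (X :+ Y) - l * (z - (X :+ Y)).
have sub z : rect x (x + wn) y (y + hn) z -> rect x1 x2 y1 y2 z.
  exact: rect_sub.
have near z : rect x (x + wn) y (y + hn) z -> N (z - (X :+ Y)) <= wn + hn.
  move=> zr; apply: le_trans (normc_le _) _; case: z zr => a b /andP[/= ax byh].
  have corner (u v t : R) : u <= t <= u + v -> forall r, u <= r <= u + v ->
      `|r - t| <= v.
    by clear => ? r ?; rewrite ler_norml; apply/andP; split; lra.
  by rewrite lerD//; [exact: corner Xx _ ax|exact: corner Yy _ byh].
have gN z : rect x (x + wn) y (y + hn) z -> N (g z) <= e * (wn + hn).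
  move=> /near zn; apply: le_trans (dP _ _) _; first by rewrite (le_lt_trans zn)// -SE.
  by rewrite ler_pM2l.
have xw : x <= x + wn by rewrite lerDl.
have yh : y <= y + hn by rewrite lerDl.
have fc : bd_cont f x (x + wn) y (y + hn).
  by apply: cdiff_bd_cont => z /sub; exact: fd.
have E : rect_int g x (x + wn) y (y + hn) = rect_int f x (x + wn) y (y + hn).
  transitivity (rect_int (fun z => f z + ((- f (X :+ Y) + l * (X :+ Y)) + (- l) * z))
    x (x + wn) y (y + hn)).
    by apply: rect_int_eq => // z _; rewrite /g; ring.
  have cid : bd_cont (fun z => - l * z) x (x + wn) y (y + hn).
    by move=> z _; apply: ccontZ; exact: ccont_id.
  have cc : bd_cont (fun=> - f (X :+ Y) + l * (X :+ Y)) x (x + wn) y (y + hn).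
    by move=> z _; exact: ccont_cst.
  rewrite rect_intD//; last by move=> z zb; apply: ccontD; [exact: cc|exact: cid].
  rewrite rect_intD// rect_int_cst// rect_intZ//; last by move=> z _; exact: ccont_id.
  by rewrite rect_int_id// mulr0 !addr0.
have gc : bd_cont g x (x + wn) y (y + hn).
  move=> z zb; have := ccontD (fc z zb) (ccontD (ccont_cst (- f (X :+ Y) + l * (X :+ Y)) z)
    (ccontZ (- l) (ccont_id z))).
  by congr ccont_at; apply/funext => v; rewrite /g; ring.
have := rect_int_bound xw yh gc (fun z zb => gN z (proj1 (andP zb))).
rewrite E => IN.
have : A <= 4 ^+ n * (4 * (e * (wn + hn)) * (x + wn - x + (y + hn - y))).
  by apply: le_trans p5 _; rewrite ler_pM2l ?exprn_gt0.
have -> : 4 ^+ n * (4 * (e * (wn + hn)) * (x + wn - x + (y + hn - y)))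
    = e * (4 * S ^+ 2) * (4 ^+ n / (2 ^+ n * 2 ^+ n)).
  have -> : x + wn - x + (y + hn - y) = wn + hn by ring.
  by rewrite -SE; field; rewrite expf_neq0.
rewrite -exprMn -natrM divff ?expf_neq0// mulr1 /e mulrAC ler_pdivlMr//.
by rewrite ler_pM2l// leNgt ltrDl ltr01.
Qed.

End Goursat.

(** * Cauchy estimates in one variable *)
Section Cauchy.
Context {R : realType}.
Local Notation C := (complex R).
Local Notation N := (@Normc.normc R).
Local Notation Re := (@complex.Re R).
Local Notation Im := (@complex.Im R).
Implicit Types (f g q : C -> C) (z w l h : C).

(** The theorem of Goursat applies to the four rectangles around the inner one. *)
Lemma rect_int_shrink f (x1 a b x2 y1 c d y2 : R) :
  x1 <= a -> a <= b -> b <= x2 -> y1 <= c -> c <= d -> d <= y2 ->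
  (forall z, rect x1 x2 y1 y2 z ->
     [\/ Re z <= a, b <= Re z, Im z <= c | d <= Im z] -> cdiff_at f z) ->
  rect_int f x1 x2 y1 y2 = rect_int f a b c d.
Proof.
move=> xa ab bx yc cd dy fd.
have bc x1' x2' y1' y2' : x1 <= x1' -> x2' <= x2 -> y1 <= y1' -> y2' <= y2 ->
    (x1' <= a \/ x1' = b) -> (x2' = a \/ b <= x2') ->
    (y1' <= c \/ y1' = d) -> (y2' = c \/ d <= y2') ->
    bd_cont f x1' x2' y1' y2'.
  move=> ? ? ? ? h1 h2 h3 h4 z zb; have /andP[zr zs] := zb.
  apply/cdiff_cont/fd; first exact: rect_sub zr.
  case/or4P: zs => /eqP ->.
  - by case: h1 => [?|->]; [constructor 1|constructor 2].
  - by case: h2 => [->|?]; [constructor 1|constructor 2].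
  - by case: h3 => [?|->]; [constructor 3|constructor 4].
  - by case: h4 => [->|?]; [constructor 3|constructor 4].
rewrite (@rect_int_split_x _ _ x1 a); [|lra|lra|by apply: bc; lra].
rewrite goursat ?add0r; [|lra|lra|]; last first.
  move=> z zr; apply: fd; first by apply: rect_sub zr; lra.
  by constructor 1; case/andP: zr => /andP[].
rewrite (@rect_int_split_x _ _ a b x2); [|lra|lra|by apply: bc; lra].
rewrite [X in _ + X]goursat ?addr0; [|lra|lra|]; last first.
  move=> z zr; apply: fd; first by apply: rect_sub zr; lra.
  by constructor 2; case/andP: zr => /andP[].
rewrite (@rect_int_split_y _ _ _ _ y1 c); [|lra|lra|by apply: bc; lra].
rewrite goursat ?add0r; [|lra|lra|]; last first.
  move=> z zr; apply: fd; first by apply: rect_sub zr; lra.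
  by constructor 3; case/andP: zr => _ /andP[].
rewrite (@rect_int_split_y _ _ _ _ c d y2); [|lra|lra|by apply: bc; lra].
rewrite [X in _ + X]goursat ?addr0//.
move=> z zr; apply: fd; first by apply: rect_sub zr; lra.
by constructor 4; case/andP: zr => _ /andP[].
Qed.

Local Notation Q := (rect (-1 : R) 1 (-1) 1).
Local Notation bdQ := (rect_bd (-1 : R) 1 (-1) 1).
Local Notation RQ f := (rect_int f (-1 : R) 1 (-1) 1).

Definition central h := rect (-2^-1 : R) 2^-1 (-2^-1) 2^-1 h.

Lemma central0 : central 0.
Proof. by rewrite /central /rect /=; apply/andP; split; apply/andP; split; lra. Qed.

Lemma central_in h : central h -> Q h.
Proof. by apply: rect_sub; lra. Qed.

Lemma bd_dist (x1 x2 y1 y2 r : R) z h : x1 <= Re h - r -> Re h + r <= x2 ->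
  y1 <= Im h - r -> Im h + r <= y2 -> rect_bd x1 x2 y1 y2 z -> r <= N (z - h).
Proof.
move=> h1 h2 h3 h4 /andP[_ zs].
have := normc_Re (z - h); rewrite raddfB /= => hr.
have := normc_Im (z - h); rewrite raddfB /= => hi.
case/or4P: zs hr hi => /eqP -> hr hi.
- by apply: le_trans hr; rewrite ler_normr; apply/orP; right; lra.
- by apply: le_trans hr; rewrite ler_normr; apply/orP; left; lra.
- by apply: le_trans hi; rewrite ler_normr; apply/orP; right; lra.
- by apply: le_trans hi; rewrite ler_normr; apply/orP; left; lra.
Qed.

Lemma bd_central z h : bdQ z -> central h -> 2^-1 <= N (z - h).
Proof.
by move=> zb /andP[/andP[h1 h2] /andP[h3 h4]]; apply: bd_dist zb; lra.
Qed.

Lemma bd_central_neq z h : bdQ z -> central h -> z - h != 0.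
Proof.
move=> zb hc; rewrite -normc_eq0; apply/eqP => E.
by have := bd_central zb hc; rewrite E; lra.
Qed.

Lemma small_box_norm z h (r : R) : 0 < r ->
  rect_bd (Re h - r) (Re h + r) (Im h - r) (Im h + r) z ->
  r <= N (z - h) <= r + r.
Proof.
move=> r0 zb; rewrite (bd_dist _ _ _ _ zb); try lra.
case/andP: zb => /andP[/andP[h1 h2] /andP[h3 h4]] _.
apply: le_trans (normc_le _) _; rewrite !raddfB /=.
by apply: lerD; rewrite ler_norml; apply/andP; split; lra.
Qed.

(** A singularity weaker than a simple pole contributes nothing: the integral
    over the unit square is the integral over arbitrarily small squares around
    the singular point. *)
Lemma rect_int_removable f h : central h ->
  (forall z, Q z -> z != h -> cdiff_at f z) ->
  (forall e : R, 0 < e -> exists2 d : R, 0 < d &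
     forall z, z != h -> N (z - h) < d -> N (f z) * N (z - h) <= e) ->
  RQ f = 0.
Proof.
move=> hc fd fe; apply/eqP; rewrite -normc_eq0 eq_le normc_ge0 andbT leNgt.
apply/negP => A0; set A := N _ in A0.
have [d d0 dP] := fe (A / 32) ltac:(lra).
pose r := Num.min (d / 4) (1 / 4).
have [r0 rd r1] : [/\ 0 < r, r <= d / 4 & r <= 1 / 4].
  by rewrite /r lt_min ge_min lexx ge_min lexx orbT; split=> //; apply/andP; split; lra.
have /andP[/andP[h1 h2] /andP[h3 h4]] := hc.
have zh z : rect_bd (Re h - r) (Re h + r) (Im h - r) (Im h + r) z -> z != h.
  by move=> zb; have := small_box_norm r0 zb; rewrite -subr_eq0 -normc_eq0 => ?;
    apply/eqP; lra.
have E : RQ f = rect_int f (Re h - r) (Re h + r) (Im h - r) (Im h + r).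
  apply: rect_int_shrink; try lra.
  move=> z zr zs; apply: fd => //; apply/eqP => zE; rewrite zE in zs.
  by case: zs; lra.
have bc : bd_cont f (Re h - r) (Re h + r) (Im h - r) (Im h + r).
  move=> z zb; apply/cdiff_cont/fd; last exact: zh.
  by apply: (rect_sub _ _ _ _ (proj1 (andP zb))); lra.
have fr z : rect_bd (Re h - r) (Re h + r) (Im h - r) (Im h + r) z ->
    N (f z) <= A / 32 / r.
  move=> zb; have zne := zh z zb.
  have /andP[z1 z2] := small_box_norm r0 zb.
  rewrite ler_pdivlMr//; apply: le_trans (dP z zne _); last lra.
  by rewrite ler_wpM2l// normc_ge0.
have xw : Re h - r <= Re h + r by lra.
have yw : Im h - r <= Im h + r by lra.
have := rect_int_bound xw yw bc fr.
rewrite -E -/A.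
have -> : 4 * (A / 32 / r) * (Re h + r - (Re h - r) + (Im h + r - (Im h - r)))
  = A / 2 by field; rewrite gt_eqF.
by lra.
Qed.

Definition cauchy_kernel h z : C := (z - h)^-1.

Lemma cdiff_kernel h z : z != h -> cdiff_at (cauchy_kernel h) z.
Proof.
move=> zh; apply: cdiffV; last by rewrite subr_eq0.
by apply: (cdiffD (@cdiff_id R z)); exact: cdiff_cst.
Qed.

Lemma ccont_kernel h z : central h -> bdQ z -> ccont_at (cauchy_kernel h) z.
Proof.
move=> hc zb; apply/cdiff_cont/cdiff_kernel.
by rewrite -subr_eq0; exact: bd_central_neq.
Qed.

(** Cauchy's formula for a function vanishing at [h]: the pole of the kernel is
    compensated. *)
Lemma rect_int_kernel0 q h : central h -> (forall z, Q z -> cdiff_at q z) ->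
  q h = 0 -> RQ (fun z => q z * cauchy_kernel h z) = 0.
Proof.
move=> hc qd qh; apply: (rect_int_removable hc) => [z zQ zh|e e0].
  by apply: cdiffM; [exact: qd|exact: cdiff_kernel].
have [d d0 dP] := cdiff_cont (qd h (central_in hc)) e0.
exists d => // z zh /dP; rewrite qh subr0 => /ltW; apply: le_trans.
by rewrite -Normc.normcM -mulrA mulVf ?mulr1 ?subr_eq0.
Qed.

Lemma rect_int_kernel00 q : (forall z, Q z -> cdiff_at q z) ->
  q 0 = 0 -> cderiv_at q 0 0 ->
  RQ (fun z => q z * (cauchy_kernel 0 z * cauchy_kernel 0 z)) = 0.
Proof.
move=> qd q0 dq0; apply: (rect_int_removable central0) => [z zQ zh|e e0].
  by apply: cdiffM; [exact: qd|apply: cdiffM; exact: cdiff_kernel].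
have [d d0 dP] := dq0 e e0; exists d => // z z0 /dP.
rewrite q0 mul0r !subr0 -Normc.normcM.
have -> : q z * (cauchy_kernel 0 z * cauchy_kernel 0 z) * z = q z * z^-1.
  by rewrite /cauchy_kernel subr0; field.
by rewrite Normc.normcM Normc.normcV ler_pdivrMr// normc_gt0.
Qed.

End Cauchy.

Section CauchyDiff.
Context {R : realType}.
Local Notation C := (complex R).
Local Notation N := (@Normc.normc R).
Local Notation Im := (@complex.Im R).
Local Notation "x :+ y" := (Complex (x : R) (y : R)) (at level 50).
Implicit Types (f g q : C -> C) (z w l h : C).
Local Notation Q := (rect (-1 : R) 1 (-1) 1).
Local Notation bdQ := (rect_bd (-1 : R) 1 (-1) 1).
Local Notation RQ f := (rect_int f (-1 : R) 1 (-1) 1).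
Local Notation bcQ f := (bd_cont f (-1 : R) 1 (-1) 1).

Let N11 : -1 <= (1 : R). Proof. lra. Qed.

(** A lower bound for an integral, to prove that the winding numbers below do not
    vanish without computing them. *)
Lemma seg_int_Im_ge (a b m : R) (u : R -> C) : a <= b -> seg_continuous a b u ->
  (forall t : R, a <= t <= b -> m <= Im (u t)) ->
  m * (b - a) <= Im (seg_int a b u).
Proof.
move=> ab uc um; rewrite /= -(fine_measure_seg ab) -Rintegral_cst//.
apply: le_Rintegral => //; last exact: (seg_continuous_Im uc).
apply: seg_integrable => t _ e e0; exists 1 => // s _.
by rewrite subrr normr0.
Qed.

(** With x and y the coordinates of z - h along and across a side of the square,
    this is the rate at which the argument of z - h increases. *)
Lemma normalized_ge (x y : R) : -(3/2) <= x <= 3/2 -> 1/2 <= y <= 3/2 ->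
  9^-1 <= y / (x ^+ 2 + y ^+ 2).
Proof.
move=> hx hy; have p : 0 < x ^+ 2 + y ^+ 2.
  by rewrite ltr_wpDl ?sqr_ge0// exprn_gt0; lra.
by rewrite ler_pdivlMr//; nra.
Qed.

Lemma cauchy_kernelE (a b x y : R) : cauchy_kernel (a :+ b) (x :+ y) =
  ((x - a) / ((x - a) ^+ 2 + (y - b) ^+ 2))
  :+ (- ((y - b) / ((x - a) ^+ 2 + (y - b) ^+ 2))).
Proof. by []. Qed.

Definition winding h := RQ (cauchy_kernel h).

(** The rate of increase of the argument of z - h along the boundary is at least
    1/9 on each of the four sides, which have length 2. *)
Lemma winding_ge h : central h -> 8 / 9 <= Im (winding h).
Proof.
move=> hc; have kc : bcQ (cauchy_kernel h) by move=> z; exact: ccont_kernel.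
have [c1 c2 c3 c4] := bd_cont_sides N11 N11 kc.
have c1B := seg_continuousZ (-1) c2; have c3B := seg_continuousZ (-1) c3.
have c12 := seg_continuousD c1 c1B.
have c34 := seg_continuousZ 'i%C (seg_continuousD c4 c3B).
have -> : winding h = seg_int (-1) 1 (fun t => cauchy_kernel h (t :+ -1)
    + -1 * cauchy_kernel h (t :+ 1) + 'i%C * (cauchy_kernel h (1 :+ t)
    + -1 * cauchy_kernel h ((-1) :+ t))).
  rewrite (seg_intD c12 c34) (seg_intD c1 c1B) (seg_intZ _ c2).
  rewrite (seg_intZ _ (seg_continuousD c4 c3B)) (seg_intD c4 c3B) (seg_intZ _ c3).
  by rewrite /winding /rect_int; ring.
have -> : 8 / 9 = 4 / 9 * (1 - (-1)) :> R by field.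
apply: seg_int_Im_ge => //; first exact: seg_continuousD.
move=> t ht; case: h hc {kc c1 c2 c3 c4 c1B c3B c12 c34} => a b /andP[].
have h1 := @normalized_ge (t - a) (1 + b).
have h2 := @normalized_ge (t - a) (1 - b).
have h3 := @normalized_ge (t - b) (1 - a).
have h4 := @normalized_ge (t - b) (1 + a).
rewrite !cauchy_kernelE /= => ha hb.
have e1 : (-1 - b) = - (1 + b) by ring.
have e4 : (-1 - a) = - (1 + a) by ring.
rewrite e1 e4 !sqrrN !mulNr opprK.
rewrite [(1 - a) ^+ 2 + _]addrC [(1 + a) ^+ 2 + _]addrC.
have {}h1 := h1 ltac:(lra) ltac:(lra); have {}h2 := h2 ltac:(lra) ltac:(lra).
have {}h3 := h3 ltac:(lra) ltac:(lra); have {}h4 := h4 ltac:(lra) ltac:(lra).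
clear e1 e4; lra.
Qed.

Lemma winding_norm h : central h -> 8 / 9 <= N (winding h).
Proof.
move=> /winding_ge hc; apply: le_trans hc _.
by apply: le_trans (ler_norm _) _; exact: normc_Im.
Qed.

Lemma winding_neq0 h : central h -> winding h != 0.
Proof.
by move=> /winding_norm hc; rewrite -normc_eq0; apply/eqP => E; lra.
Qed.

Local Notation k0 := (cauchy_kernel (0 : C)).

(** Cauchy's formula for the derivative at the centre of the square, applied to
    g - g 0, the integral of 1/z standing for 2 i pi. *)
Definition cauchy_diff g :=
  (RQ (fun z => g z * (k0 z * k0 z)) - g 0 * RQ (fun z => k0 z * k0 z))
  / winding 0.

Lemma bd_cont_k00 : bcQ (fun z => k0 z * k0 z).
Proof. by move=> z zb; apply: ccontM; apply: ccont_kernel => //; exact: central0. Qed.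

Lemma bd_contM f g : bcQ f -> bcQ g -> bcQ (fun z => f z * g z).
Proof. by move=> fc gc z zb; apply: ccontM; [exact: fc|exact: gc]. Qed.

Lemma taylor_remainder g l : (forall z, Q z -> cdiff_at g z) -> cderiv_at g 0 l ->
  let q z := g z - g 0 - l * z in
  [/\ forall z, Q z -> cdiff_at q z, q 0 = 0 & cderiv_at q 0 0].
Proof.
move=> gd gl q; have qE : q = (fun z => g z + (- g 0 + - l * z)).
  by apply/funext => z; rewrite /q; ring.
have q0 : q 0 = 0 by rewrite /q mulr0 subrr subr0.
split=> // [z zQ|e /gl[d d0 dP]]; last first.
  by exists d => // w /dP; rewrite q0 /q mul0r !subr0.
rewrite qE; apply: cdiffD; first exact: gd.
apply: cdiffD; first exact: cdiff_cst.
by apply: (cdiffM _ (@cdiff_id R z)); exact: cdiff_cst.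
Qed.

Lemma cauchy_diffE g l : (forall z, Q z -> cdiff_at g z) ->
  cderiv_at g 0 l -> cauchy_diff g = l.
Proof.
move=> gd gl; pose q z := g z - g 0 - l * z.
have [qd q0 dq0] := taylor_remainder gd gl.
have gc := bd_contM (cdiff_bd_cont gd) bd_cont_k00.
have kc : bcQ k0 by move=> z zb; apply: ccont_kernel => //; exact: central0.
have := rect_int_kernel00 qd q0 dq0.
rewrite (@rect_int_eq _ _ _ _ _ N11 N11 _ (fun z => g z * (k0 z * k0 z)
  + (- g 0 * (k0 z * k0 z) + - l * k0 z))); last first.
  move=> z zb; have := bd_central_neq zb central0.
  by rewrite /q /cauchy_kernel subr0 => z0; field.
have c1 : bcQ (fun z => - g 0 * (k0 z * k0 z)).
  by move=> z zb; apply: ccontZ; exact: bd_cont_k00.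
have c2 : bcQ (fun z => - l * k0 z) by move=> z zb; apply: ccontZ; exact: kc.
rewrite !rect_intD// ?rect_intZ//; last 2 first.
- exact: bd_cont_k00.
- by move=> z zb; apply: ccontD; [exact: c1|exact: c2].
move=> E; have w0 := winding_neq0 central0.
apply: (mulIf w0); rewrite divfK//; apply: subr0_eq; rewrite -[RHS]E.
by rewrite -/(winding 0); ring.
Qed.

Lemma cauchy_diffD f g : bcQ f -> bcQ g ->
  cauchy_diff (fun z => f z + g z) = cauchy_diff f + cauchy_diff g.
Proof.
move=> fc gc; rewrite /cauchy_diff.
rewrite (@rect_int_eq _ _ _ _ _ N11 N11 _ (fun z => f z * (k0 z * k0 z)
  + g z * (k0 z * k0 z))); last by move=> z _; rewrite mulrDl.
rewrite rect_intD//; [ring|exact: bd_contM fc bd_cont_k00|].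
exact: bd_contM gc bd_cont_k00.
Qed.

Lemma cauchy_diffZ g l : bcQ g ->
  cauchy_diff (fun z => l * g z) = l * cauchy_diff g.
Proof.
move=> gc; rewrite /cauchy_diff.
rewrite (@rect_int_eq _ _ _ _ _ N11 N11 _ (fun z => l * (g z * (k0 z * k0 z))));
  last by move=> z _; rewrite -mulrA.
rewrite rect_intZ//; [ring|exact: bd_contM gc bd_cont_k00].
Qed.

Lemma normc_kernel h z : central h -> bdQ z -> N (cauchy_kernel h z) <= 2.
Proof.
move=> hc zb; have z0 := bd_central zb hc.
rewrite Normc.normcV -[2]invrK lef_pV2// posrE; first lra.
by rewrite invr_gt0.
Qed.

Lemma cauchy_diff_bound : exists2 K : R, 0 <= K & forall g (M : R), bcQ g ->
  (forall z, Q z -> N (g z) <= M) -> N (cauchy_diff g) <= K * M.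
Proof.
pose k2 := RQ (fun z => k0 z * k0 z).
exists ((64 + N k2) / N (winding 0)).
  by rewrite divr_ge0// ?normc_ge0// addr_ge0// normc_ge0.
move=> g M gc gM; rewrite Normc.normcM Normc.normcV mulrAC.
rewrite ler_wpM2r ?invr_ge0 ?normc_ge0//.
apply: le_trans (normcB _ _) _; rewrite mulrDl; apply: lerD; last first.
  rewrite Normc.normcM mulrC ler_wpM2l ?normc_ge0// gM//.
  exact/central_in/central0.
have kM z : bdQ z -> N (g z * (k0 z * k0 z)) <= 4 * M.
  move=> zb; rewrite !Normc.normcM.
  have h1 := normc_kernel central0 zb; have h2 := normc_ge0 (k0 z).
  have h3 := gM z (proj1 (andP zb)); have h4 := normc_ge0 (g z).
  rewrite mulrC ler_pM//; first exact: mulr_ge0.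
  have -> : 4 = 2 * 2 :> R by ring.
  exact: ler_pM.
apply: le_trans (rect_int_bound N11 N11 (bd_contM gc bd_cont_k00) kM) _.
lra.
Qed.

(** Let q be the remainder of the first-order expansion. The expansion
    1/(z - h) = 1/z + h/z^2 + h^2/(z^2 (z - h)) turns Cauchy's formula for q h
    into a sum of three integrals; the first two vanish as q does to second
    order at 0, and the third is of order h^2. *)
Lemma cauchy_taylor : exists2 K : R, 0 <= K & forall g (M : R) h,
  (forall z, Q z -> cdiff_at g z) -> (forall z, Q z -> N (g z) <= M) ->
  central h -> N (g h - g 0 - cauchy_diff g * h) <= K * M * N h ^+ 2.
Proof.
have [K K0 KP] := cauchy_diff_bound.
exists (128 * (2 + K * 2) * (9 / 8)); first by rewrite !mulr_ge0 ?addr_ge0 ?mulr_ge0.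
move=> g M h gd gM hc.
have [l gl] := gd 0 (central_in central0).
have E := cauchy_diffE gd gl.
have lM : N l <= K * M by rewrite -E; apply: KP => //; exact: cdiff_bd_cont.
rewrite E; pose q z := g z - g 0 - l * z.
have [qd q0 dq0] := taylor_remainder gd gl.
have qc := cdiff_bd_cont qd.
have kc c : central c -> bcQ (cauchy_kernel c) by move=> cc z; exact: ccont_kernel.
have qkc c : central c -> bcQ (fun z => q z * cauchy_kernel c z).
  by move=> cc; exact: bd_contM qc (kc c cc).
have I1 := rect_int_kernel0 central0 qd q0.
have I2 := rect_int_kernel00 qd q0 dq0.
have I3 : RQ (fun z => (q z - q h) * cauchy_kernel h z) = 0.
  apply: rect_int_kernel0 => //; last by rewrite subrr.
  by move=> z zQ; apply: cdiffD; [exact: qd|exact: cdiff_cst].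
pose r z := q z * (k0 z * k0 z) * cauchy_kernel h z.
have rc : bcQ r by apply: bd_contM (kc h hc); apply: bd_contM qc bd_cont_k00.
have c2 : bcQ (fun z => h * (q z * (k0 z * k0 z))).
  by move=> z zb; apply: ccontZ; exact: (bd_contM qc bd_cont_k00 zb).
have c3 : bcQ (fun z => h ^+ 2 * r z) by move=> z zb; apply: ccontZ; exact: rc.
have c4 : bcQ (fun z => - q h * cauchy_kernel h z).
  by move=> z zb; apply: ccontZ; exact: kc.
have F : q h * winding h = h ^+ 2 * RQ r.
  transitivity (RQ (fun z => q z * cauchy_kernel h z)).
    apply/eqP; rewrite eq_sym -subr_eq0 -[X in _ == X]I3.
    rewrite (@rect_int_eq _ _ _ _ _ N11 N11 (fun z => (q z - q h) * cauchy_kernel h z)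
      (fun z => q z * cauchy_kernel h z + - q h * cauchy_kernel h z)); last first.
      by move=> z _; ring.
    by rewrite rect_intD//; [rewrite rect_intZ//; [rewrite mulNr|exact: kc]|exact: qkc].
  rewrite (@rect_int_eq _ _ _ _ _ N11 N11 _ (fun z => q z * k0 z
    + (h * (q z * (k0 z * k0 z)) + h ^+ 2 * r z))); last first.
    move=> z zb; have := bd_central_neq zb central0; have := bd_central_neq zb hc.
    rewrite /r /cauchy_kernel subr0 => z0 zh.
    by field; apply/andP.
  have c23 : bcQ (fun z => h * (q z * (k0 z * k0 z)) + h ^+ 2 * r z).
    by move=> z zb; apply: ccontD; [exact: c2|exact: c3].
  rewrite (rect_intD N11 N11 (qkc 0 central0) c23) (rect_intD N11 N11 c2 c3).
  by rewrite !rect_intZ// ?I1 ?I2 ?mulr0 ?add0r//; exact: bd_contM qc bd_cont_k00.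
have M0 : 0 <= M by apply: le_trans (gM 0 (central_in central0)); exact: normc_ge0.
have qM z : Q z -> N (q z) <= (2 + K * 2) * M.
  move=> zQ; rewrite /q; apply: le_trans (normcB _ _) _.
  apply: le_trans (lerD (normcB _ _) (lexx _)) _; rewrite Normc.normcM.
  have h1 := gM z zQ; have h2 := gM 0 (central_in central0).
  have h3 : N z <= 2.
    apply: le_trans (normc_le _) _; case/andP: zQ => hr hi.
    have -> : 2 = 1 + 1 :> R by ring.
    by apply: lerD; rewrite ler_norml.
  have h4 : N l * N z <= K * M * 2 by apply: ler_pM => //; exact: normc_ge0.
  by move: h1 h2 h4; clear; lra.
have rM z : bdQ z -> N (r z) <= (2 + K * 2) * M * 8.
  move=> zb; rewrite /r !Normc.normcM.
  have h1 := normc_kernel central0 zb; have h2 := normc_ge0 (k0 z).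
  have h3 := qM z (proj1 (andP zb)); have h4 := normc_ge0 (q z).
  have h5 := normc_kernel hc zb; have h6 := normc_ge0 (cauchy_kernel h z).
  have -> : 8 = 2 * 2 * 2 :> R by ring.
  rewrite [leRHS]mulrA; apply: ler_pM => //; first by rewrite !mulr_ge0.
  apply: ler_pM => //; first by rewrite !mulr_ge0.
  exact: ler_pM.
have B := rect_int_bound N11 N11 rc rM.
have w0 := winding_norm hc; have wn := normc_ge0 (q h).
have F' : N (q h) * N (winding h) = N h ^+ 2 * N (RQ r).
  by rewrite -!Normc.normcM F !expr2 !Normc.normcM.
rewrite -/(q h); have h2 : 0 <= N h ^+ 2 by rewrite sqr_ge0.
have : N (q h) * (8 / 9) <= N h ^+ 2 * (4 * ((2 + K * 2) * M * 8) * (1 - -1 + (1 - -1))).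
  apply: le_trans (_ : N (q h) * N (winding h) <= _); first by rewrite ler_wpM2l.
  by rewrite F' ler_wpM2l.
by move: (N (q h)) (N h ^+ 2) => a b; clear; lra.
Qed.

End CauchyDiff.

(** * Holomorphic functions of several variables *)
Section RealNorm.
Context {R : realType}.
Local Notation C := (Cplx R).
Local Notation N := (@Normc.normc R).

Definition rnorm (V : normedModType C) (v : V) : R := complex.Re `|v|.

Variable V : normedModType C.
Implicit Types (u v : V).

Lemma rnormE v : `|v| = ((rnorm v)%:C%C : C).
Proof. by rewrite /rnorm RRe_real// realE normr_ge0. Qed.

Lemma rnorm_ge0 v : 0 <= rnorm v.
Proof. by rewrite -ler0c -rnormE normr_ge0. Qed.

Lemma rnormD u v : rnorm (u + v) <= rnorm u + rnorm v.
Proof. by rewrite -lecR rmorphD /= -!rnormE ler_normD. Qed.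

Lemma rnormN v : rnorm (- v) = rnorm v.
Proof. by rewrite /rnorm normrN. Qed.

Lemma rnormZ (a : C) v : rnorm (a *: v) = N a * rnorm v.
Proof. by apply: complexI; rewrite rmorphM /= -!rnormE normrZ normcE0. Qed.

Lemma rnorm0 : rnorm (0 : V) = 0.
Proof. by rewrite /rnorm normr0. Qed.

Lemma rnorm_eq0 v : (rnorm v == 0) = (v == 0).
Proof. by rewrite -[RHS]normr_eq0 rnormE -(inj_eq (@complexI R)). Qed.

Lemma rnorm_gt0 v : (0 < rnorm v) = (v != 0).
Proof. by rewrite lt0r rnorm_eq0 rnorm_ge0 andbT. Qed.

Lemma rnormC (c : C) : rnorm (c : C) = N c.
Proof. by []. Qed.

End RealNorm.

Section RealNormNear.
Context {R : realType}.
Local Notation C := (Cplx R).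

Lemma cvg_rnorm (V : normedModType C) (T : Type) (G : set_system T) {FG : Filter G}
    (f : T -> V) (y : V) :
  f @ G --> y <-> forall e : R, 0 < e -> \forall t \near G, rnorm (f t - y) < e.
Proof.
split=> [/cvgrPdist_lt fc e e0|fc].
  have e0' : 0 < (e%:C%C : C) by rewrite ltcR.
  by apply: filterS (fc _ e0') => t; rewrite rnormE ltcR -rnormN opprB.
apply/cvgrPdist_lt => e /cplx_pos[d d0 ->]; apply: filterS (fc d d0) => t.
by rewrite rnormE ltcR -rnormN opprB.
Qed.

Variable V : normedModType C.

Lemma near_rnorm (x : V) (P : V -> Prop) :
  (\forall y \near x, P y) <->
  exists2 d : R, 0 < d & forall y, rnorm (y - x) < d -> P y.
Proof.
split=> [/near_cplx|] [d d0 dP].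
  by exists d => // y yx; apply: dP; rewrite rnormE ltcR.
by apply/near_cplx; exists d => // y; rewrite rnormE ltcR; exact: dP.
Qed.

Lemma near_diff_rnorm (W : normedModType C) (f : V -> W) (x : V) :
  differentiable f x -> forall e : R, 0 < e -> exists2 d : R, 0 < d &
  forall y, rnorm (y - x) < d ->
    rnorm (f y - f x - 'd f x (y - x)) <= e * rnorm (y - x).
Proof.
move=> fd e e0; have /near_rnorm[d d0 dP] := near_diff fd e0.
by exists d => // y /dP; rewrite !rnormE -rmorphM /= lecR.
Qed.

Lemma diff_near_rnorm (W : normedModType C) (f : V -> W) (x : V)
    (L : {linear V -> W}) : continuous L ->
  (forall e : R, 0 < e -> exists2 d : R, 0 < d & forall y, rnorm (y - x) < d ->
    rnorm (f y - f x - L (y - x)) <= e * rnorm (y - x)) ->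
  differentiable f x /\ 'd f x = L :> (V -> W).
Proof.
move=> Lc fL; apply: diff_near => // e e0; have [d d0 dP] := fL e e0.
by apply/near_rnorm; exists d => // y /dP h; rewrite !rnormE -rmorphM /= lecR.
Qed.

End RealNormNear.

Section SeveralVariables.
Context {R : realType} {n : nat}.
Local Notation C := (Cplx R).
Local Notation N := (@Normc.normc R).
Local Notation V := 'rV[C]_n.
Implicit Types (f : V -> C) (x y v k : V).

Definition ebase (i : 'I_n) : V := delta_mx 0 i.

Lemma pdE (i : 'I_n) f x : differentiable f x -> pd i f x = 'd f x (ebase i).
Proof. exact: deriveE. Qed.

Lemma diff_pd f x v : differentiable f x ->
  'd f x v = \sum_j v 0 j * pd j f x.
Proof.
move=> fd; rewrite {1}[v]row_sum_delta linear_sum.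
by apply: eq_bigr => j _; rewrite linearZ pdE.
Qed.

Definition lform (l : 'I_n -> C) v : C := \sum_j v 0 j * l j.

Lemma lform_is_linear l : linear (lform l).
Proof.
move=> a u v; rewrite /lform scaler_sumr -big_split /=.
by apply: eq_bigr => j _; rewrite !mxE mulrDl scalerAl.
Qed.

HB.instance Definition _ l :=
  GRing.isLinear.Build C V C *:%R (lform l) (lform_is_linear l).

Lemma lform_continuous l : continuous (lform l).
Proof.
move=> x; apply: differentiable_continuous; apply: differentiable_bigsum => j.
apply: differentiableM; last exact: differentiable_cst.
exact: differentiable_coord.
Qed.

(** A first-order expansion with coefficients [l] determines the differential,
    linear forms on rows being continuous. *)
Lemma diff_lform f x (l : 'I_n -> C) :
  (forall e : R, 0 < e -> exists2 d : R, 0 < d & forall y, rnorm (y - x) < d ->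
    N (f y - f x - lform l (y - x)) <= e * rnorm (y - x)) ->
  differentiable f x /\ forall j, pd j f x = l j.
Proof.
move=> fl; have [//|fd dE] := @diff_near_rnorm _ _ _ f x (lform l) (@lform_continuous l).
split=> // j; rewrite pdE// dE /= /lform (bigD1 j)//= big1 ?addr0.
  by rewrite mxE !eqxx mul1r.
by move=> i /negbTE ij; rewrite mxE ij andbF mul0r.
Qed.

Lemma line_cderiv f y v (z : C) : differentiable f (y + z *: v) ->
  cderiv_at (fun w : C => f (y + w *: v)) z ('d f (y + z *: v) v).
Proof.
move=> fd e e0; have v0 : 0 < rnorm v + 1 by rewrite ltr_wpDl// rnorm_ge0.
have [d d0 dP] := near_diff_rnorm fd (divr_gt0 e0 v0).
exists (d / (rnorm v + 1)); first exact: divr_gt0.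
move=> w; rewrite ltr_pdivlMr// => wz.
have E : y + w *: v - (y + z *: v) = (w - z) *: v.
  by rewrite opprD addrACA subrr add0r scalerBl.
have wv : N (w - z) * rnorm v < d.
  by apply: le_lt_trans wz; rewrite ler_wpM2l ?normc_ge0//; lra.
have := dP (y + w *: v); rewrite E rnormZ linearZ => /(_ wv) h.
rewrite [X in N (_ - X)]mulrC; apply: le_trans h _.
rewrite mulrCA mulrC ler_wpM2r ?normc_ge0//.
rewrite mulrAC ler_pdivrMr// ler_wpM2l ?ltW//; lra.
Qed.

End SeveralVariables.

Section HolomorphicPartials.
Context {R : realType} {n : nat}.
Local Notation C := (Cplx R).
Local Notation N := (@Normc.normc R).
Local Notation V := 'rV[C]_n.
Implicit Types (f : V -> C) (x y v k : V).
Local Notation Q := (rect (-1 : R) 1 (-1) 1).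
Local Notation bcQ f := (bd_cont f (-1 : R) 1 (-1) 1).

Lemma normc_square (z : C) : Q z -> N z <= 2.
Proof.
move=> /andP[hr hi]; apply: le_trans (normc_le _) _.
have -> : 2 = 1 + 1 :> R by ring.
by apply: lerD; rewrite ler_norml.
Qed.

Lemma bd_cont_lform (l : 'I_n -> C -> C) v : (forall j, bcQ (l j)) ->
  bcQ (fun z => lform (l^~ z) v).
Proof.
move=> lc z zb; rewrite /lform; elim: (index_enum _) => [|j s IH].
  by under eq_fun do rewrite big_nil; exact: ccont_cst.
under eq_fun do rewrite big_cons.
by apply: ccontD => //; apply: ccontZ; exact: lc.
Qed.

Lemma cauchy_diff_lform (l : 'I_n -> C -> C) v : (forall j, bcQ (l j)) ->
  cauchy_diff (fun z => lform (l^~ z) v) = lform (fun j => cauchy_diff (l j)) v.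
Proof.
move=> lc; rewrite /lform.
suff h s : bcQ (fun z => \sum_(j <- s) v 0 j * l j z) /\
    cauchy_diff (fun z => \sum_(j <- s) v 0 j * l j z) =
    \sum_(j <- s) v 0 j * cauchy_diff (l j) by have [] := h (index_enum 'I_n).
have c0 z : ccont_at (fun=> 0 : C) z by exact: ccont_cst.
elim: s => [|j s [c IH]].
  rewrite (_ : (fun _ => _) = fun=> 0); last by apply/funext => w; rewrite big_nil.
  split=> [z _|]; first exact: ccont_cst.
  rewrite big_nil (_ : (fun=> 0) = fun w : C => 0 * 1); last first.
    by apply/funext => w; rewrite mul0r.
  by rewrite cauchy_diffZ ?mul0r// => z _; exact: ccont_cst.
rewrite (_ : (fun _ => _) = fun w => v 0 j * l j w + \sum_(j <- s) v 0 j * l j w);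
  last by apply/funext => w; rewrite big_cons.
have cj : bcQ (fun z => v 0 j * l j z) by move=> z zb; apply: ccontZ; exact: lc.
split=> [z zb|]; first by apply: ccontD; [exact: cj|exact: c].
by rewrite big_cons cauchy_diffD// cauchy_diffZ// IH.
Qed.

Lemma cauchy_diffB (g h : C -> C) : bcQ g -> bcQ h ->
  cauchy_diff (fun z => g z - h z) = cauchy_diff g - cauchy_diff h.
Proof.
move=> gc hc; rewrite -[in RHS]mulN1r -cauchy_diffZ// -cauchy_diffD//.
  by congr cauchy_diff; apply/funext => z; rewrite mulN1r.
by move=> z zb; apply: ccontZ; exact: hc.
Qed.

Lemma bd_contB (g h : C -> C) : bcQ g -> bcQ h -> bcQ (fun z => g z - h z).
Proof.
move=> gc hc z zb; rewrite (_ : (fun _ => _) = fun z => g z + -1 * h z).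
  by apply: ccontD; [exact: gc|apply: ccontZ; exact: hc].
by apply/funext => w; rewrite mulN1r.
Qed.

Section Ball.
Variables (f : V -> C) (x : V) (rho M : R).
Hypothesis rho0 : 0 < rho.
(* The unit square contains points of modulus up to 2, so lines y + z v with
   |v| <= rho stay within the radius 8 rho when y is within 6 rho of x. *)
Hypothesis f_diff : forall y, rnorm (y - x) < 8 * rho -> differentiable f y.
Hypothesis f_le : forall y, rnorm (y - x) < 8 * rho -> N (f y) <= M.

Lemma shift_dist y k (a b : R) : rnorm (y - x) < a -> rnorm k < b ->
  rnorm (y + k - x) < a + b.
Proof.
by move=> ya kb; rewrite addrAC (le_lt_trans (rnormD _ _))// ltrD.
Qed.

Lemma line_dist y v (z : C) (a : R) : Q z -> rnorm v <= rho ->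
  rnorm (y - x) < a -> rnorm (y + z *: v - x) < a + 2 * rho.
Proof.
move=> /normc_square z2 vr yx; rewrite addrAC.
apply: le_lt_trans (rnormD _ _) _; rewrite rnormZ ltr_leD// ler_pM//.
  exact: normc_ge0.
exact: rnorm_ge0.
Qed.

Lemma line_in_ball y v (z : C) : Q z -> rnorm v <= rho ->
  rnorm (y - x) < 6 * rho -> rnorm (y + z *: v - x) < 8 * rho.
Proof.
have -> : 8 * rho = 6 * rho + 2 * rho by ring.
exact: line_dist.
Qed.

Lemma line_cdiff y v (z : C) : Q z -> rnorm v <= rho ->
  rnorm (y - x) < 6 * rho -> cdiff_at (fun z : C => f (y + z *: v)) z.
Proof.
move=> zQ vr yx; exists ('d f (y + z *: v) v); apply: line_cderiv.
exact/f_diff/line_in_ball.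
Qed.

(** Cauchy's one-variable formula on the line through [y] with direction [v]. *)
Lemma line_diffE y v : rnorm v <= rho -> rnorm (y - x) < 6 * rho ->
  'd f y v = cauchy_diff (fun z : C => f (y + z *: v)).
Proof.
move=> vr yx; apply/esym/cauchy_diffE => [z zQ|]; first exact: line_cdiff.
have y0 : y = y + 0 *: v by rewrite scale0r addr0.
rewrite [X in 'd f X]y0; apply: line_cderiv; rewrite -y0.
by apply: f_diff; apply: lt_le_trans yx _; rewrite ler_wpM2r ?ltW//; lra.
Qed.

(** The one-variable estimates on the line in the direction of [k], rescaled so
    that [k] corresponds to a point of the central part of the unit square. *)
Lemma diff_bound : exists2 K : R, 0 <= K & forall y k,
  rnorm (y - x) < 6 * rho -> rnorm k <= rho / 4 ->
  N ('d f y k) <= K * rnorm k /\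
  N (f (y + k) - f y - 'd f y k) <= K * rnorm k ^+ 2.
Proof.
have [K1 K10 K1P] := @cauchy_diff_bound R.
have [K2 K20 K2P] := @cauchy_taylor R.
have M0 : 0 <= M.
  by apply: le_trans (normc_ge0 _) (f_le (y := x) _); rewrite subrr rnorm0 mulr_gt0.
pose A := K1 * M / rho; pose B := K2 * M / rho ^+ 2.
have A0 : 0 <= A by rewrite divr_ge0 ?mulr_ge0// ltW.
have B0 : 0 <= B by rewrite divr_ge0 ?mulr_ge0// ltW.
exists (A + B); first exact: addr_ge0.
move=> y k yx; have [->|k0] := eqVneq k 0.
  by rewrite linear0 rnorm0 addr0 subrr subr0 Normc.normc0 mulr0 expr0n mulr0.
rewrite -rnorm_gt0 in k0; set t := rnorm k in k0 * => kr.
pose v := ((rho / t)%:C%C : C) *: k; pose h : C := (t / rho)%:C%C.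
have rt : rho / t != 0 by rewrite gt_eqF// divr_gt0.
have kE : k = h *: v.
  by rewrite /v scalerA -rmorphM /= -invf_div mulVf// scale1r.
have vr : rnorm v = rho.
  by rewrite rnormZ normc_real ger0_norm ?divr_ge0 ?ltW// divfK ?gt_eqF.
have gd z : Q z -> cdiff_at (fun z : C => f (y + z *: v)) z.
  by move=> zQ; apply: line_cdiff => //; rewrite vr.
have gM z : Q z -> N (f (y + z *: v)) <= M.
  by move=> zQ; apply/f_le/line_in_ball => //; rewrite vr.
have dE : 'd f y k = cauchy_diff (fun z : C => f (y + z *: v)) * h.
  by rewrite kE linearZ -line_diffE ?vr// mulrC.
have Nh : N h = t / rho by rewrite normc_real ger0_norm// divr_ge0 ?ltW.
have hc : central h.
  rewrite /central /rect /= andbC; have t0 : 0 <= t / rho by rewrite divr_ge0 ?ltW.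
  have t1 : t / rho <= 4^-1 by rewrite ler_pdivrMr// mulrC.
  by apply/andP; split; apply/andP; split; lra.
split.
  rewrite dE Normc.normcM Nh mulrDl.
  have := K1P _ _ (cdiff_bd_cont gd) gM => /(ler_wpM2r (ltW (divr_gt0 k0 rho0))) H.
  apply: le_trans H _.
  have -> : K1 * M * (t / rho) = A * t by rewrite /A; ring.
  by rewrite lerDl; apply: mulr_ge0 B0 (ltW k0).
have := K2P _ _ h gd gM hc; rewrite -dE -kE scale0r addr0 => H.
apply: le_trans H _; rewrite Nh mulrDl.
have -> : K2 * M * (t / rho) ^+ 2 = B * t ^+ 2 by rewrite /B expr_div_n; ring.
by rewrite lerDr; apply: mulr_ge0 A0 (sqr_ge0 _).
Qed.

Let D i : R := rnorm (ebase i : V) + 1.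
Let D0 i : 0 < D i. Proof. by rewrite ltr_wpDl ?rnorm_ge0. Qed.
Let c i : C := (rho / D i)%:C%C.

Let c0 i : c i != 0.
Proof. by rewrite -normc_gt0 normc_real normr_gt0 gt_eqF// divr_gt0. Qed.

Let ce i : rnorm (c i *: ebase i : V) <= rho.
Proof.
rewrite rnormZ normc_real ger0_norm; last by rewrite divr_ge0// ltW.
by rewrite mulrAC ler_pdivrMr// ler_wpM2l ?lerDl// ltW.
Qed.

Lemma pd_cauchy i y : rnorm (y - x) < 6 * rho ->
  pd i f y = (c i)^-1 * cauchy_diff (fun z : C => f (y + z *: (c i *: ebase i))).
Proof.
move=> yx; rewrite -line_diffE// linearZ pdE; first by rewrite mulKf.
by apply: f_diff; apply: lt_le_trans yx _; rewrite ler_wpM2r ?ltW//; lra.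
Qed.

Lemma holo_lipschitz : exists2 K : R, 0 <= K & forall y k,
  rnorm (y - x) < 6 * rho -> rnorm k <= rho / 4 ->
  N (f (y + k) - f y) <= K * rnorm k.
Proof.
have [K K0 KP] := diff_bound; exists (K + K * (rho / 4)).
  by rewrite addr_ge0// mulr_ge0// divr_ge0// ltW.
move=> y k yx kr; have [h1 h2] := KP y k yx kr.
rewrite -(subrK ('d f y k) (f (y + k) - f y)); apply: le_trans (normcD _ _) _.
rewrite mulrDl addrC; apply: lerD => //; apply: le_trans h2 _.
by rewrite expr2 mulrA ler_wpM2r ?rnorm_ge0// ler_wpM2l.
Qed.

Lemma line_bd_cont y v : rnorm v <= rho ->
  rnorm (y - x) < 6 * rho -> bcQ (fun z : C => f (y + z *: v)).
Proof. by move=> vr yx; apply: cdiff_bd_cont => z zQ; apply: line_cdiff. Qed.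

(** Cauchy's formula bounds the oscillation of the partial derivative by that of
    [f], which is Lipschitz. *)
Lemma pd_line_bd_cont i j y : rnorm (y - x) < rho ->
  bcQ (fun z : C => pd j f (y + z *: (c i *: ebase i))).
Proof.
move=> yx z /andP[zQ _] e e0; set v := c i *: ebase i.
have [K1 K10 K1P] := @cauchy_diff_bound R; have [K K0 KP] := holo_lipschitz.
pose L := (N (c j))^-1 * (K1 * K) + 1.
have L0 : 0 < L by rewrite ltr_wpDl// !mulr_ge0// invr_ge0 normc_ge0.
pose v1 := rnorm v + 1; have v10 : 0 < v1 by rewrite ltr_wpDl ?rnorm_ge0.
pose d := Num.min (rho / 4 / v1) (e / L / v1).
exists d; first by rewrite lt_min !divr_gt0.
move=> w; rewrite lt_min !ltr_pdivlMr// => /andP[w1 w2].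
set Y := y + z *: v; set k := (w - z) *: v.
have wE : y + w *: v = Y + k by rewrite /Y /k scalerBl -addrA subrKC.
have kr : rnorm k < rho / 4 /\ L * rnorm k < e.
  have h1 : N (w - z) * rnorm v <= N (w - z) * v1.
    by rewrite ler_wpM2l ?normc_ge0// lerDl.
  rewrite rnormZ; split; first lra.
  by apply: le_lt_trans w2; rewrite mulrC ler_wpM2r// ltW.
have Yx : rnorm (Y - x) < 3 * rho.
  have -> : 3 * rho = rho + 2 * rho by ring.
  by apply: line_dist => //; exact: ce.
have Y4 : rnorm (Y - x) < 4 * rho by apply: lt_trans Yx _; rewrite ltr_pM2r// ltr_nat.
have Ykx : rnorm (Y + k - x) < 4 * rho.
  have -> : 4 * rho = 3 * rho + rho by ring.
  apply: shift_dist => //; case: kr => /lt_le_trans + _; apply.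
  by rewrite ler_pdivrMr// ler_pMr// ler1n.
have r46 : 4 * rho < 6 * rho by rewrite ltr_pM2r// ltr_nat.
rewrite wE !pd_cauchy; [|exact: lt_trans r46|exact: lt_trans r46].
have gc u : rnorm (u - x) < 4 * rho -> bcQ (fun z : C => f (u + z *: (c j *: ebase j))).
  by move=> ux; apply: line_bd_cont; [exact: ce|exact: lt_trans r46].
rewrite -mulrBr -(cauchy_diffB (gc _ Ykx) (gc _ Y4)).
rewrite Normc.normcM Normc.normcV.
have B := K1P _ (K * rnorm k) (bd_contB (gc _ Ykx) (gc _ Y4)).
apply: (@le_lt_trans _ _ ((N (c j))^-1 * (K1 * (K * rnorm k)))); last first.
  case: kr => _; apply: le_lt_trans; rewrite /L mulrDl mul1r !mulrA lerDl.
  exact: rnorm_ge0.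
rewrite ler_wpM2l ?invr_ge0 ?normc_ge0//; apply: B => z' zQ'.
rewrite [Y + k + _]addrAC; apply: KP; last by case: kr => /ltW.
have -> : 6 * rho = 4 * rho + 2 * rho by ring.
by apply: line_dist => //; exact: ce.
Qed.

(** Differentiating Cauchy's formula under the integral sign; the second-order
    bound makes the error uniform along the contour. *)
Lemma pd_diff i : differentiable (pd i f) x /\
  exists c : C, [/\ c != 0, rnorm (c *: ebase i : V) <= rho & forall j,
    pd j (pd i f) x =
    c^-1 * cauchy_diff (fun z : C => pd j f (x + z *: (c *: ebase i)))].
Proof.
suff [fd fE] : differentiable (pd i f) x /\ forall j, pd j (pd i f) x =
    (c i)^-1 * cauchy_diff (fun z : C => pd j f (x + z *: (c i *: ebase i))).
  by split=> //; exists (c i).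
have [K1 K10 K1P] := @cauchy_diff_bound R; have [K K0 KP] := diff_bound.
have xx : rnorm (x - x) < rho by rewrite subrr rnorm0.
apply: diff_lform => e e0.
pose L := (N (c i))^-1 * (K1 * K) + 1.
have L0 : 0 < L by rewrite ltr_wpDl// !mulr_ge0// invr_ge0 normc_ge0.
exists (Num.min (rho / 4) (e / L)); first by rewrite lt_min !divr_gt0.
move=> y; rewrite lt_min (ltr_pdivlMr _ _ L0); set k := y - x => /andP[k1 k2].
have yE : y = x + k by rewrite /k subrKC.
pose v := c i *: ebase i : V; pose g j (z : C) := pd j f (x + z *: v).
have gc j : bcQ (g j) by exact: pd_line_bd_cont.
have x6 : rnorm (x - x) < 6 * rho by rewrite subrr rnorm0 mulr_gt0.
have y6 : rnorm (y - x) < 6 * rho.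
  apply: lt_trans k1 _.
  by rewrite ltr_pdivrMr// mulrAC mulrC ltr_pMr// -natrM ltr1n.
have c1 : bcQ (fun z : C => f (y + z *: v)) by apply: line_bd_cont => //; exact: ce.
have c2 : bcQ (fun z : C => f (x + z *: v)) by apply: line_bd_cont => //; exact: ce.
have E : pd i f y - pd i f x - lform (fun j => (c i)^-1 * cauchy_diff (g j)) k =
    (c i)^-1 * cauchy_diff (fun z : C => f (y + z *: v) - f (x + z *: v)
      - lform (g^~ z) k).
  rewrite cauchy_diffB; [|exact: bd_contB|exact: bd_cont_lform].
  rewrite cauchy_diffB// cauchy_diff_lform// !pd_cauchy// mulrBr mulrBr.
  congr (_ - _); rewrite /lform mulr_sumr; apply: eq_bigr => j _.
  by rewrite mulrCA.
rewrite E Normc.normcM Normc.normcV.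
apply: (@le_trans _ _ ((N (c i))^-1 * (K1 * (K * rnorm k ^+ 2)))); last first.
  have -> : (N (c i))^-1 * (K1 * (K * rnorm k ^+ 2)) = (L - 1) * rnorm k * rnorm k.
    by rewrite /L; ring.
  rewrite ler_wpM2r ?rnorm_ge0// mulrBl mul1r lerBlDr.
  by rewrite mulrC (le_trans (ltW k2))// lerDl rnorm_ge0.
rewrite ler_wpM2l ?invr_ge0 ?normc_ge0//; apply: K1P.
  by apply: bd_contB; [exact: bd_contB|exact: bd_cont_lform].
move=> z zQ; set Y := x + z *: v.
have Y6 : rnorm (Y - x) < 6 * rho.
  apply: (@lt_trans _ _ (rho + 2 * rho)); first by apply: line_dist => //; exact: ce.
  have -> : rho + 2 * rho = 3 * rho by ring.
  by rewrite ltr_pM2r// ltr_nat.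
have [_] := KP Y k Y6 (ltW k1).
rewrite diff_pd; last by apply/f_diff/(lt_trans Y6); rewrite ltr_pM2r// ltr_nat.
by have -> : y + z *: v = Y + k by rewrite yE addrAC.
Qed.

End Ball.

Lemma holo_ball f x : (\forall y \near x, differentiable f y) ->
  exists rho M : R, 0 < rho /\ forall y, rnorm (y - x) < 8 * rho ->
    differentiable f y /\ N (f y) <= M.
Proof.
move=> /near_rnorm[d d0 dP].
have xd : differentiable f x by apply: dP; rewrite subrr rnorm0.
have fc := differentiable_continuous xd.
have fx := (@cvg_rnorm _ _ _ _ (nbhs_filter x) f (f x)).1 fc 1 ltr01.
have [r r0 rP] := (near_rnorm x _).1 fx.
exists (Num.min d r / 8), (N (f x) + 1); split.
  by rewrite divr_gt0// lt_min d0.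
have e8 (m : R) : 8 * (m / 8) = m by field.
move=> y; rewrite e8 lt_min => /andP[/dP yd /rP yr].
split=> //; rewrite -(subrK (f x) (f y)); apply: le_trans (normcD _ _) _.
by rewrite addrC lerD2l ltW.
Qed.

Theorem holo_pd f x i : (\forall y \near x, differentiable f y) ->
  differentiable (pd i f) x.
Proof.
move=> /holo_ball[rho [M [rho0 H]]].
have [] // := pd_diff rho0 (fun y h => (H y h).1) (fun y h => (H y h).2) i.
Qed.

(** Differentiating Cauchy's formula for the i-th derivative in the direction j
    gives Cauchy's formula for the i-th derivative of the j-th derivative. *)
Theorem holo_pdC f x i j : (\forall y \near x, differentiable f y) ->
  pd j (pd i f) x = pd i (pd j f) x.
Proof.
move=> fd; have [rho [M [rho0 H]]] := holo_ball fd.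
have Hd y h := (H y h).1; have HM y h := (H y h).2.
have [_ [c [c0 cr ->]]] := pd_diff rho0 Hd HM i.
have pdd y : rnorm (y - x) < 8 * rho -> differentiable (pd j f) y.
  move=> yx; apply: holo_pd; apply/near_rnorm.
  exists (8 * rho - rnorm (y - x)); first by rewrite subr_gt0.
  move=> w wy; apply: Hd; rewrite -(subrK y w) -addrA.
  by apply: le_lt_trans (rnormD _ _) _; lra.
have xx : rnorm (x - x) < 6 * rho by rewrite subrr rnorm0 mulr_gt0.
rewrite (cauchy_diffE (l := 'd (pd j f) x (c *: ebase i))).
- rewrite linearZ -pdE; last by apply: pdd; lra.
  by rewrite mulKf.
- move=> z zQ; exists ('d (pd j f) (x + z *: (c *: ebase i)) (c *: ebase i)).
  by apply: line_cderiv; apply: pdd; exact: line_in_ball xx.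
have x0 : x = x + 0 *: (c *: ebase i) by rewrite scale0r addr0.
rewrite [X in 'd _ X]x0; apply: line_cderiv; rewrite -x0.
by apply: pdd; lra.
Qed.

End HolomorphicPartials.

(** * Characters of the tangent algebras are closed forms *)
Section PartialRules.
Context {R : realType} {n : nat}.
Local Notation C := (Cplx R).
Local Notation V := 'rV[C]_n.
Implicit Types (f g : V -> C) (x : V).

Lemma pdB (i : 'I_n) f g x : differentiable f x -> differentiable g x ->
  pd i (fun y => f y - g y) x = pd i f x - pd i g x.
Proof. by move=> fd gd; apply: deriveB; exact: diff_derivable. Qed.

Lemma pdM (i : 'I_n) f g x : differentiable f x -> differentiable g x ->
  pd i (fun y => f y * g y) x = f x * pd i g x + g x * pd i f x.
Proof. by move=> fd gd; apply: deriveM; exact: diff_derivable. Qed.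

Lemma pd_sum (i : 'I_n) k (f : 'I_k -> V -> C) x :
  (forall j, differentiable (f j) x) ->
  pd i (fun y => \sum_j f j y) x = \sum_j pd i (f j) x.
Proof.
move=> fd; rewrite (_ : (fun y => _) = \sum_j f j); last first.
  by apply/funext => y; rewrite fct_sumE.
by apply: derive_sum => j; exact: diff_derivable.
Qed.

Lemma pd_near (i : 'I_n) f g x : (\forall y \near x, f y = g y) ->
  pd i f x = pd i g x.
Proof. by move=> fg; exact: near_eq_derive. Qed.

End PartialRules.

Section CharacterDerivative.
Variables (F : fieldType) (n : nat) (g : 'M[F]_n) (m : 'I_n -> 'I_n -> 'I_n -> F).
Variables (dg : 'I_n -> 'I_n -> 'I_n -> F) (dm : 'I_n -> 'I_n -> 'I_n -> 'I_n -> F).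
Hypothesis two_neq0 : (2 : F) != 0.
Hypothesis g_sym : g^T = g.
Hypothesis dg_sym : forall l i j, dg l i j = dg l j i.
Hypothesis g_unit : g \in unitmx.

(** The pointwise identities between a metric [g], a multiplication [m] and their
    first derivatives [dg] and [dm] are algebraic; they are stated over a field,
    for arbitrary values of these derivatives. [cubic] and [nabla_cubic] are the
    tensor c and its covariant derivative. *)
Definition levi_civita k i j : F :=
  2^-1 * \sum_l invmx g k l * (dg i j l + dg j i l - dg l i j).
Local Notation G := levi_civita.

Definition cubic i j k : F := \sum_l m i j l * g l k.
Local Notation c := cubic.

Definition nabla_cubic l i j k : F :=
  (\sum_p dm l i j p * g p k + \sum_p m i j p * dg l p k)
  - \sum_p (G p l i * c p j k + G p l j * c i p k + G p l k * c i j p).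
Local Notation nabla_c := nabla_cubic.

Lemma levi_civita_sym k i j : G k i j = G k j i.
Proof.
rewrite /levi_civita; congr (_ * _); apply: eq_bigr => l _; congr (_ * _).
by rewrite (dg_sym l i j); congr (_ - _); rewrite addrC.
Qed.

Let gC k q : g q k = g k q. Proof. by rewrite -{1}g_sym mxE. Qed.

(** Christoffel symbols of the first kind. *)
Lemma levi_civita_lower k i j :
  \sum_q G q i j * g q k = 2^-1 * (dg i j k + dg j i k - dg k i j).
Proof.
pose E l := dg i j l + dg j i l - dg l i j.
transitivity (2^-1 * \sum_l (\sum_q g k q * invmx g q l) * E l).
  rewrite mulr_sumr.
  under eq_bigr => q _ do rewrite -mulrA mulr_suml mulr_sumr.
  rewrite exchange_big /=; apply: eq_bigr => l _.
  rewrite mulr_suml mulr_sumr; apply: eq_bigr => q _.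
  rewrite gC -/(E l); ring.
congr (_ * _); rewrite (bigD1 k)//= [X in _ + X]big1 ?addr0; last first.
  move=> l lk; have /matrixP/(_ k l) := mulmxV g_unit; rewrite !mxE => ->.
  by rewrite eq_sym (negbTE lk) mul0r.
by have /matrixP/(_ k k) := mulmxV g_unit; rewrite !mxE eqxx => ->; rewrite mul1r.
Qed.

Lemma metric_compatible l i j :
  dg l i j = \sum_q G q l i * g q j + \sum_q G q l j * g q i.
Proof.
rewrite !levi_civita_lower (dg_sym l j i).
by field.
Qed.

Variables (th : 'I_n -> F) (dth : 'I_n -> 'I_n -> F) (f : 'I_n -> F).
Hypothesis th_mult : forall i j, \sum_p m i j p * th p = th i * th j.
Hypothesis dth_mult : forall l i j,
  \sum_p (m i j p * dth l p + th p * dm l i j p) = th i * dth l j + th j * dth l i.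
Hypothesis f_eigen : forall i p, \sum_j f j * m i j p = th i * f p.
Hypothesis f_th : \sum_j f j * th j = 1.

Let w k := \sum_p invmx g k p * th p.

Let gw p : \sum_k g p k * w k = th p.
Proof.
rewrite /w; under eq_bigr => k _ do rewrite mulr_sumr.
rewrite exchange_big /= (bigD1 p)//= [X in _ + X]big1 ?addr0; last first.
  move=> l lp; under eq_bigr => k _ do rewrite mulrA.
  rewrite -mulr_suml; have /matrixP/(_ p l) := mulmxV g_unit; rewrite !mxE => ->.
  by rewrite eq_sym (negbTE lp) mul0r.
under eq_bigr => k _ do rewrite mulrA.
by rewrite -mulr_suml; have /matrixP/(_ p p) := mulmxV g_unit; rewrite !mxE eqxx => ->;
  rewrite mul1r.
Qed.

Let cw i j : \sum_k c i j k * w k = th i * th j.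
Proof.
rewrite /c -(th_mult i j).
under eq_bigr => k _ do rewrite mulr_suml.
rewrite exchange_big /=; apply: eq_bigr => p _.
rewrite -gw mulr_sumr; apply: eq_bigr => k _; by rewrite mulrA.
Qed.

Let fc i k : \sum_j f j * c i j k = th i * \sum_p f p * g p k.
Proof.
rewrite /c mulr_sumr; under eq_bigr => j _ do rewrite mulr_sumr.
rewrite exchange_big /=; apply: eq_bigr => p _.
rewrite mulrA -f_eigen mulr_suml; apply: eq_bigr => j _; by rewrite mulrA.
Qed.

Let pd_th l i : \sum_j f j * \sum_p dm l i j p * th p = dth l i.
Proof.
have E j : \sum_p dm l i j p * th p =
    dth l i * th j + th i * dth l j - \sum_p m i j p * dth l p.
  have := dth_mult l i j; rewrite big_split /= addrC [RHS]addrC (mulrC (th j)) => <-.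
  by rewrite addrK; apply: eq_bigr => p _; rewrite mulrC.
under eq_bigr => j _ do rewrite E mulrBr mulrDr.
rewrite sumrB big_split /=.
have -> : \sum_j f j * (dth l i * th j) = dth l i.
  rewrite -[RHS]mulr1 -f_th mulr_sumr; apply: eq_bigr => j _; by rewrite mulrCA.
have -> : \sum_j f j * (th i * dth l j) = \sum_j f j * (\sum_p m i j p * dth l p).
  under [RHS]eq_bigr => j _ do rewrite mulr_sumr.
  rewrite exchange_big /=; apply: eq_bigr => p _.
  rewrite mulrCA mulrA -f_eigen mulr_suml; apply: eq_bigr => j _.
  by rewrite mulrA.
by rewrite addrK.
Qed.

Let contract l i : \sum_j \sum_k f j * (w k * nabla_c l i j k) =
  dth l i - \sum_p G p l i * th p.
Proof.
pose B := \sum_j \sum_k f j * (w k * \sum_p (G p l j * g p k + G p l k * g p j)).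
have E1 : \sum_j \sum_k f j * (w k * \sum_p dm l i j p * g p k)
    = dth l i.
  rewrite -pd_th; apply: eq_bigr => j _; rewrite -mulr_sumr; congr (_ * _).
  under eq_bigr => k _ do rewrite mulr_sumr.
  rewrite exchange_big /=; apply: eq_bigr => p _; rewrite -gw mulr_sumr.
  by apply: eq_bigr => k _; rewrite mulrCA [w k * _]mulrC.
have E2 : \sum_j \sum_k f j * (w k * \sum_p m i j p * dg l p k)
    = th i * B.
  transitivity (\sum_p \sum_k th i * f p * (w k * dg l p k)).
    rewrite exchange_big [RHS]exchange_big /=; apply: eq_bigr => k _.
    under eq_bigr => j _ do rewrite 2!mulr_sumr.
    rewrite exchange_big /=; apply: eq_bigr => p _.
    rewrite -f_eigen mulr_suml; apply: eq_bigr => j _; ring.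
  rewrite /B mulr_sumr; apply: eq_bigr => j _; rewrite mulr_sumr.
  apply: eq_bigr => k _; rewrite metric_compatible big_split /=; ring.
have E3 : \sum_j \sum_k f j * (w k * \sum_p G p l i * c p j k)
    = \sum_p G p l i * th p.
  under eq_bigr => j _ do under eq_bigr => k _ do rewrite 2!mulr_sumr.
  under eq_bigr => j _ do rewrite exchange_big /=.
  rewrite exchange_big /=; apply: eq_bigr => p _.
  rewrite -[RHS]mulr1 -f_th mulr_sumr; apply: eq_bigr => j _.
  transitivity (f j * G p l i * \sum_k c p j k * w k).
    by rewrite mulr_sumr; apply: eq_bigr => k _; ring.
  by rewrite cw; ring.
have E4 : \sum_j \sum_k f j * (w k * \sum_p (G p l j * c i p k
      + G p l k * c i j p)) = th i * B.
  pose T1 := \sum_j \sum_p f j * (G p l j * th p).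
  have B1 : \sum_j \sum_k f j * (w k * \sum_p G p l j * g p k) = T1.
    apply: eq_bigr => j _; under eq_bigr => k _ do rewrite 2!mulr_sumr.
    rewrite exchange_big /=; apply: eq_bigr => p _; rewrite -gw 2!mulr_sumr.
    by apply: eq_bigr => k _; ring.
  have B2 : \sum_j \sum_k f j * (w k * \sum_p G p l j * c i p k)
      = th i * T1.
    rewrite /T1 mulr_sumr; apply: eq_bigr => j _; rewrite mulr_sumr.
    under eq_bigr => k _ do rewrite 2!mulr_sumr.
    rewrite exchange_big /=; apply: eq_bigr => p _.
    transitivity (f j * G p l j * \sum_k c i p k * w k).
      by rewrite mulr_sumr; apply: eq_bigr => k _; ring.
    by rewrite cw; ring.
  have B3 : \sum_j \sum_k f j * (w k * \sum_p G p l k * c i j p)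
      = th i * \sum_j \sum_k f j * (w k * \sum_p G p l k * g p j).
    transitivity (\sum_k \sum_p w k * G p l k * \sum_j f j * c i j p).
      rewrite exchange_big /=; apply: eq_bigr => k _.
      under eq_bigr => j _ do rewrite 2!mulr_sumr.
      rewrite exchange_big /=; apply: eq_bigr => p _; rewrite mulr_sumr.
      by apply: eq_bigr => j _; ring.
    rewrite exchange_big [in RHS]exchange_big /= mulr_sumr [LHS]exchange_big /=.
    apply: eq_bigr => k _; rewrite mulr_sumr.
    under [RHS]eq_bigr => j _ do rewrite 3!mulr_sumr.
    rewrite [RHS]exchange_big /=; apply: eq_bigr => p _.
    rewrite fc 2!mulr_sumr; apply: eq_bigr => j _.
    rewrite gC.
    ring.
  transitivity (th i * T1 + th i * \sum_j \sum_k f j * (w k * \sum_p G p l k * g p j)).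
    rewrite -B2 -B3 -big_split; apply: eq_bigr => j _; rewrite -big_split.
    by apply: eq_bigr => k _; rewrite /= big_split /=; ring.
  rewrite -mulrDr; congr (_ * _); rewrite -B1 /B -big_split; apply: eq_bigr => j _.
  rewrite -big_split; apply: eq_bigr => k _; rewrite /= big_split /=; ring.
transitivity (\sum_j \sum_k f j * (w k * \sum_p dm l i j p * g p k)
  + \sum_j \sum_k f j * (w k * \sum_p m i j p * dg l p k)
  - (\sum_j \sum_k f j * (w k * \sum_p G p l i * c p j k)
  + \sum_j \sum_k f j * (w k * \sum_p (G p l j * c i p k
      + G p l k * c i j p)))).
  rewrite -!big_split -sumrB; apply: eq_bigr => j _.
  rewrite -!big_split -sumrB; apply: eq_bigr => k _ /=.
  rewrite /nabla_cubic; under [X in _ - X]eq_bigr => p _ do rewrite -addrA.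
  rewrite !big_split /=; ring.
rewrite E1 E2 E3 E4; ring.
Qed.

(** Contracting the symmetric tensor nabla c with th and with an idempotent on
    which th takes the value 1 kills every term of nabla c except the
    covariant derivative of th; its antisymmetric part, d th, vanishes with
    that of the Christoffel symbols. *)
Theorem character_derivative_sym :
  (forall l i j k, nabla_c l i j k = nabla_c i l j k) ->
  forall l i, dth l i = dth i l.
Proof.
move=> c_sym l i; have := contract l i; have := contract i l.
have -> : \sum_j \sum_k f j * (w k * nabla_c l i j k) =
    \sum_j \sum_k f j * (w k * nabla_c i l j k).
  by apply: eq_bigr => j _; apply: eq_bigr => k _; rewrite c_sym.
move=> ->; under eq_bigr => p _ do rewrite levi_civita_sym.
by move/addIr.
Qed.

End CharacterDerivative.

Lemma sum_product_rule (F : fieldType) n (a b a' b' : 'I_n -> F) :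
  \sum_p (a p * b' p + b p * a' p) = \sum_p a' p * b p + \sum_p a p * b' p.
Proof.
by rewrite -big_split; apply: eq_bigr => p _ /=; rewrite addrC [b p * _]mulrC.
Qed.

Section ClosedCharacters.
Context {R : realType} {n : nat}.
Local Notation C := (Cplx R).
Local Notation V := 'rV[C]_n.

Lemma nabla_c3E (g : V -> 'M[C]_n) (m : V -> 'I_n -> 'I_n -> 'I_n -> C) (x : V)
    (l i j k : 'I_n) :
  (forall i j, differentiable (fun y => g y i j) x) ->
  (forall i j k, differentiable (fun y => m y i j k) x) ->
  nabla_c3 g m x l i j k = nabla_cubic (g x) (m x)
    (fun l i j => pd l (fun y => g y i j) x)
    (fun l i j k => pd l (fun y => m y i j k) x) l i j k.
Proof.
move=> gd md; rewrite /nabla_c3 /nabla_cubic; congr (_ - _).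
rewrite /c3 pd_sum; last by move=> p; apply: differentiableM.
rewrite (eq_bigr _ (fun p _ => pdM l (md i j p) (gd p k))).
exact: sum_product_rule.
Qed.

(** The multiplicativity of the character near the point gives, by
    differentiation, the relation between its derivatives and those of the
    multiplication. *)
Theorem character_closed (g : V -> 'M[C]_n) (m : V -> 'I_n -> 'I_n -> 'I_n -> C)
    (x : V) (th : V -> 'I_n -> C) (f : 'I_n -> C) :
  (forall i j, differentiable (fun y => g y i j) x) ->
  (forall i j k, differentiable (fun y => m y i j k) x) ->
  (forall i, differentiable (fun y => th y i) x) ->
  (\forall y \near x, (g y)^T = g y) -> g x \in unitmx ->
  (forall l i j k, nabla_c3 g m x l i j k = nabla_c3 g m x i l j k) ->
  (\forall y \near x, forall i j, \sum_p m y i j p * th y p = th y i * th y j) ->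
  (forall i p, \sum_j f j * m x i j p = th x i * f p) ->
  \sum_j f j * th x j = 1 ->
  forall l i, pd l (fun y => th y i) x = pd i (fun y => th y l) x.
Proof.
move=> gd md thd gs gu cs thm fe f1.
apply: (@character_derivative_sym _ _ (g x) (m x)
  (fun l i j => pd l (fun y => g y i j) x)
  (fun l i j k => pd l (fun y => m y i j k) x) _ _ _ _ (th x)
  (fun l i => pd l (fun y => th y i) x) f).
- by rewrite pnatr_eq0.
- exact: nbhs_singleton gs.
- move=> l i j; apply: pd_near; near=> y.
  by rewrite -[in LHS](near gs y)// mxE.
- exact: gu.
- exact: nbhs_singleton thm.
- move=> l i j.
  transitivity (pd l (fun y => th y i * th y j) x); last exact: pdM.
  transitivity (pd l (fun y => \sum_p m y i j p * th y p) x).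
    rewrite pd_sum; last by move=> p; exact: (differentiableM (md i j p) (thd p)).
    by apply: eq_bigr => p _; exact/esym/(pdM l (md i j p) (thd p)).
  by apply: pd_near; near=> y; exact: (near thm y).
- exact: fe.
- exact: f1.
- move=> l i j k; rewrite -(nabla_c3E l i j k gd md) -(nabla_c3E i l j k gd md).
  exact: cs.
Unshelve. all: by end_near. Qed.

End ClosedCharacters.

(** * Idempotents of a deformed algebra *)
Section EntrywiseLimits.
Context {K : numFieldType} {T : Type} (F : set_system T) {FF : Filter F}.

Lemma cvg_bigsum (I : Type) (r : seq I) (P : pred I) (f : I -> T -> K) (a : I -> K) :
  (forall i, f i @ F --> a i) ->
  (fun t => \sum_(i <- r | P i) f i t) @ F --> \sum_(i <- r | P i) a i.
Proof. by move=> fa; apply: cvg_big => //; exact: add_continuous. Qed.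

Lemma cvg_bigprod (I : Type) (r : seq I) (P : pred I) (f : I -> T -> K) (a : I -> K) :
  (forall i, f i @ F --> a i) ->
  (fun t => \prod_(i <- r | P i) f i t) @ F --> \prod_(i <- r | P i) a i.
Proof. by move=> fa; apply: cvg_big => //; exact: mul_continuous. Qed.

Definition cvg_mx m n (A : T -> 'M[K]_(m, n)) (B : 'M[K]_(m, n)) :=
  forall i j, (fun t => A t i j) @ F --> B i j.

Lemma cvg_mulmx m n p (A : T -> 'M[K]_(m, n)) A0 (B : T -> 'M[K]_(n, p)) B0 :
  cvg_mx A A0 -> cvg_mx B B0 -> cvg_mx (fun t => A t *m B t) (A0 *m B0).
Proof.
move=> cA cB i j; rewrite mxE; under eq_fun do rewrite mxE.
by apply: cvg_bigsum => k; apply: cvgM; [exact: cA|exact: cB].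
Qed.

Lemma cvg_mx_cst m n (A : 'M[K]_(m, n)) : cvg_mx (fun=> A) A.
Proof. by move=> i j; exact: cvg_cst. Qed.

Lemma cvg_mxD m n (A B : T -> 'M[K]_(m, n)) A0 B0 :
  cvg_mx A A0 -> cvg_mx B B0 -> cvg_mx (fun t => A t + B t) (A0 + B0).
Proof.
move=> cA cB i j; rewrite mxE; under eq_fun do rewrite mxE.
exact: (cvgD (cA i j) (cB i j)).
Qed.

Lemma cvg_mxB m n (A B : T -> 'M[K]_(m, n)) A0 B0 :
  cvg_mx A A0 -> cvg_mx B B0 -> cvg_mx (fun t => A t - B t) (A0 - B0).
Proof.
move=> cA cB i j; rewrite !mxE; under eq_fun do rewrite !mxE.
exact: (cvgB (cA i j) (cB i j)).
Qed.

Lemma cvg_mxZ m n (c : T -> K) (c0 : K) (A : T -> 'M[K]_(m, n)) A0 :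
  c @ F --> c0 -> cvg_mx A A0 -> cvg_mx (fun t => c t *: A t) (c0 *: A0).
Proof.
move=> cc cA i j; rewrite mxE; under eq_fun do rewrite mxE.
exact: (cvgM cc (cA i j)).
Qed.

Lemma cvg_scalar_mx n (c : T -> K) (c0 : K) :
  c @ F --> c0 -> cvg_mx (fun t => ((c t)%:M : 'M[K]_n)) (c0%:M).
Proof.
move=> cc i j; rewrite mxE; under eq_fun do rewrite mxE.
by case: (i == j) => //=; exact: cvg_cst.
Qed.

Lemma cvg_det n (A : T -> 'M[K]_n) A0 : cvg_mx A A0 ->
  (fun t => \det (A t)) @ F --> \det A0.
Proof.
move=> cA; apply: cvg_bigsum => s; apply: cvgM; first exact: cvg_cst.
by apply: cvg_bigprod => i; exact: cA.
Qed.

Lemma cvg_neq0 (c : T -> K) (c0 : K) : c @ F --> c0 -> c0 != 0 ->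
  \forall t \near F, c t != 0.
Proof.
move=> /cvgrPdist_lt cc c00; have c0p : 0 < `|c0| by rewrite normr_gt0.
apply: filterS (cc _ c0p) => t; apply: contraTneq => ->.
by rewrite subr0 ltxx.
Qed.

Lemma cvg_unitmx n (A : T -> 'M[K]_n) A0 : cvg_mx A A0 -> A0 \in unitmx ->
  \forall t \near F, A t \in unitmx.
Proof.
move=> /cvg_det cA; rewrite unitmxE unitfE => /(cvg_neq0 cA).
by apply: filterS => t; rewrite unitmxE unitfE.
Qed.

Lemma cvg_invmx n (A : T -> 'M[K]_n) A0 : cvg_mx A A0 -> A0 \in unitmx ->
  cvg_mx (fun t => invmx (A t)) (invmx A0).
Proof.
move=> cA uA i j; have dA := cvg_det cA.
have d0 : \det A0 != 0 by rewrite -unitfE -unitmxE.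
have E t : A t \in unitmx -> (\det (A t))^-1 * cofactor (A t) j i = invmx (A t) i j.
  by move=> u; rewrite /invmx u !mxE.
rewrite /invmx uA !mxE.
suff h : (fun t => (\det (A t))^-1 * cofactor (A t) j i) @ F -->
    (\det A0)^-1 * cofactor A0 j i.
  apply: cvg_trans h; apply: near_eq_cvg.
  by apply: filterS (cvg_unitmx cA uA) => t /E.
apply: cvgM; first exact: cvgV.
rewrite /cofactor; apply: cvgM; first exact: cvg_cst.
apply: cvg_det => a b; rewrite !mxE; under eq_fun do rewrite !mxE; exact: cA.
Qed.

End EntrywiseLimits.

(** The value of the characteristic polynomial at [c] is the product of the
    distances from [c] to its roots. *)
Lemma det_root_near (F : numClosedFieldType) n (A : 'M[F]_n) (c : F) : (0 < n)%N ->
  exists2 l : F, \det (l%:M - A) = 0 & `|l - c| ^+ n <= `|\det (c%:M - A)|.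
Proof.
move=> n0.
have detE (z : F) : \det (z%:M - A) = (char_poly A).[z].
  rewrite /char_poly -horner_evalE -det_map_mx; congr (\det _).
  apply/matrixP => i j; rewrite !mxE /= /horner_eval /=.
  by case: (i == j); rewrite ?mulr1n ?mulr0n !hornerE.
have [s sE] := closed_field_poly_normal (char_poly A).
have /monicP lc := char_poly_monic A; rewrite lc scale1r in sE.
have ss : size s = n.
  by have := size_char_poly A; rewrite sE size_prod_XsubC => -[].
have [t ts tm] : exists2 t, t \in s & forall z, z \in s -> `|t - c| <= `|z - c|.
  have sne : s != [::] by rewrite -size_eq0 ss -lt0n.
  clear -sne; elim: s sne => // a s IH _; have [->|/IH[t ts tm]] := eqVneq s [::].
    by exists a; rewrite ?inE// => z; rewrite inE => /eqP ->.
  have [h|h] := real_leP (normr_real (a - c)) (normr_real (t - c)).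
    exists a; rewrite ?mem_head// => z; rewrite inE => /predU1P[->//|/tm].
    exact: le_trans.
  exists t; first by rewrite inE ts orbT.
  by move=> z; rewrite inE => /predU1P[->|/tm//]; exact: ltW.
exists t.
  by rewrite detE sE; apply/rootP; rewrite root_prod_XsubC.
rewrite detE sE horner_prod normr_prod.
under eq_bigr do rewrite hornerXsubC distrC.
have h (d : F) : 0 <= d -> (forall z, z \in s -> d <= `|z - c|) ->
    d ^+ size s <= \prod_(z <- s) `|z - c|.
  move=> d0; elim: (s) => [|z r IH] dz; first by rewrite big_nil expr0.
  rewrite big_cons exprS; apply: ler_pM => //; first exact: exprn_ge0.
    by apply: dz; rewrite mem_head.
  by apply: IH => y yr; apply: dz; rewrite inE yr orbT.
by rewrite -ss; exact: h.
Qed.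

Section OneAlgebra.
Variables (F : fieldType) (n : nat).
Local Notation V := 'rV[F]_n.
Variables (mul : V -> V -> V) (L : V -> 'M[F]_n).
Hypothesis mulE : forall u v, mul u v = u *m L v.
Hypothesis mulC : forall u v, mul u v = mul v u.
Hypothesis mulA : forall u v w, mul u (mul v w) = mul (mul u v) w.

Lemma mulZl c u v : mul (c *: u) v = c *: mul u v.
Proof. by rewrite !mulE scalemxAl. Qed.

Lemma mulZr c u v : mul u (c *: v) = c *: mul u v.
Proof. by rewrite mulC mulZl mulC. Qed.

Lemma mulDl u v w : mul (u + v) w = mul u w + mul v w.
Proof. by rewrite !mulE mulmxDl. Qed.

Lemma mulNl u v : mul (- u) v = - mul u v.
Proof. by rewrite !mulE mulNmx. Qed.

Lemma mulBl u v w : mul (u - v) w = mul u w - mul v w.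
Proof. by rewrite mulDl mulNl. Qed.

Lemma mulBr u v w : mul w (u - v) = mul w u - mul w v.
Proof. by rewrite mulC mulBl !(mulC w). Qed.

Lemma idempotent_diff_cube u v : mul u u = u -> mul v v = v ->
  mul (mul (u - v) (u - v)) (u - v) = u - v.
Proof.
move=> uu vv.
have sq : mul (u - v) (u - v) = u + v - mul u v - mul u v.
  rewrite mulBl !mulBr uu vv (mulC v u); apply/rowP => i; rewrite !mxE; ring.
have uuv : mul u (mul u v) = mul u v by rewrite mulA uu.
have vuv : mul v (mul u v) = mul u v by rewrite (mulC u) mulA vv.
have uvu : mul (mul u v) u = mul u v by rewrite mulC.
have uvv : mul (mul u v) v = mul u v by rewrite mulC.
rewrite sq mulBr !mulBl !mulDl uu vv uvu uvv (mulC v u).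
apply/rowP => i; rewrite !mxE; ring.
Qed.

Lemma mul_idempotent u v : mul u u = u -> mul v v = v ->
  mul (mul u v) (mul u v) = mul u v.
Proof. by move=> uu vv; rewrite -mulA (mulC v) -(mulA u v v) vv mulA uu. Qed.

(** When x - f + P0 is invertible, the kernel of x - f is the line of w; this
    kernel is stable under multiplication, so it contains the square of w. *)
Lemma eigenvector_square (f : V) (P0 : 'M[F]_n) (a : V -> F) (x : F) :
  (forall v, v *m P0 = a v *: f) ->
  \det (x%:M - L f) = 0 -> x%:M - L f + P0 \in unitmx ->
  let w := f *m invmx (x%:M - L f + P0) in mul w w = a (mul w w) *: w.
Proof.
move=> aP d0 uN w.
have ker v : v *m (x%:M - L f) = 0 -> v = a v *: w.
  move=> v0; rewrite /w scalemxAl -aP; apply: (canRL (mulmxK uN)).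
  by rewrite mulmxDr v0 add0r.
have /det0P[v v0 vk] : \det (x%:M - L f) == 0 by rewrite d0.
have av : a v != 0.
  by apply: contraNneq v0 => E; rewrite (ker v vk) E scale0r.
have wk : w *m (x%:M - L f) = 0.
  have -> : w = (a v)^-1 *: v by rewrite {2}(ker v vk) scalerA mulVf// scale1r.
  by rewrite -scalemxAl vk scaler0.
apply: ker; move: wk; rewrite !mulmxBr !mul_mx_scalar -!mulE => /eqP.
rewrite subr_eq0 => /eqP wk; rewrite -mulA -wk.
by rewrite mulZr subrr.
Qed.

Lemma scaled_idempotent w k : mul w w = k *: w -> k != 0 ->
  mul (k^-1 *: w) (k^-1 *: w) = k^-1 *: w.
Proof.
by move=> ww k0; rewrite mulZl mulZr ww !scalerA -mulrA mulVf// mulr1.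
Qed.

End OneAlgebra.

Section ComplexLimits.
Context {R : realType}.
Local Notation C := (Cplx R).
Local Notation N := (@Normc.normc R).

Lemma cvg_cplx (T : Type) (F : set_system T) {FF : Filter F} (f : T -> C) (c : C) :
  f @ F --> c <-> forall e : R, 0 < e -> \forall t \near F, N (f t - c) < e.
Proof. exact: (cvg_rnorm f c). Qed.

End ComplexLimits.

Section RowNorm.
Context {R : realType} {n : nat}.
Local Notation C := (Cplx R).
Local Notation N := (@Normc.normc R).
Local Notation V := 'rV[C]_n.
Implicit Types (u v : V).

Lemma rnorm_lt v (e : R) : 0 < e -> rnorm v < e <-> forall i, N (v 0 i) < e.
Proof.
move=> e0; have e0' : 0 < (e%:C%C : C) by rewrite ltcR.
have E : ball (0 : V) (e%:C%C : C) v <-> rnorm v < e.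
  by rewrite mx_norm_ball /ball_ /= sub0r normrN rnormE ltcR.
rewrite -E; split=> [[_ h] i|h].
  by have := h 0 i; rewrite mxE -ball_normE /= sub0r normrN normcE0 ltcR.
split=> // i j; rewrite mxE -ball_normE /= sub0r normrN normcE0 ltcR.
by rewrite (ord1 i).
Qed.

Lemma coord_le v i : N (v 0 i) <= rnorm v.
Proof.
rewrite leNgt; apply/negP => h.
have v0 : 0 < N (v 0 i) by apply: le_lt_trans h; exact: rnorm_ge0.
by move/(rnorm_lt _ v0): h => /(_ i); rewrite ltxx.
Qed.

Lemma rnorm_le v (c : R) : 0 <= c -> (forall i, N (v 0 i) <= c) -> rnorm v <= c.
Proof.
move=> c0 h; rewrite leNgt; apply/negP => cv.
have v0 : 0 < rnorm v by exact: le_lt_trans cv.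
suff : rnorm v < rnorm v by rewrite ltxx.
by apply/rnorm_lt => // i; exact: le_lt_trans (h i) cv.
Qed.

Lemma cvg_row_rnorm (T : Type) (F : set_system T) {FF : Filter F} (A : T -> V) (B : V) :
  cvg_mx F A B <-> forall e : R, 0 < e -> \forall t \near F, rnorm (A t - B) < e.
Proof.
split=> [AB e e0|AB i j].
  have e0' : 0 < (e%:C%C : C) by rewrite ltcR.
  have h (j : 'I_n) : \forall t \near F, N ((A t - B) 0 j) < e.
    have /cvgrPdist_lt/(_ _ e0') := AB 0 j; apply: filterS => t.
    by rewrite normcE0 ltcR normc_dist !mxE.
  have : \forall t \near F, forall j, N ((A t - B) 0 j) < e by exact: filter_forall.
  by apply: filterS => t /(rnorm_lt _ e0).
apply/cvgrPdist_lt => e /cplx_pos[d d0 ->]; apply: filterS (AB d d0) => t.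
move=> /(rnorm_lt _ d0)/(_ j); rewrite (ord1 i) normcE0 ltcR normc_dist.
by rewrite !mxE.
Qed.

End RowNorm.

Section Frames.
Context {R : realType} {n : nat}.
Local Notation C := (Cplx R).
Local Notation N := (@Normc.normc R).
Local Notation V := 'rV[C]_n.
Implicit Types (u v y : V) (m : V -> 'I_n -> 'I_n -> 'I_n -> C).

Definition mult_mx m y v : 'M[C]_n := \matrix_(i, k) \sum_j v 0 j * m y i j k.

Lemma prodvE m y u v : prodv m y u v = u *m mult_mx m y v.
Proof.
apply/rowP => k; rewrite !mxE; apply: eq_bigr => i _; rewrite mxE mulr_sumr.
by apply: eq_bigr => j _; rewrite mulrA.
Qed.

Definition frame_at m y (f : 'I_n -> V) :=
  (forall i j, prodv m y (f i) (f j) = if i == j then f i else 0) /\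
  \matrix_i f i \in unitmx.

Definition algebra_at m y :=
  (forall u v, prodv m y u v = prodv m y v u) /\
  (forall u v w, prodv m y u (prodv m y v w) = prodv m y (prodv m y u v) w).

(** The columns are the forms dual to the frame: [(v *m coframe f) 0 i] is the
    i-th component of [v]. *)
Definition coframe (f : 'I_n -> V) : 'M[C]_n := invmx (\matrix_i f i).

Lemma frame_decomp m y f v : frame_at m y f ->
  v = \sum_i (v *m coframe f) 0 i *: f i.
Proof.
move=> [_ fu]; rewrite -[LHS](mulmxKV fu) [LHS]mulmx_sum_row.
by apply: eq_bigr => i _; rewrite rowK.
Qed.

Lemma frame_coord m y f v i : frame_at m y f ->
  v *m mult_mx m y (f i) = (v *m coframe f) 0 i *: f i.
Proof.
move=> ff; rewrite {1}(frame_decomp v ff) mulmx_suml (bigD1 i)//= big1 => [|j ji].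
  by rewrite addr0 -scalemxAl -prodvE ff.1 eqxx.
by rewrite -scalemxAl -prodvE ff.1 (negbTE ji) scaler0.
Qed.

Lemma coframe_row m y f i : frame_at m y f -> f i *m coframe f = delta_mx 0 i.
Proof.
move=> [_ fu]; have <- : row i (\matrix_i f i) = f i by rewrite rowK.
by rewrite -row_mul mulmxV// row1.
Qed.

Lemma frame_neq0 m y f i : frame_at m y f -> f i != 0 :> V.
Proof.
move=> ff; apply/eqP => E; have := coframe_row i ff; rewrite E mul0mx => /rowP/(_ i).
by rewrite !mxE !eqxx => /eqP; rewrite eq_sym oner_eq0.
Qed.

Lemma cvg_mult_mx (T : Type) (F : set_system T) {FF : Filter F} m (y : T -> V) y0
    (v : T -> V) v0 :
  (forall i j k, (fun t => m (y t) i j k) @ F --> m y0 i j k) ->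
  cvg_mx F v v0 -> cvg_mx F (fun t => mult_mx m (y t) (v t)) (mult_mx m y0 v0).
Proof.
move=> mc vc i k; rewrite mxE; under eq_fun do rewrite mxE.
apply: cvg_bigsum => j; apply: cvgM; [exact: vc|exact: mc].
Qed.

Lemma cvg_prodv (T : Type) (F : set_system T) {FF : Filter F} m (y : T -> V) y0
    (u v : T -> V) u0 v0 :
  (forall i j k, (fun t => m (y t) i j k) @ F --> m y0 i j k) ->
  cvg_mx F u u0 -> cvg_mx F v v0 ->
  cvg_mx F (fun t => prodv m (y t) (u t) (v t)) (prodv m y0 u0 v0).
Proof.
move=> mc uc vc; rewrite prodvE; under eq_fun do rewrite prodvE.
by apply: cvg_mulmx => //; exact: cvg_mult_mx.
Qed.

(** An idempotent of a frame deforms with the algebra: the eigenvalue 1 of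
    multiplication by it moves continuously, and so does the eigenvector. *)
Lemma idempotent_near m y0 f i (e : R) : 0 < e -> frame_at m y0 f ->
  (forall i j k, {for y0, continuous (fun y => m y i j k)}) ->
  (\forall y \near y0, algebra_at m y) ->
  \forall y \near y0, exists2 v, prodv m y v v = v & rnorm (v - f i) < e.
Proof.
move=> e0 ff mc ma; pose P0 := mult_mx m y0 (f i).
have n0 : (0 < n)%N by exact: leq_ltn_trans (ltn_ord i).
have fi0 := frame_neq0 i ff.
have fP : f i *m P0 = f i by rewrite -prodvE ff.1 eqxx.
have Ac : cvg_mx (nbhs y0) (fun y => mult_mx m y (f i)) P0.
  apply: (@cvg_mult_mx _ _ _ m id); first exact: mc.
  exact: cvg_mx_cst.
have /choice[l lP] : forall y, exists l : C, \det (l%:M - mult_mx m y (f i)) = 0 /\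
    `|l - 1| ^+ n <= `|\det (1%:M - mult_mx m y (f i))|.
  move=> y; have [l l0 l1] := @det_root_near (complex R) n (mult_mx m y (f i)) 1 n0.
  by exists l.
have d0 : \det (1%:M - P0) = 0.
  by apply/eqP/det0P; exists (f i) => //; rewrite mulmxBr mulmx1 fP subrr.
have dc : (fun y => \det (1%:M - mult_mx m y (f i))) @ y0 --> (0 : C).
  by rewrite -d0; exact: cvg_det (cvg_mxB (cvg_mx_cst (A := 1%:M)) Ac).
have lc : l @ y0 --> (1 : C).
  apply/(@cvg_cplx _ _ (nbhs y0)) => r r0.
  have /(@cvg_cplx _ _ (nbhs y0))/(_ _ (exprn_gt0 n r0)) := dc.
  apply: filterS => y; rewrite subr0 -ltcR -normcE0 => h.
  have := le_lt_trans (lP y).2 h; rewrite rmorphXn /= -ltcR -normcE0.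
  have r0' : 0 < (r%:C%C : C) by rewrite ltcR.
  by rewrite ltr_pXn2r// ?nnegrE// ltW.
pose Nm y := (l y)%:M - mult_mx m y (f i) + P0.
have Nc : cvg_mx (nbhs y0) Nm 1%:M.
  have -> : 1%:M = 1%:M - P0 + P0 by rewrite subrK.
  exact: (cvg_mxD (cvg_mxB (cvg_scalar_mx lc) Ac) (cvg_mx_cst (A := P0))).
have uN : \forall y \near y0, Nm y \in unitmx by exact: (cvg_unitmx Nc (unitmx1 _ _)).
pose w y := f i *m invmx (Nm y).
have wc : cvg_mx (nbhs y0) w (f i).
  have -> : f i = f i *m invmx 1%:M by rewrite invmx1 mulmx1.
  exact: (cvg_mulmx (cvg_mx_cst (A := (f i))) (cvg_invmx Nc (unitmx1 _ _))).
pose a v : C := (v *m coframe f) 0 i.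
have wwc : cvg_mx (nbhs y0) (fun y => prodv m y (w y) (w y)) (f i).
  have E : f i = prodv m y0 (f i) (f i) by rewrite ff.1 eqxx.
  rewrite {1}E.
  exact: (@cvg_prodv _ _ _ m id _ _ _ _ _ mc wc wc).
pose k y := a (prodv m y (w y) (w y)).
have kc : k @ y0 --> (1 : C).
  have H : cvg_mx (nbhs y0) (fun y => prodv m y (w y) (w y) *m coframe f)
    (f i *m coframe f) by exact: (cvg_mulmx wwc (cvg_mx_cst (A := coframe f))).
  have := H 0 i; by rewrite (coframe_row i ff) mxE !eqxx.
have k0 : \forall y \near y0, k y != 0 by exact: (cvg_neq0 kc (oner_neq0 _)).
pose v y := (k y)^-1 *: w y.
have vc : cvg_mx (nbhs y0) v (f i).
  rewrite -[f i]scale1r -invr1; exact: (cvg_mxZ (cvgV (oner_neq0 _) kc) wc).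
have ve : \forall y \near y0, rnorm (v y - f i) < e by exact: ((cvg_row_rnorm v (f i)).1 vc e e0).
near=> y; exists (v y); last by near: y.
have [aC aA] : algebra_at m y by near: y.
have uNy : Nm y \in unitmx by near: y.
have k0y : k y != 0 by near: y.
rewrite /v; apply: (@scaled_idempotent _ _ _ (mult_mx m y)) => //.
  by move=> ? ?; rewrite prodvE.
rewrite /k; apply: (@eigenvector_square _ _ _ (mult_mx m y) _ _ _ (f i) P0 a (l y)) => //.
- by move=> ? ?; rewrite prodvE.
- by move=> u; exact: frame_coord.
- exact: (lP y).1.
Unshelve. all: by end_near. Qed.

Lemma prodv_bound m y0 :
  (forall i j k, {for y0, continuous (fun y => m y i j k)}) ->
  exists2 K : R, 0 < K & \forall y \near y0, forall u v,
    rnorm (prodv m y u v) <= K * rnorm u * rnorm v.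
Proof.
move=> mc; pose M := 1 + \sum_i \sum_j \sum_k N (m y0 i j k).
have sum0 i j : 0 <= \sum_k N (m y0 i j k).
  by apply: sumr_ge0 => k _; exact: normc_ge0.
have M1 i j k : 1 + N (m y0 i j k) <= M.
  rewrite lerD2l (bigD1 i)//= (bigD1 j)//= (bigD1 k)//= -!addrA lerDl.
  apply: addr_ge0; first by apply: sumr_ge0 => ? _; exact: normc_ge0.
  apply: addr_ge0; apply: sumr_ge0 => ? _ //.
  by apply: sumr_ge0 => ? _.
have M0 : 0 < M.
  by rewrite ltr_wpDr//; apply: sumr_ge0 => ? _; apply: sumr_ge0.
have near3 : \forall y \near y0, forall p : 'I_n * 'I_n * 'I_n,
    N (m y p.1.1 p.1.2 p.2) <= M.
  suff h (p : 'I_n * 'I_n * 'I_n) : \forall y \near y0, N (m y p.1.1 p.1.2 p.2) <= M.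
    exact: (filter_forall (nbhs_filter y0) h).
  case: p => -[i j] k /=.
  have /(@cvg_cplx _ _ (nbhs y0))/(_ _ ltr01) := mc i j k; apply: filterS => y h.
  apply: le_trans (M1 i j k).
  rewrite -[X in N X](subrK (m y0 i j k)); apply: le_trans (normcD _ _) _.
  by rewrite lerD2r ltW.
exists (n%:R * n%:R * M + 1).
  by rewrite ltr_wpDl// !mulr_ge0// ltW.
apply: filterS near3 => y My u v.
have h : 0 <= rnorm u * rnorm v by rewrite mulr_ge0 ?rnorm_ge0.
rewrite -mulrA; apply: rnorm_le.
  by rewrite mulr_ge0// addr_ge0// !mulr_ge0// ltW.
move=> k; rewrite mxE.
apply: le_trans (normc_sum _) _.
apply: (@le_trans _ _ (\sum_(i < n) \sum_(j < n) (rnorm u * rnorm v * M))).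
  apply: ler_sum => i _; apply: le_trans (normc_sum _) _; apply: ler_sum => j _.
  rewrite !Normc.normcM; apply: ler_pM; rewrite ?mulr_ge0 ?normc_ge0//.
    by apply: ler_pM; rewrite ?normc_ge0// coord_le.
  exact: My (i, j, k).
rewrite !sumr_const card_ord -[leLHS]mulr_natr -[X in X * _ <= _]mulr_natr mulrDl mul1r.
have -> : rnorm u * rnorm v * M * n%:R * n%:R = n%:R * n%:R * M * (rnorm u * rnorm v).
  by ring.
by rewrite lerDl.
Qed.

(** The difference d of two idempotents satisfies d^3 = d, which a small nonzero
    vector cannot do. *)
Lemma idempotent_isolated m y0 :
  (forall i j k, {for y0, continuous (fun y => m y i j k)}) ->
  (\forall y \near y0, algebra_at m y) ->
  exists2 r : R, 0 < r & \forall y \near y0, forall u v,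
    prodv m y u u = u -> prodv m y v v = v -> rnorm (u - v) < r -> u = v.
Proof.
move=> mc ma; have [K K0 KP] := prodv_bound mc.
exists K^-1; first by rewrite invr_gt0.
near=> y => u v uu vv uv; apply: subr0_eq; apply/eqP; rewrite -rnorm_eq0.
have [aC aA] : algebra_at m y by near: y.
have Ky : forall u v, rnorm (prodv m y u v) <= K * rnorm u * rnorm v by near: y.
have E := idempotent_diff_cube (fun u v => prodvE m y u v) aC aA uu vv.
set d := u - v in uv E *; set t := rnorm d in uv *.
have t0 : 0 <= t by exact: rnorm_ge0.
have h : t <= (K * t) ^+ 2 * t.
  rewrite {1}/t -E; apply: le_trans (Ky _ _) _; rewrite -/t ler_wpM2r//.
  by have := ler_wpM2l (ltW K0) (Ky d d); rewrite -/t expr2 mulrACA mulrA mulrA mulrA.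
have Kt : K * t < 1 by rewrite mulrC -ltr_pdivlMr// mul1r.
rewrite eq_le t0 andbT leNgt; apply/negP => tp; move: h.
rewrite leNgt => /negP; apply; rewrite gtr_pMl// expr_lt1//.
by rewrite mulr_ge0// ltW.
Unshelve. all: by end_near. Qed.

End Frames.

Section Caratheodory.
Context {R : realType} {n : nat}.
Local Notation C := (Cplx R).
Local Notation N := (@Normc.normc R).
Local Notation V := 'rV[C]_n.
Implicit Types (f g h M : V -> C) (y z : V).

Lemma near_near (y0 : V) (P : V -> Prop) : (\forall y \near y0, P y) ->
  \forall y \near y0, \forall z \near y, P z.
Proof.
move=> /near_rnorm[d d0 dP]; apply/near_rnorm; exists d => // y yd.
apply/near_rnorm; exists (d - rnorm (y - y0)); first by rewrite subr_gt0.
move=> z zy; apply: dP; rewrite -(subrK y z) -addrA.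
by apply: le_lt_trans (rnormD _ _) _; rewrite -ltrBrDr.
Qed.

Lemma diff_lipschitz M y : differentiable M y ->
  exists2 B : R, 0 < B & \forall z \near y, N (M z - M y) <= B * rnorm (z - y).
Proof.
move=> Md; have [d d0 dP] := near_diff_rnorm Md ltr01.
exists (1 + \sum_j N (pd j M y)).
  by rewrite ltr_wpDr//; apply: sumr_ge0 => j _; exact: normc_ge0.
apply/near_rnorm; exists d => // z /dP h.
rewrite -(subrK ('d M y (z - y)) (M z - M y)); apply: le_trans (normcD _ _) _.
rewrite mulrDl; apply: lerD => //; rewrite diff_pd// mulr_suml.
apply: le_trans (normc_sum _) _; apply: ler_sum => j _.
by rewrite Normc.normcM mulrC ler_wpM2l ?normc_ge0// coord_le.
Qed.

(** The second factor vanishes at [y], so that the first one enters the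
    differential only through its value. *)
Lemma diff_caratheodory h M y : {for y, continuous h} -> differentiable M y ->
  differentiable (fun z => h z * (M z - M y)) y.
Proof.
move=> hc Md; have [B B0 BP] := diff_lipschitz Md.
have d1 : differentiable (fun z => h y * (M z - M y)) y.
  apply: (@differentiableM _ _ (fun=> h y) (fun z => M z - M y)).
    exact: differentiable_cst.
  apply: (@differentiableB _ _ _ M (fun=> M y)) => //; exact: differentiable_cst.
have [d2 _] : differentiable (fun z => (h z - h y) * (M z - M y)) y /\
    forall j : 'I_n, pd j (fun z => (h z - h y) * (M z - M y)) y = 0.
  apply: (@diff_lform _ _ _ _ (fun=> 0)) => e e0.
  have hc' : \forall z \near y, N (h z - h y) < e / B.
    by move/(@cvg_cplx _ _ (nbhs y)): hc; apply; exact: divr_gt0.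
  have /near_rnorm[d d0 dP] : \forall z \near y, N (h z - h y) < e / B /\
      N (M z - M y) <= B * rnorm (z - y) by exact: (filterI hc' BP).
  exists d => // z /dP[h1 h2].
  rewrite subrr mul0r subr0 /lform big1 ?subr0; last by move=> j _; rewrite mulr0.
  rewrite Normc.normcM; apply: (@le_trans _ _ (e / B * (B * rnorm (z - y)))).
    by apply: ler_pM; rewrite ?normc_ge0// ltW.
  by rewrite mulrA divfK ?gt_eqF.
rewrite (_ : (fun z => _) = (fun z => h y * (M z - M y)) +
  (fun z => (h z - h y) * (M z - M y))); first exact: differentiableD.
by apply/funext => z; rewrite fctE -mulrDl [h y + _]addrC subrK.
Qed.

End Caratheodory.

Section FrameExtension.
Context {R : realType} {n : nat}.
Local Notation C := (Cplx R).
Local Notation V := 'rV[C]_n.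
Implicit Types (u v y z : V) (m : V -> 'I_n -> 'I_n -> 'I_n -> C).

Lemma mult_mxD m y u v : mult_mx m y (u + v) = mult_mx m y u + mult_mx m y v.
Proof.
apply/matrixP => i k; rewrite !mxE -big_split; apply: eq_bigr => j _.
by rewrite mxE mulrDl.
Qed.

(** Subtracting the equations of two idempotents for two multiplications yields a
    linear equation for their difference, whose right-hand side only involves
    the increments of the structure constants. *)
Lemma idempotent_increment m y z u v : algebra_at m y ->
  prodv m y u u = u -> prodv m z v v = v ->
  (v - u) *m (mult_mx m y (v + u) - 1%:M) =
  \row_k - \sum_a \sum_b v 0 a * v 0 b * (m z a b k - m y a b k).
Proof.
move=> [yC _] uu vv.
have E : \row_k - \sum_a \sum_b v 0 a * v 0 b * (m z a b k - m y a b k) =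
    prodv m y v v - prodv m z v v.
  apply/rowP => k; rewrite !mxE -sumrB -sumrN; apply: eq_bigr => a _.
  rewrite -sumrB -sumrN; apply: eq_bigr => b _.
  by rewrite mulrBr opprB.
rewrite E vv mulmxBr mulmx1 mult_mxD mulmxDr !mulmxBl -!prodvE uu (yC u v).
have h (A : zmodType) (a b c d : A) : a - b + (b - c) - (d - c) = a - d.
  by rewrite subrKA opprB addrA subrK.
exact: h.
Qed.

(** Multiplication by 2u - 1 is an involution when u is idempotent. *)
Lemma idempotent_unit m y u : algebra_at m y -> prodv m y u u = u ->
  mult_mx m y (u + u) - 1%:M \in unitmx.
Proof.
move=> [yC yA] uu; have LL : mult_mx m y u *m mult_mx m y u = mult_mx m y u.
  apply/row_matrixP => i; rewrite !rowE mulmxA -!prodvE yC (yC _ u).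
  by rewrite yA uu.
have sq : (mult_mx m y (u + u) - 1%:M) *m (mult_mx m y (u + u) - 1%:M) = 1%:M.
  rewrite mult_mxD mulmxBr mulmx1 !mulmxBl mulmxDr !mulmxDl !mul1mx LL.
  set L := mult_mx m y u; rewrite opprB.
  have h (A : zmodType) (a b : A) : a + a + (a + a) - (a + a) + (b - (a + a)) = b.
    by rewrite addrK addrC subrK.
  exact: h.
by have [] := mulmx1_unit sq.
Qed.

(** The extension is continuous because idempotents persist and are isolated. It
    is differentiable because its increment solves a linear equation
    ([idempotent_increment]), with an invertible matrix depending continuously on
    the point, and with a right-hand side that is differentiable
    ([diff_caratheodory]). *)
Theorem frame_extends m y0 (f : 'I_n -> V) : frame_at m y0 f ->
  (\forall y \near y0, algebra_at m y) ->
  (\forall y \near y0, forall i j k, differentiable (fun z => m z i j k) y) ->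
  exists e : 'I_n -> V -> V, (forall i, e i y0 = f i) /\
  exists2 r : R, 0 < r & \forall y \near y0,
    [/\ frame_at m y (e^~ y),
        forall i k, differentiable (fun z => e i z 0 k) y &
        forall i v, prodv m y v v = v -> rnorm (v - f i) < r -> v = e i y].
Proof.
move=> ff ma md.
have mc y : (forall i j k, differentiable (fun z => m z i j k) y) ->
    forall i j k, {for y, continuous (fun z => m z i j k)}.
  by move=> h i j k; exact: differentiable_continuous.
have mc0 := mc _ (nbhs_singleton md).
have [r0 r00 r0P] := idempotent_isolated mc0 ma.
pose r := r0 / 2; have rr : 0 < r by rewrite divr_gt0.
(* [f i] is the value at the points without such an idempotent. *)
pose e i y := xget (f i) [set v | prodv m y v v = v /\ rnorm (v - f i) < r].
pose P y := [/\ algebra_at m y, (forall i j k, differentiable (fun z => m z i j k) y),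
  forall u v, prodv m y u u = u -> prodv m y v v = v -> rnorm (u - v) < r0 -> u = v &
  forall i, exists2 v, prodv m y v v = v & rnorm (v - f i) < r].
have nP : \forall y \near y0, P y.
  have h : \forall y \near y0, forall i, exists2 v, prodv m y v v = v & rnorm (v - f i) < r.
    have h i := idempotent_near i rr ff mc0 ma.
    exact: (filter_forall (nbhs_filter y0) h).
  by near=> y; split; near: y.
have spec y i : P y -> prodv m y (e i y) (e i y) = e i y /\ rnorm (e i y - f i) < r.
  by case=> _ _ _ /(_ i)[v vv vf]; exact: (@xgetPex _ (f i)
    [set v | prodv m y v v = v /\ rnorm (v - f i) < r] (ex_intro _ v (conj vv vf))).
have uniq y i v : P y -> prodv m y v v = v -> rnorm (v - f i) < r -> v = e i y.
  move=> Py vv vf; have [_ _ iso _] := Py; have [ee ef] := spec y i Py.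
  apply: iso => //; rewrite -(subrK (f i) v) -addrA; apply: le_lt_trans (rnormD _ _) _.
  by rewrite -[f i - _]opprB rnormN (splitr r0) ltrD.
have conv y (g : 'I_n -> V) i : (\forall z \near y, P z) -> frame_at m y g ->
    rnorm (g i - f i) < r -> cvg_mx (nbhs y) (e i) (g i).
  move=> nPy gf gi; apply/(@cvg_row_rnorm _ _ _ (nbhs y)) => d d0.
  pose d' := Num.min d (r - rnorm (g i - f i)).
  have d'0 : 0 < d' by rewrite lt_min d0 subr_gt0.
  have [Py1 Py2 _ _] := nbhs_singleton nPy.
  have nA : \forall z \near y, algebra_at m z by apply: filterS nPy => z [].
  have := idempotent_near i d'0 gf (mc _ Py2) nA.
  apply: filterS2 nPy => z Pz [v vv]; rewrite lt_min => /andP[v1 v2].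
  rewrite -(uniq z i v Pz vv)// -(subrK (g i) v) -addrA.
  by apply: le_lt_trans (rnormD _ _) _; rewrite -ltrBrDr.
have e0 i : e i y0 = f i.
  apply/esym/uniq; first exact: nbhs_singleton nP.
    by have := ff.1 i i; rewrite eqxx.
  by rewrite subrr rnorm0.
have c0 i : cvg_mx (nbhs y0) (e i) (f i).
  by apply: conv => //; rewrite subrr rnorm0.
have nF : \forall y \near y0, frame_at m y (e^~ y).
  have orth i j : i != j -> \forall y \near y0, prodv m y (e i y) (e j y) = 0.
    move=> ij; have pc : cvg_mx (nbhs y0) (fun y => prodv m y (e i y) (e j y)) 0.
      have -> : 0 = prodv m y0 (f i) (f j) by rewrite ff.1 (negbTE ij).
      exact: (@cvg_prodv _ _ _ _ _ m id _ _ _ _ _ mc0 (c0 i) (c0 j)).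
    have ps := (@cvg_row_rnorm _ _ _ (nbhs y0) _ _ _).1 pc r0 r00.
    near=> y; have Py : P y by near: y.
    have [[yC yA] _ iso _] := Py.
    have [ei _] := spec y i Py; have [ej _] := spec y j Py.
    apply: iso; last by near: y; exact: ps.
      exact: (mul_idempotent yC yA ei ej).
    by rewrite prodvE mul0mx.
  have orth2 : \forall y \near y0, forall p : 'I_n * 'I_n, p.1 != p.2 ->
      prodv m y (e p.1 y) (e p.2 y) = 0.
    have h (p : 'I_n * 'I_n) : \forall y \near y0, p.1 != p.2 ->
        prodv m y (e p.1 y) (e p.2 y) = 0.
      by have [->|/orth] := eqVneq p.1 p.2; [near=> y|apply: filterS => y ->].
    exact: (filter_forall (nbhs_filter y0) h).
  have Mc : cvg_mx (nbhs y0) (fun y => \matrix_i e i y) (\matrix_i f i).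
    by move=> i j; rewrite mxE; under eq_fun do rewrite mxE; exact: c0.
  have nU : \forall y \near y0, \matrix_i e i y \in unitmx.
    by exact: (cvg_unitmx Mc ff.2).
  near=> y; have Py : P y by near: y.
  split; last by near: y.
  move=> i j; have [<-|ij] := eqVneq i j.
    by have [] := spec y i Py.
  by have /(_ (i, j) ij) : forall p : 'I_n * 'I_n, p.1 != p.2 ->
      prodv m y (e p.1 y) (e p.2 y) = 0 by near: y.
exists e; split=> //; exists r => //.
have nnP := near_near nP.
near=> y; have Py : P y by near: y.
have Fy : frame_at m y (e^~ y) by near: y.
split=> // [i k|i v]; last exact: uniq.
have nPy : \forall z \near y, P z by near: y.
have [yA yd _ _] := Py; have [ee ef] := spec y i Py.
have ec : cvg_mx (nbhs y) (e i) (e i y) by exact: (conv y (e^~ y)).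
pose Nm z := mult_mx m y (e i z + e i y) - 1%:M.
have uN : Nm y \in unitmx by exact: idempotent_unit.
have Nc : cvg_mx (nbhs y) Nm (Nm y).
  have Sc : cvg_mx (nbhs y) (fun z => e i z + e i y) (e i y + e i y).
    exact: (cvg_mxD ec (cvg_mx_cst (A := e i y))).
  have Lc : cvg_mx (nbhs y) (fun z => mult_mx m y (e i z + e i y))
      (mult_mx m y (e i y + e i y)).
    have mcst a b c : (fun z : V => m y a b c) @ y --> m y a b c.
      apply/(@cvg_cplx _ _ (nbhs y)) => d d0; apply: nearW => z.
      by rewrite subrr Normc.normc0.
    exact: (@cvg_mult_mx _ _ _ _ _ m (fun=> y) y (fun z => e i z + e i y) _ mcst Sc).
  exact: (cvg_mxB Lc (cvg_mx_cst (A := 1%:M))).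
have nU : \forall z \near y, Nm z \in unitmx by exact: (cvg_unitmx Nc uN).
have Ic : cvg_mx (nbhs y) (fun z => invmx (Nm z)) (invmx (Nm y)).
  exact: (cvg_invmx Nc uN).
pose h c a b z : C := - (e i z 0 a * e i z 0 b * invmx (Nm z) c k).
pose G z : C := e i y 0 k + \sum_c \sum_a \sum_b h c a b z * (m z a b c - m y a b c).
have GE : \forall z \near y, G z = e i z 0 k.
  near=> z; have Pz : P z by near: z.
  have [ez _] := spec z i Pz; have uz : Nm z \in unitmx by near: z.
  have := idempotent_increment yA ee ez => /(canRL (mulmxK uz)).
  move=> /rowP/(_ k); rewrite !mxE /G => /(canRL (subrK _)) ->; rewrite addrC.
  congr (_ + _); apply: eq_bigr => c _; rewrite mxE mulNr mulr_suml -sumrN.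
  apply: eq_bigr => a _; rewrite mulr_suml -sumrN; apply: eq_bigr => b _.
  by rewrite /h mulNr mulrAC.
apply: (near_eq_diff _ GE).1.
have hc c a b : {for y, continuous (h c a b)}.
  exact: (cvgN (cvgM (cvgM (ec 0 a) (ec 0 b)) (Ic c k))).
apply: (@differentiableD _ _ _ (fun=> e i y 0 k)); first exact: differentiable_cst.
apply: differentiable_bigsum => c; apply: differentiable_bigsum => a.
apply: differentiable_bigsum => b.
exact: (diff_caratheodory (hc c a b) (yd a b c)).
Unshelve. all: by end_near. Qed.

End FrameExtension.

Lemma invmx_increment (F : fieldType) n (A B : 'M[F]_n) :
  A \in unitmx -> B \in unitmx ->
  invmx A = invmx B - invmx A *m (A - B) *m invmx B.
Proof.
by move=> uA uB; rewrite mulmxBr mulVmx// mulmxBl mul1mx mulmxK// opprB addrC subrK.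
Qed.

Section Coframes.
Context {R : realType} {n : nat}.
Local Notation C := (Cplx R).
Local Notation V := 'rV[C]_n.
Implicit Types (u v y z : V) (m : V -> 'I_n -> 'I_n -> 'I_n -> C).

Lemma prodv_frame m y f v i : frame_at m y f ->
  prodv m y v (f i) = (v *m coframe f) 0 i *: f i.
Proof. by move=> ff; rewrite prodvE (frame_coord v i ff). Qed.

Lemma scaler_frame_inj m y f i (a b : C) : frame_at m y f ->
  a *: f i = b *: f i -> a = b.
Proof.
move=> ff /eqP; rewrite -subr_eq0 -scalerBl scaler_eq0 (negbTE (frame_neq0 i ff)) orbF.
by rewrite subr_eq0 => /eqP.
Qed.

(** The forms of the dual coframe are the characters of the algebra. *)
Lemma coframeM m y f u v i : frame_at m y f -> algebra_at m y ->
  (prodv m y u v *m coframe f) 0 i = (u *m coframe f) 0 i * (v *m coframe f) 0 i.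
Proof.
move=> ff [yC yA]; apply: (scaler_frame_inj (i := i) ff).
rewrite -(prodv_frame _ _ ff) -yA (prodv_frame v i ff) prodvE.
have -> : mult_mx m y ((v *m coframe f) 0 i *: f i)
    = (v *m coframe f) 0 i *: mult_mx m y (f i).
  apply/matrixP => a b; rewrite !mxE mulr_sumr; apply: eq_bigr => j _.
  by rewrite !mxE mulrA.
by rewrite -scalemxAr -prodvE (prodv_frame u i ff) scalerA mulrC.
Qed.

Lemma coframe1 m y f w i : frame_at m y f -> (forall v, prodv m y w v = v) ->
  (w *m coframe f) 0 i = 1.
Proof.
move=> ff w1; apply: (scaler_frame_inj (i := i) ff).
by rewrite -(prodv_frame w i ff) w1 scale1r.
Qed.

Lemma prodv_delta m y a b :
  prodv m y (delta_mx 0 a) (delta_mx 0 b) = \row_k m y a b k.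
Proof.
apply/rowP => k; rewrite !mxE (bigD1 a)//= (bigD1 b)//= !mxE !eqxx !mul1r.
rewrite [X in _ + X + _]big1 ?addr0; last first.
  by move=> j /negbTE jb; rewrite mxE jb andbF mulr0 mul0r.
rewrite big1 ?addr0// => j /negbTE ja; apply: big1 => l _.
by rewrite !mxE ja andbF !mul0r.
Qed.

Lemma coframe_mult m y f i a b : frame_at m y f -> algebra_at m y ->
  \sum_p m y a b p * coframe f p i = coframe f a i * coframe f b i.
Proof.
move=> ff yA; have := coframeM (delta_mx 0 a) (delta_mx 0 b) i ff yA.
rewrite prodv_delta -!rowE !mxE => <-.
by apply: eq_bigr => p _; rewrite mxE.
Qed.

Lemma coframe_eigen m y f i a p : frame_at m y f ->
  \sum_j f i 0 j * m y a j p = coframe f a i * f i 0 p.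
Proof.
move=> ff; have := prodv_frame (delta_mx 0 a) i ff.
rewrite -rowE => /rowP/(_ p); rewrite !mxE => <-.
rewrite [RHS](bigD1 a)//= [X in _ + X]big1 ?addr0.
  by apply: eq_bigr => j _; rewrite mxE !eqxx mul1r.
by move=> b /negbTE ba; apply: big1 => j _; rewrite mxE ba andbF !mul0r.
Qed.

(** As for the frame, the increment of the inverse matrix is linear in the
    increment of the matrix, with continuous coefficients. *)
Lemma coframe_diff m y (e : 'I_n -> V -> V) k i :
  (\forall z \near y, frame_at m z (e^~ z)) ->
  (forall i k, differentiable (fun z => e i z 0 k) y) ->
  differentiable (fun z => coframe (e^~ z) k i) y.
Proof.
move=> nF ed; pose E z : 'M[C]_n := \matrix_i e i z.
have Ec : cvg_mx (nbhs y) E (E y).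
  move=> a b; rewrite mxE; under eq_fun do rewrite mxE.
  exact: (differentiable_continuous (ed a b)).
have uE : E y \in unitmx by have [] := nbhs_singleton nF.
have Ic : cvg_mx (nbhs y) (fun z => invmx (E z)) (invmx (E y)).
  exact: (cvg_invmx Ec uE).
pose h a b z : C := - (invmx (E z) k a * invmx (E y) b i).
pose G z : C := invmx (E y) k i + \sum_a \sum_b h a b z * (e a z 0 b - e a y 0 b).
have GE : \forall z \near y, G z = coframe (e^~ z) k i.
  near=> z; have [_ uz] : frame_at m z (e^~ z) by near: z.
  have D : coframe (e^~ z) = invmx (E y) - invmx (E z) *m (E z - E y) *m invmx (E y).
    exact: invmx_increment.
  rewrite D /G !mxE; congr (_ + _); rewrite -sumrN exchange_big.
  apply: eq_bigr => b _; rewrite mxE mulr_suml -sumrN; apply: eq_bigr => a _.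
  by rewrite !mxE /h mulNr mulrAC.
apply: (near_eq_diff _ GE).1.
have hc a b : {for y, continuous (h a b)}.
  have cc : (fun z : V => invmx (E y) b i) @ y --> invmx (E y) b i.
    by apply/(@cvg_cplx _ _ (nbhs y)) => d d0; apply: nearW => z; rewrite subrr Normc.normc0.
  exact: (cvgN (cvgM (Ic k a) cc)).
apply: (@differentiableD _ _ _ (fun=> invmx (E y) k i)); first exact: differentiable_cst.
apply: differentiable_bigsum => a; apply: differentiable_bigsum => b.
exact: (diff_caratheodory (hc a b) (ed a b)).
Unshelve. all: by end_near. Qed.

End Coframes.

(** * Canonical coframes of a Frobenius manifold *)
Section FrobeniusCoframe.
Context {R : realType} {n : nat} {M : cmanifold R n} (F : frobenius M).
Local Notation C := (Cplx R).
Local Notation V := 'rV[C]_n.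

Lemma near_chart (a : chart M) p : cdom a p ->
  \forall y \near cmap a p, (cmap a @` cdom a) y.
Proof. by move=> ap; apply: open_nbhs_nbhs; split; [exact: cimg_open|exists p]. Qed.

Lemma chart_algebra (a : chart M) y : (cmap a @` cdom a) y ->
  algebra_at (fr_mult F a) y.
Proof. by move=> ya; split; [exact: fr_multC|exact: fr_multA]. Qed.

(** The last clause recognizes idempotents that depend continuously on the point
    as members of the extended frame. *)
Theorem canonical_coframe (a : chart M) p (f : 'I_n -> V) : cdom a p ->
  frame_at (fr_mult F a) (cmap a p) f ->
  exists e : 'I_n -> V -> V, (forall i, e i (cmap a p) = f i) /\
  exists2 r : R, 0 < r & \forall y \near cmap a p,
    [/\ (cmap a @` cdom a) y, frame_at (fr_mult F a) y (e^~ y),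
        forall k i, differentiable (fun z => coframe (e^~ z) k i) y,
        forall i l k, pd l (fun z => coframe (e^~ z) k i) y =
                      pd k (fun z => coframe (e^~ z) l i) y &
        forall i v, prodv (fr_mult F a) y v v = v -> rnorm (v - f i) < r ->
          v = e i y].
Proof.
move=> ap ff; have nU := near_chart ap.
have nA : \forall y \near cmap a p, algebra_at (fr_mult F a) y.
  by apply: filterS nU => y /chart_algebra.
have nM : \forall y \near cmap a p, forall i j k,
    differentiable (fun z => fr_mult F a z i j k) y.
  by apply: filterS nU => y ya i j k; exact: fr_mult_holo.
have [e [ep [r r0 nE]]] := frame_extends ff nA nM.
exists e; split=> //; exists r => //.
have nF : \forall y \near cmap a p, frame_at (fr_mult F a) y (e^~ y).
  by apply: filterS nE => y [].
have nnF : \forall y \near cmap a p, \forall z \near y,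
    frame_at (fr_mult F a) z (e^~ z) by exact: near_near.
have nnU : \forall y \near cmap a p, \forall z \near y, (cmap a @` cdom a) z.
  exact: near_near.
near=> y.
have Uy : (cmap a @` cdom a) y by near: y.
have nUy : \forall z \near y, (cmap a @` cdom a) z by near: y.
have nFy : \forall z \near y, frame_at (fr_mult F a) z (e^~ z) by near: y.
have [Fy dy uy] : [/\ frame_at (fr_mult F a) y (e^~ y),
    forall i k, differentiable (fun z => e i z 0 k) y &
    forall i v, prodv (fr_mult F a) y v v = v -> rnorm (v - f i) < r -> v = e i y].
  by near: y.
have cd k i := coframe_diff k i nFy dy.
split; [exact: Uy|exact: Fy|exact: cd| |exact: uy] => i l k.
apply: (@character_closed _ _ (fr_metric F a) (fr_mult F a) y
  (fun z k => coframe (e^~ z) k i) (fun j => e i y 0 j)).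
- by move=> ? ?; exact: fr_metric_holo.
- by move=> ? ? ?; exact: fr_mult_holo.
- by move=> ?; exact: cd.
- by apply: filterS nUy => z za; exact: fr_metric_sym.
- exact: fr_metric_nondeg.
- by move=> l' i' j' k'; have [] := fr_potential F Uy l' i' j' k'.
- apply: filterS2 nFy nUy => z Fz Uz b c.
  exact: (coframe_mult i b c Fz (chart_algebra Uz)).
- by move=> b q; exact: (coframe_eigen i b q Fy).
have <- : (e i y *m coframe (e^~ y)) 0 i = 1.
  by rewrite (coframe_row i Fy) mxE !eqxx.
by rewrite mxE.
Unshelve. all: by end_near. Qed.

End FrobeniusCoframe.

(** * Tangent vectors in charts *)
Section TangentVectors.
Context {R : realType} {n : nat} (M : cmanifold R n).
Local Notation C := (Cplx R).
Local Notation V := 'rV[C]_n.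
Implicit Types (a b c : chart M) (p : M) (u v : V).

(** Changes of charts are the composites that one expects only near the point. *)
Lemma diff_comp_near (U W Z : normedModType C) (f : U -> W) (g : W -> Z) (k : U -> Z) x y (u : U) :
  f x = y -> differentiable f x -> differentiable g y ->
  (\forall z \near x, g (f z) = k z) -> 'd k x u = 'd g y ('d f x u).
Proof.
move=> <- fd gd kE; have [_ kd] := near_eq_diff (differentiable_comp fd gd) kE.
by rewrite kd (diff_comp fd gd).
Qed.

Lemma near_cdom a p : cdom a p -> \forall q \near p, cdom a q.
Proof. by move=> ap; apply: open_nbhs_nbhs; split => //; exact: cdom_open. Qed.

Lemma near_cinv a b p : cdom a p -> cdom b p ->
  \forall y \near cmap a p, cdom b (cinv a y).
Proof.
move=> ap bp; apply: (cinv_cont ap); rewrite cmapK//; exact: near_cdom.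
Qed.

Lemma jac_id a p u : cdom a p -> jac a a p u = u.
Proof.
move=> ap; have near_id : \forall y \near cmap a p, id y = (cmap a \o cinv a) y.
  by apply: filterS (near_chart ap) => _ [q aq <-]; rewrite /= cmapK.
have [_ E] := near_eq_diff (f := id) ex_diff near_id.
by rewrite /jac E diff_val.
Qed.

Lemma jac_comp a b c p u : cdom a p -> cdom b p -> cdom c p ->
  jac b c p (jac a b p u) = jac a c p u.
Proof.
move=> ap bp cp; have d1 := transition_holo ap bp; have d2 := transition_holo bp cp.
have e1 : (cmap b \o cinv a) (cmap a p) = cmap b p by rewrite /= cmapK.
apply: esym; apply: (diff_comp_near u e1 d1 d2).
by apply: filterS (near_cinv ap bp) => y by_; rewrite /= cmapK.
Qed.

Definition tlift a p u : tvec M := fun b => jac a b p u.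

Lemma tlift_tangent a p u : cdom a p -> tangent p (tlift a p u).
Proof. by move=> ap b c bp cp; rewrite /tlift (jac_comp u ap bp cp). Qed.

Lemma tangent_teq a p (u v : tvec M) : cdom a p -> tangent p u -> tangent p v ->
  u a = v a -> teq p u v.
Proof. by move=> ap ut vt uv b bp; rewrite (ut a b ap bp) (vt a b ap bp) uv. Qed.

Lemma jacD a b p u v : jac a b p (u + v) = jac a b p u + jac a b p v.
Proof. exact: linearD. Qed.

Lemma jacZ a b p (k : C) u : jac a b p (k *: u) = k *: jac a b p u.
Proof. exact: linearZ. Qed.

Lemma tangentD p (u v : tvec M) : tangent p u -> tangent p v ->
  tangent p (fun a => u a + v a).
Proof. by move=> ut vt a b ap bp; rewrite jacD (ut a b ap bp) (vt a b ap bp). Qed.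

Lemma tangentZ p (k : C) (u : tvec M) : tangent p u -> tangent p (fun a => k *: u a).
Proof. by move=> ut a b ap bp; rewrite jacZ (ut a b ap bp). Qed.

Lemma jac_unitmx a b p : cdom a p -> cdom b p ->
  lin1_mx ('d (cmap b \o cinv a) (cmap a p)) \in unitmx.
Proof.
move=> ap bp; set A := lin1_mx _; pose B := lin1_mx ('d (cmap a \o cinv b) (cmap b p)).
have AE u : u *m A = jac a b p u by rewrite mul_rV_lin1.
have BE u : u *m B = jac b a p u by rewrite mul_rV_lin1.
have ABE u : u *m (A *m B) = u.
  by rewrite mulmxA AE BE (jac_comp u ap bp ap) (jac_id _ ap).
have E : A *m B = 1%:M by apply/row_matrixP => i; rewrite !rowE ABE mulmx1.
exact: (mulmx1_unit E).1.
Qed.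

Section Push.
Context {k : nat}.
Variables (psi : 'rV[C]_k -> M) (x : 'rV[C]_k) (a b : chart M).
Hypothesis psi_cont : {for x, continuous psi}.
Hypotheses (ax : cdom a (psi x)) (bx : cdom b (psi x)).

Lemma near_chart_psi : \forall y \near x, cdom a (psi y).
Proof. by apply: psi_cont; exact: near_cdom. Qed.

Lemma push_jac w : differentiable (cmap a \o psi) x ->
  'd (cmap b \o psi) x w = jac a b (psi x) ('d (cmap a \o psi) x w).
Proof.
move=> d1; have d2 := transition_holo ax bx.
apply: (diff_comp_near w (erefl (cmap a (psi x))) d1 d2).
by apply: filterS near_chart_psi => y ay; rewrite /= cmapK.
Qed.

End Push.
End TangentVectors.

Section FrobeniusFrames.
Context {R : realType} {n : nat} {M : cmanifold R n} (F : frobenius M).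
Local Notation C := (Cplx R).
Local Notation V := 'rV[C]_n.

Lemma idempotent_frame_chart p (f : 'I_n -> tvec M) a : idempotent_frame F p f ->
  cdom a p -> frame_at (fr_mult F a) (cmap a p) (fun i => f i a).
Proof. by move=> [_ h] /h. Qed.

Lemma idempotent_frame_lift p a (f : 'I_n -> V) : cdom a p ->
  frame_at (fr_mult F a) (cmap a p) f ->
  idempotent_frame F p (fun i => tlift a p (f i)).
Proof.
move=> ap [ff fu]; split=> [i|b bp]; first exact: tlift_tangent.
split=> [i j|].
  rewrite /tlift (fr_mult_tensor F ap bp) ff; case: (i == j) => //.
  by rewrite /jac linear0.
rewrite (_ : \matrix_i _ = (\matrix_i f i) *m lin1_mx ('d (cmap b \o cinv a) (cmap a p))).
  by rewrite unitmx_mul fu jac_unitmx.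
by apply/row_matrixP => i; rewrite row_mul !rowK mul_rV_lin1.
Qed.

Lemma unit_chart p a : cdom a p -> forall v,
  prodv (fr_mult F a) (cmap a p) (field_at (fr_unit F) p a) v = v.
Proof. by move=> ap v; exact: (@fr_unitP _ _ _ F a _ (ex_intro2 _ _ p ap erefl)). Qed.

End FrobeniusFrames.

(** * Difference quotients and parametrizations *)
Section Quotients.
Context {R : realType}.
Local Notation C := (Cplx R).
Local Notation N := (@Normc.normc R).

Lemma cvg_near_eq (V : normedModType C) (T : Type) (G : set_system T) {FG : Filter G}
    (f g : T -> V) (y : V) :
  f @ G --> y -> (\forall t \near G, f t = g t) -> g @ G --> y.
Proof.
move=> /cvg_rnorm fy fg; apply/cvg_rnorm => e e0.
by apply: filterS (filterI fg (fy e e0)) => t [<-].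
Qed.

Lemma mulmx_rnorm_bound k n (P : 'M[C]_(k, n)) :
  exists2 K : R, 0 < K & forall v : 'rV[C]_k, rnorm (v *m P) <= K * rnorm v.
Proof.
exists (1 + \sum_i \sum_j N (P i j)).
  by rewrite ltr_wpDr//; apply: sumr_ge0 => i _; apply: sumr_ge0 => j _; exact: normc_ge0.
move=> v; set K := \sum_i _; have K0 : 0 <= K.
  by apply: sumr_ge0 => i _; apply: sumr_ge0 => j _; exact: normc_ge0.
apply: rnorm_le => [|j]; first by rewrite mulr_ge0 ?rnorm_ge0 ?addr_ge0.
rewrite mulrDl mul1r; apply: (@le_trans _ _ (K * rnorm v)); last by rewrite lerDr rnorm_ge0.
rewrite mxE; apply: le_trans (normc_sum _) _.
rewrite /K mulr_suml; apply: ler_sum => i _.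
rewrite Normc.normcM mulrC; apply: ler_pM; rewrite ?normc_ge0 ?coord_le//.
by rewrite (bigD1 j)//= lerDl; apply: sumr_ge0 => l _; exact: normc_ge0.
Qed.

Section Filtered.
Context {T : Type} (G : set_system T) {FG : Filter G}.
Context {V W : normedModType C}.
Variables (h : T -> V) (c : T -> C) (x : V) (f : V -> W).
Hypothesis hx : h @ G --> x.
Hypothesis fd : differentiable f x.

(** The divisors [c] are arbitrary: they are real increments for velocities of
    curves, and complex ones for tangent vectors of surfaces. *)
Lemma remainder_small (e : R) : 0 < e ->
  \forall t \near G, rnorm ((c t)^-1 *: (f (h t) - f x - 'd f x (h t - x))) <=
    e * rnorm ((c t)^-1 *: (h t - x)).
Proof.
move=> e0; have [d d0 dP] := near_diff_rnorm fd e0.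
have /cvg_rnorm/(_ d d0) := hx; apply: filterS => t /dP h1.
by rewrite !rnormZ mulrCA ler_wpM2l// normc_ge0.
Qed.

Lemma quotient_chain (w : V) : (fun t => (c t)^-1 *: (h t - x)) @ G --> w ->
  (fun t => (c t)^-1 *: (f (h t) - f x)) @ G --> 'd f x w.
Proof.
move=> hw.
have Lw : (fun t => 'd f x ((c t)^-1 *: (h t - x))) @ G --> 'd f x w.
  by apply: continuous_cvg hw; exact: (diff_continuous fd).
have B0 : 0 < rnorm w + 1 by rewrite ltr_wpDl// rnorm_ge0.
apply/cvg_rnorm => e e0; have e2 : 0 < e / 2 by rewrite divr_gt0.
have /cvg_rnorm/(_ _ ltr01) h1 := hw.
have /cvg_rnorm/(_ _ e2) h2 := Lw.
have h3 := remainder_small (divr_gt0 e2 B0).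
apply: filterS (filterI h1 (filterI h2 h3)) => t [k1 [k2 k3]].
have k4 : rnorm ((c t)^-1 *: (h t - x)) < rnorm w + 1.
  rewrite -[X in rnorm X](subrK w) addrC.
  by apply: le_lt_trans (rnormD _ _) _; rewrite ltrD2l.
rewrite (_ : _ - _ = (c t)^-1 *: (f (h t) - f x - 'd f x (h t - x)) +
   ('d f x ((c t)^-1 *: (h t - x)) - 'd f x w)); last first.
  by rewrite linearZ /= [X in _ = X + _]scalerBr addrA subrK.
apply: le_lt_trans (rnormD _ _) _; rewrite [e]splitr; apply: ler_ltD k2.
apply: le_trans k3 _; rewrite -[leRHS](divfK (lt0r_neq0 B0)).
by rewrite ler_wpM2l// ltW// divr_gt0.
Qed.

End Filtered.

(** An immersion detects difference quotients: a left inverse of the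
    differential turns those of [f o h] into those of [h], up to a remainder
    which is a small multiple of the latter. *)
Lemma quotient_immersion (T : Type) (G : set_system T) {FG : Filter G} k n
    (h : T -> 'rV[C]_k) (c : T -> C) (x : 'rV[C]_k) (f : 'rV[C]_k -> 'rV[C]_n)
    (y : 'rV[C]_n) :
  h @ G --> x -> differentiable f x ->
  (forall w, 'd f x w = 0 -> w = 0) ->
  (fun t => (c t)^-1 *: (f (h t) - f x) : 'rV[C]_n) @ G --> y ->
  exists w : 'rV[C]_k, (fun t => (c t)^-1 *: (h t - x) : 'rV[C]_k) @ G --> w.
Proof.
move=> hx fd finj fy; pose A := lin1_mx ('d f x).
have LA w : w *m A = 'd f x w by rewrite mul_rV_lin1.
have rfA : row_free A.
  apply/row_freeP; exists (pinvmx A); apply: mulmxVp.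
  rewrite -kermx_eq0; apply/eqP/row_matrixP => i; rewrite row0; apply: finj.
  by rewrite -LA -row_mul mulmx_ker row0.
pose P := pinvmx A; have AP : A *m P = 1%:M by exact: mulmxVp.
have [K K0 KP] := mulmx_rnorm_bound P.
exists (y *m P); apply/cvg_rnorm => e e0.
pose q t : 'rV[C]_k := (c t)^-1 *: (h t - x); pose r t : 'rV[C]_n := (c t)^-1 *: (f (h t) - f x).
pose s t : 'rV[C]_n := (c t)^-1 *: (f (h t) - f x - 'd f x (h t - x)).
have qE t : q t = (r t - s t) *m P.
  rewrite /r /s -scalerBr opprB addrC subrK -LA -scalemxAl -mulmxA.
  by rewrite AP mulmx1.
have K2 : 0 < (K *+ 2)^-1 by rewrite invr_gt0 mulrn_wgt0.
pose B := (K *+ 2) * (rnorm y + 1).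
have B0 : 0 < B by rewrite mulr_gt0 ?mulrn_wgt0// ltr_wpDl// rnorm_ge0.
have e2 : 0 < e / 2 / K by rewrite !divr_gt0.
have /cvg_rnorm/(_ _ ltr01) h1 := fy.
have /cvg_rnorm/(_ _ e2) h2 := fy.
have h3 : \forall t \near G, rnorm (s t) <= (K *+ 2)^-1 * rnorm (q t).
  by exact: (remainder_small c hx fd K2).
have h4 : \forall t \near G, rnorm (s t) <= (e / 2 / K / B) * rnorm (q t).
  by exact: (remainder_small c hx fd (divr_gt0 e2 B0)).
apply: filterS (filterI h1 (filterI h2 (filterI h3 h4))) => t [k1 [k2 [k3 k4]]].
rewrite -/(r t) in k1 k2; rewrite -/(q t).
have k5 : rnorm (r t) < rnorm y + 1.
  rewrite -[X in rnorm X](subrK y) addrC.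
  by apply: le_lt_trans (rnormD _ _) _; rewrite ltrD2l.
have k6 : rnorm (q t) <= B.
  have k7 : rnorm (q t) <= K * rnorm (r t) + 2^-1 * rnorm (q t).
    rewrite {1}qE; apply: le_trans (KP _) _.
    have -> : K * rnorm (r t) + 2^-1 * rnorm (q t) =
        K * (rnorm (r t) + (K *+ 2)^-1 * rnorm (q t)).
      by rewrite mulrDr mulrA -[K *+ 2]mulr_natr invfM mulrA mulfV ?mul1r// lt0r_neq0.
    rewrite ler_wpM2l// ?(ltW K0)//; apply: le_trans (rnormD _ _) _.
    by rewrite rnormN lerD2l.
  have k8 : K * rnorm (r t) <= K * (rnorm y + 1) by rewrite ler_wpM2l ?(ltW K0) ?(ltW k5).
  rewrite /B mulrnAl; move: k7 k8; clear; move: (rnorm (q t)) (K * _) (K * _) => a b d.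
  lra.
rewrite qE -mulmxBl (_ : r t - s t - y = (r t - y) - s t); last by rewrite addrAC.
apply: le_lt_trans (KP _) _; rewrite mulrC -ltr_pdivlMr//.
apply: le_lt_trans (rnormD _ _) _; rewrite rnormN.
rewrite {1}[e]splitr mulrDl; apply: ltr_leD k2 _.
apply: le_trans k4 _; rewrite -[leRHS](divfK (lt0r_neq0 B0)).
by rewrite ler_wpM2l// ltW// divr_gt0.
Qed.

Lemma has_deriv_chain (V W : normedModType C) (I : set R) (x : R -> V) (t : R) (x' : V)
    (f : V -> W) : x @ within I (t^') --> x t -> differentiable f (x t) ->
  has_deriv I x t x' -> has_deriv I (f \o x) t ('d f (x t) x').
Proof. by move=> xc fd; exact: quotient_chain. Qed.

End Quotients.

Section Parametrizations.
Context {R : realType} {M : cmanifold R 3} (S : set M).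
Local Notation C := (Cplx R).
Local Notation P := 'rV[C]_2.
Implicit Types (D : set P) (psi : P -> M) (x : P).

(** A parametrization is open onto its image in [S], and injective: a family of
    points of [S] tending to [psi x] has parameters tending to [x]. *)
Lemma lift_near D psi x (T : Type) (G : set_system T) {FG : Filter G} (b : T -> M) :
  local_param S D psi -> D x -> b @ G --> psi x -> (\forall t \near G, S (b t)) ->
  exists2 h : T -> P, h @ G --> x & \forall t \near G, D (h t) /\ psi (h t) = b t.
Proof.
move=> [Do psi_inj _ psi_open _] Dx bx Sb.
have near_pre B : nbhs x B ->
    \forall t \near G, exists y, [/\ B y, D y & psi y = b t].
  move=> xB; have Bo : open (interior B `&` D) by apply: openI => //; exact: open_interior.
  have [U [Uo UE]] := psi_open _ Bo (@subIsetr _ _ _).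
  have Ux : U (psi x).
    have : (psi @` (interior B `&` D)) (psi x) by exists x.
    by rewrite UE => -[].
  have Ub : \forall t \near G, U (b t).
    by apply: bx; apply: open_nbhs_nbhs.
  apply: filterS (filterI Sb Ub) => t SU.
  have : (S `&` U) (b t) by [].
  by rewrite -UE => -[y [By Dy] yb]; exists y; split=> //; exact: interior_subset By.
have /choice[h hP] : forall t, exists y, (exists2 z, D z & psi z = b t) -> D y /\ psi y = b t.
  move=> t; have [[z Dz zb]|nz] := pselect (exists2 z, D z & psi z = b t); first by exists z.
  by exists x => /nz.
exists h.
  move=> B /near_pre; apply: filterS => t [y [By Dy yb]].
  have [Dh hb] : D (h t) /\ psi (h t) = b t by apply: hP; exists y.
  have E : h t = y by apply: psi_inj; rewrite ?inE// hb yb.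
  by rewrite /= E.
apply: filterS (near_pre setT filterT) => t [y [_ Dy yb]].
by apply: hP; exists y.
Qed.

(** A complex line through the parameter that defines the tangent vector is sent
    into [S], and lifted to the parametrization [psi]; the lift has a velocity
    because [psi] is an immersion. *)
Lemma surf_tangent_push D psi x u : local_param S D psi -> D x ->
  surf_tangent S (psi x) u -> exists w, teq (psi x) u (push psi x w).
Proof.
move=> lp Dx [D' [psi' [x' [w' [lp' Dx' px' uE]]]]].
have [D'o _ psi'c psi'o psi'd] := lp'; have [Do _ psic _ psid] := lp.
have F0 : Filter ((0 : C)^') by exact: dnbhs_filter.
pose l (z : C) : P := x' + z *: w'.
have l0 : l 0 = x' by rewrite /l scale0r addr0.
have ld : {for (0 : C), continuous l}.
  have lz : (fun z : C => z *: w') @ (0 : C) --> (0 : C) *: w' by exact: scalel_continuous.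
  exact: (cvgD (cvg_cst x') lz).
have lc : l @ (0 : C)^' --> x'.
  by rewrite -l0; apply: cvg_within_filter; exact: ld.
have Sb : \forall z \near (0 : C)^', S (psi' (l z)).
  have D'S z : D' z -> S (psi' z).
    move=> Dz; have [U [_ UE]] := psi'o _ D'o (fun _ => id).
    by have : (psi' @` D') (psi' z) by [exists z]; rewrite UE => -[].
  have D'x : nbhs x' D' by exact: open_nbhs_nbhs (conj D'o Dx').
  have near_D : \forall z \near (0 : C)^', D' (l z) by exact: (lc _ D'x).
  by near=> z; apply: D'S; near: z.
have bc : (psi' \o l) @ (0 : C)^' --> psi x.
  by rewrite -px'; apply: cvg_comp lc _; exact: (psi'c _ Dx').
have [h hx hb] := lift_near (FG := F0) lp Dx bc Sb.
have [a ax] := chart_cover (psi x).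
have ax' : cdom a (psi' x') by rewrite px'.
have [fd finj] := psid _ _ Dx ax; have [fd' _] := psi'd _ _ Dx' ax'.
have lq : (fun z : C => z^-1 *: (l z - x') : P) @ (0 : C)^' --> w'.
  apply: cvg_near_cst; near=> z.
  have z0 : z != 0 by near: z; exact: nbhs_dnbhs_neq.
  by rewrite /l addrAC subrr add0r scalerA mulVf// scale1r.
have q' := quotient_chain (FG := F0) lc fd' lq.
have q : (fun z : C => z^-1 *: ((cmap a \o psi) (h z) - (cmap a \o psi) x) : 'rV[C]_3)
    @ (0 : C)^' --> 'd (cmap a \o psi') x' w'.
  apply: (cvg_near_eq q'); near=> z.
  have [_ E] : D (h z) /\ psi (h z) = psi' (l z) by near: z.
  by rewrite /= E px'.
have [w hw] := quotient_immersion (FG := F0) hx fd finj q.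
exists w; have q2 := quotient_chain (FG := F0) hx fd hw.
have E : 'd (cmap a \o psi') x' w' = 'd (cmap a \o psi) x w.
  exact: (cvg_unique _ q q2).
move=> b bx; rewrite (uE _ bx) /push; have bx' : cdom b (psi' x') by rewrite px'.
have E1 := push_jac (psi'c _ Dx') ax' bx' w' fd'; have E2 := push_jac (psic _ Dx) ax bx w fd.
have E3 p1 p2 X Y : p1 = p2 -> X = Y -> jac a b p1 X = jac a b p2 Y by move=> -> ->.
exact: etrans E1 (etrans (E3 _ _ _ _ px' E) (esym E2)).
Unshelve. all: by end_near. Qed.

End Parametrizations.

(** * Pulling back closed forms *)
Section RowMaps.
Context {R : realType} {k n : nat}.
Local Notation C := (Cplx R).
Local Notation N := (@Normc.normc R).
Implicit Types (f : 'rV[C]_k -> 'rV[C]_n) (x v w : 'rV[C]_k).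

Lemma mulmxr_continuous (J : 'M[C]_(k, n)) :
  continuous (mulmxr J : 'rV[C]_k -> 'rV[C]_n).
Proof.
move=> x; have [K K0 KJ] := mulmx_rnorm_bound J.
apply/(@cvg_rnorm _ _ _ (nbhs x)) => e e0; apply: (near_rnorm x _).2.
exists (e / K); first exact: divr_gt0.
move=> y yx; rewrite /= -mulmxBl; apply: le_lt_trans (KJ _) _.
by rewrite mulrC -ltr_pdivlMr.
Qed.

Definition jacobian f x : 'M[C]_(k, n) := \matrix_(i, j) pd i (fun y => f y 0 j) x.

Lemma diff_row f x : (forall j, differentiable (fun y => f y 0 j) x) ->
  differentiable f x /\ forall v, 'd f x v = v *m jacobian f x.
Proof.
move=> fd; have [] := @diff_near_rnorm _ _ _ f x (mulmxr (jacobian f x)).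
- exact: mulmxr_continuous.
- move=> e e0; have h j : \forall y \near x,
      N (f y 0 j - f x 0 j - ((y - x) *m jacobian f x) 0 j) <= e * rnorm (y - x).
    have [d d0 dP] := near_diff_rnorm (fd j) e0; apply/near_rnorm; exists d => // y /dP.
    rewrite rnormC; suff -> : 'd (fun y => f y 0 j) x (y - x) = ((y - x) *m jacobian f x) 0 j by [].
    by rewrite (diff_pd _ (fd j)) [RHS]mxE; apply: eq_bigr => i _; rewrite [jacobian f x i j]mxE.
  have /near_rnorm[d d0 dP] := filter_forall (nbhs_filter x) h.
  exists d => // y /dP hy; apply: rnorm_le => [|j].
    by rewrite mulr_ge0 ?rnorm_ge0 ?ltW.
  by have := hy j; rewrite !mxE.
by move=> fd' E; split=> // v; rewrite E.
Qed.

Lemma row_diff f x j : differentiable f x -> differentiable (fun y => f y 0 j) x.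
Proof.
move=> fd; apply: (@differentiable_comp _ _ _ _ f (fun M : 'rV[C]_n => M 0 j)) => //.
exact: differentiable_coord.
Qed.

Lemma diff_jacobian f x v : differentiable f x -> 'd f x v = v *m jacobian f x.
Proof. by move=> fd; apply: (diff_row _).2 => j; exact: row_diff. Qed.

End RowMaps.

Section ChainRule.
Context {R : realType} {k n : nat}.
Local Notation C := (Cplx R).

Lemma pd_comp (f : 'rV[C]_k -> 'rV[C]_n) (g : 'rV[C]_n -> C) x i :
  differentiable f x -> differentiable g (f x) ->
  pd i (fun y => g (f y)) x = \sum_l pd i (fun y => f y 0 l) x * pd l g (f x).
Proof.
move=> fd gd; have gfd : differentiable (g \o f) x by exact: differentiable_comp.
rewrite (pdE i gfd).
have -> : 'd (g \o f) x (ebase i) = 'd g (f x) ('d f x (ebase i)).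
  by rewrite (diff_comp fd gd).
rewrite (diff_pd _ gd); apply: eq_bigr => l _; congr (_ * _).
by rewrite (diff_jacobian _ fd) -rowE !mxE.
Qed.

End ChainRule.

Lemma alternating_sum (F : fieldType) n (a b : 'I_n -> F) (t : 'I_n -> 'I_n -> F) :
  (forall l k, t l k = t k l) ->
  \sum_k b k * (\sum_l a l * t l k) - \sum_k a k * (\sum_l b l * t l k) = 0.
Proof.
move=> ts; apply/eqP; rewrite subr_eq0; apply/eqP.
under eq_bigr do rewrite mulr_sumr.
under [RHS]eq_bigr do rewrite mulr_sumr.
rewrite exchange_big; apply: eq_bigr => l _; apply: eq_bigr => k _.
by rewrite ts mulrCA.
Qed.

Lemma addKr_sub_eq0 (F : fieldType) (a b c d : F) : c = d -> a - b = 0 -> a + c - (b + d) = 0.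
Proof. by move=> -> ab; rewrite opprD addrACA subrr addr0. Qed.

Section Pullback.
Context {R : realType} {n : nat}.
Local Notation C := (Cplx R).
Variables (f : 'rV[C]_2 -> 'rV[C]_n) (th : 'rV[C]_n -> 'I_n -> C) (x : 'rV[C]_2).

(** The components are written with partial derivatives, to which [holo_pd] and
    [holo_pdC] apply. *)
Definition pullback y : 'rV[C]_2 :=
  \row_c \sum_k pd c (fun z => f z 0 k) y * th (f y) k.

Lemma ev_pullback w : differentiable f x ->
  ev (pullback x) w = \sum_k ('d f x w) 0 k * th (f x) k.
Proof.
move=> fd; rewrite /ev mxE; under eq_bigr do rewrite !mxE.
have E : forall k, ('d f x w) 0 k = \sum_c w 0 c * pd c (fun z => f z 0 k) x.
  by move=> k; rewrite (diff_jacobian _ fd) mxE; apply: eq_bigr => c _; rewrite [jacobian f x c k]mxE.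
under [RHS]eq_bigr do rewrite E mulr_suml.
rewrite exchange_big; apply: eq_bigr => c _; rewrite mulr_suml.
by apply: eq_bigr => k _; rewrite mulrC mulrA.
Qed.

Hypothesis fd : \forall y \near x, differentiable f y.
Hypothesis thd : forall k, differentiable (fun z => th z k) (f x).

Let fx : differentiable f x. Proof. exact: nbhs_singleton fd. Qed.

Let pfd c k : differentiable (pd c (fun z => f z 0 k)) x.
Proof. by apply: holo_pd; apply: filterS fd => y; exact: row_diff. Qed.

Let thfd k : differentiable (fun y => th (f y) k) x.
Proof. exact: (differentiable_comp (g := fun z => th z k) fx (thd k)). Qed.

Let termd c k :
  differentiable (fun y => pd c (fun z => f z 0 k) y * th (f y) k) x.
Proof. exact: (differentiableM (pfd c k) (thfd k)). Qed.

Lemma pullback_coord c :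
  (fun y => pullback y 0 c) = (fun y => \sum_k pd c (fun z => f z 0 k) y * th (f y) k).
Proof. by apply/funext => y; rewrite mxE. Qed.

Lemma pullback_diff : differentiable pullback x.
Proof.
apply: (diff_row _).1 => c; rewrite pullback_coord.
by apply: differentiable_bigsum => k; exact: termd.
Qed.

Lemma pd_pullback a c : pd a (fun y => pullback y 0 c) x =
  \sum_k pd c (fun z => f z 0 k) x *
         (\sum_l pd a (fun z => f z 0 l) x * pd l (fun z => th z k) (f x)) +
  \sum_k th (f x) k * pd a (pd c (fun z => f z 0 k)) x.
Proof.
rewrite pullback_coord (pd_sum a (termd c)) -big_split /=; apply: eq_bigr => k _.
rewrite (pdM a (pfd c k) (thfd k)).
by rewrite (pd_comp (g := fun z => th z k) a fx (thd k)).
Qed.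

(** Exterior derivative commutes with pull-back: the second derivatives of [f]
    cancel by symmetry and the remaining terms are the pull-back of the
    exterior derivative of [th]. *)
Lemma pullback_closed :
  (forall l k, pd l (fun z => th z k) (f x) = pd k (fun z => th z l) (f x)) ->
  extd pullback x = 0.
Proof.
move=> thc; rewrite /extd !pd_pullback.
apply: addKr_sub_eq0; last first.
  exact: (alternating_sum (fun k => pd 0 (fun z => f z 0 k) x)
    (fun k => pd 1 (fun z => f z 0 k) x) thc).
apply: eq_bigr => k _; apply: congr1.
by apply: holo_pdC; apply: filterS fd => y; exact: row_diff.
Qed.

End Pullback.

(** * Linear algebra of one-forms on the plane *)
Section ThreeIndices.

Lemma sum3 (V : nmodType) (f : 'I_3 -> V) : \sum_i f i = f 0 + f 1 + f 2.
Proof.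
rewrite !big_ord_recl big_ord0 addr0 addrA.
by congr (_ + f _ + f _); exact: val_inj.
Qed.

Lemma forall3 (P : 'I_3 -> Prop) : P 0 -> P 1 -> P 2 -> forall i, P i.
Proof.
move=> P0 P1 P2 [[|[|[|//]]] i3].
- by rewrite (_ : Ordinal i3 = 0) //; exact: val_inj.
- by rewrite (_ : Ordinal i3 = 1) //; exact: val_inj.
by rewrite (_ : Ordinal i3 = 2) //; exact: val_inj.
Qed.

Lemma succ3 : ((1 + 1 = 2 :> 'I_3) * (1 + 2 = 0 :> 'I_3) * (2 + 1 = 0 :> 'I_3) *
  (2 + 2 = 1 :> 'I_3)).
Proof. by do !split; exact: val_inj. Qed.

Lemma remaining3 (l j k : 'I_3) : l != j -> l != k -> j != k ->
  (j = l + 1 /\ k = l + 2) \/ (j = l + 2 /\ k = l + 1).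
Proof.
by elim/forall3: l; elim/forall3: j; elim/forall3: k => //= _ _ _;
  (left; split; exact: val_inj) || (right; split; exact: val_inj).
Qed.

Lemma succ_neq3 (l : 'I_3) : (l + 1 != l) && (l + 2 != l) && (l + 1 != l + 2).
Proof. by elim/forall3: l. Qed.

End ThreeIndices.

Section FormAlgebra.
Context {R : realType}.
Local Notation C := (Cplx R).
Implicit Types (a b c w v : 'rV[C]_2) (k : C).

Lemma sum2 (V : nmodType) (f : 'I_2 -> V) : \sum_i f i = f 0 + f 1.
Proof.
by rewrite !big_ord_recl big_ord0 addr0; congr (_ + f _); exact: val_inj.
Qed.

Lemma row2P a b : a 0 0 = b 0 0 -> a 0 1 = b 0 1 -> a = b.
Proof.
move=> e0 e1; apply/rowP => -[[|[|//]] i2].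
  by rewrite (_ : Ordinal i2 = 0) //; exact: val_inj.
by rewrite (_ : Ordinal i2 = 1) //; exact: val_inj.
Qed.

Definition row2 (s t : C) : 'rV[C]_2 := \row_i (if i == 0 then s else t).

Lemma row2E s t : (row2 s t 0 0 = s) * (row2 s t 0 1 = t).
Proof. by rewrite !mxE. Qed.

Lemma evE a w : ev a w = a 0 0 * w 0 0 + a 0 1 * w 0 1.
Proof. by rewrite /ev mxE sum2 !mxE. Qed.

Lemma evDl a b w : ev (a + b) w = ev a w + ev b w.
Proof. by rewrite /ev mulmxDl mxE. Qed.

Lemma evZl k a w : ev (k *: a) w = k * ev a w.
Proof. by rewrite /ev -scalemxAl mxE. Qed.

Lemma evDr a w v : ev a (w + v) = ev a w + ev a v.
Proof. by rewrite /ev linearD mulmxDr mxE. Qed.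

Lemma evNr a w : ev a (- w) = - ev a w.
Proof. by rewrite /ev linearN mulmxN mxE. Qed.

Lemma evZr k a w : ev a (k *: w) = k * ev a w.
Proof. by rewrite /ev linearZ -scalemxAr mxE. Qed.

Lemma wedgeC a b : wedge a b = - wedge b a.
Proof. by rewrite /wedge opprB mulrC [a 0 1 * _]mulrC. Qed.

Lemma wedgeZ k l a b : wedge (k *: a) (l *: b) = k * l * wedge a b.
Proof. rewrite /wedge !mxE; ring. Qed.

Lemma wedgexx a : wedge a a = 0.
Proof. by rewrite /wedge mulrC subrr. Qed.

Lemma wedge0r a : wedge a 0 = 0.
Proof. by rewrite /wedge !mxE !mulr0 subrr. Qed.

Lemma wedge_kernel a b : (forall w, ev b w = 0 -> ev a w = 0) -> wedge a b = 0.
Proof.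
move=> h; have := h (row2 (b 0 1) (- b 0 0)).
rewrite !evE !row2E => h'; transitivity (a 0 0 * b 0 1 + a 0 1 * - b 0 0).
  by rewrite /wedge mulrN.
by apply: h'; ring.
Qed.

Lemma wedge_proportional a b w : wedge a b = 0 -> ev b w != 0 ->
  a = (ev a w / ev b w) *: b.
Proof.
move=> ab bw; have E : ev b w *: a = ev a w *: b.
  apply/eqP; rewrite -subr_eq0; apply/eqP.
  have -> : ev b w *: a - ev a w *: b = wedge a b *: row2 (w 0 1) (- w 0 0).
    by apply: row2P; rewrite !mxE /= !evE /wedge; ring.
  by rewrite ab scale0r.
by rewrite mulrC -scalerA -E scalerA mulVf// scale1r.
Qed.

Lemma wedge_separates a b w v : wedge a b != 0 -> ev a w = ev a v -> ev b w = ev b v ->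
  w = v.
Proof.
move=> ab aw bw; have h u : wedge a b *: u =
    row2 (b 0 1 * ev a u - a 0 1 * ev b u) (a 0 0 * ev b u - b 0 0 * ev a u).
  by apply: row2P; rewrite !mxE /= !evE /wedge; ring.
by apply: (scalerI ab); rewrite !h aw bw.
Qed.

Lemma wedge_degenerate a b : wedge a b = 0 ->
  exists w, [/\ w != 0, ev a w = 0 & ev b w = 0].
Proof.
move=> ab; pose p c := row2 (c 0 1) (- c 0 0).
have p0 c : c != 0 -> p c != 0.
  apply: contraNneq => pc; apply/eqP/row2P.
    by have /rowP/(_ 1) := pc; rewrite !mxE /= => /eqP; rewrite oppr_eq0 => /eqP.
  by have /rowP/(_ 0) := pc; rewrite !mxE.
have pw c d : ev c (p d) = wedge c d by rewrite evE !row2E /wedge mulrN.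
have [a0|a0] := eqVneq a 0; last first.
  by exists (p a); rewrite p0// !pw wedgexx wedgeC ab oppr0.
have [b0|b0] := eqVneq b 0; last by exists (p b); rewrite p0// !pw wedgexx ab.
exists (row2 1 0); rewrite a0 b0 !evE !mxE !mul0r addr0; split => //.
by apply/eqP => /rowP/(_ 0); rewrite !mxE /= => /eqP; rewrite oner_eq0.
Qed.

Lemma wedge_neq0_ev a b : wedge a b != 0 -> exists w, ev b w != 0.
Proof.
move=> ab; exists (row2 (- a 0 1) (a 0 0)); rewrite evE !row2E.
by apply: contraNneq ab => h; apply/eqP; rewrite -[RHS]h /wedge; ring.
Qed.

Section Triple.
Variables (d : 'I_3 -> 'rV[C]_2).
Hypothesis d_sum : \sum_i d i = 0.
Hypothesis d_indep : wedge (d 0) (d 1) != 0.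

Lemma triple2 : d 2 = - d 0 - d 1.
Proof.
apply/eqP; rewrite -subr_eq0 opprD !opprK addrC; apply/eqP.
by rewrite -d_sum sum3.
Qed.

Lemma triple_indep i j : i != j -> wedge (d i) (d j) != 0.
Proof.
have d2 := triple2; have h12 : wedge (d 1) (d 2) = wedge (d 0) (d 1).
  by rewrite d2 /wedge !mxE; ring.
have h20 : wedge (d 2) (d 0) = wedge (d 0) (d 1).
  by rewrite d2 /wedge !mxE; ring.
by elim/forall3: i; elim/forall3: j => //= _;
  rewrite ?h12 ?h20// wedgeC oppr_eq0 ?h12 ?h20.
Qed.

(** Two of the three forms are independent, and the third is minus their sum. *)
Lemma triple_coef (c : 'I_3 -> C) : \sum_i c i *: d i = 0 -> forall i, c i = c 0.
Proof.
rewrite sum3 triple2 => h.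
have E : (c 0 - c 2) *: d 0 + (c 1 - c 2) *: d 1 = 0.
  by rewrite -[RHS]h; apply: row2P; rewrite !mxE; ring.
have e0 : (c 0 - c 2) * wedge (d 0) (d 1) = 0.
  transitivity (wedge ((c 0 - c 2) *: d 0 + (c 1 - c 2) *: d 1) (d 1)).
    by rewrite /wedge !mxE; ring.
  by rewrite E /wedge !mxE !mul0r subrr.
have e1 : (c 1 - c 2) * wedge (d 0) (d 1) = 0.
  transitivity (wedge (d 0) ((c 0 - c 2) *: d 0 + (c 1 - c 2) *: d 1)).
    by rewrite /wedge !mxE; ring.
  by rewrite E wedge0r.
have c02 : c 0 = c 2.
  by apply/eqP; rewrite -subr_eq0; move/eqP: e0; rewrite mulf_eq0 (negbTE d_indep) orbF.
have c12 : c 1 = c 2.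
  by apply/eqP; rewrite -subr_eq0; move/eqP: e1; rewrite mulf_eq0 (negbTE d_indep) orbF.
by elim/forall3; rewrite ?c02 ?c12.
Qed.

(** The quarter turn of a form is a vector killed by it; the area form gives the
    normalization. *)
Definition dual_fields (i : 'I_3) : 'rV[C]_2 :=
  (wedge (d 0) (d 1))^-1 *: row2 (d i 0 1) (- d i 0 0).

Lemma dual_fieldsP :
  [/\ forall i, ev (d i) (dual_fields i) = 0, \sum_i dual_fields i = 0
    & forall i, ev (d i) (dual_fields (i + 1)) = 1].
Proof.
have pw a b : ev a (row2 (b 0 1) (- b 0 0)) = wedge a b.
  by rewrite evE !row2E /wedge mulrN.
have d2 := triple2; have h12 : wedge (d 1) (d 2) = wedge (d 0) (d 1).
  by rewrite d2 /wedge !mxE; ring.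
have h20 : wedge (d 2) (d 0) = wedge (d 0) (d 1).
  by rewrite d2 /wedge !mxE; ring.
split.
- by move=> i; rewrite evZr pw wedgexx mulr0.
- rewrite -scaler_sumr sum3 [X in _ *: X](_ : _ = 0) ?scaler0//.
  by apply: row2P; rewrite d2 !mxE /=; ring.
elim/forall3; rewrite ?add0r ?succ3 evZr pw ?h12 ?h20 mulVf//.
Qed.

(** The first form takes the values 0 and 1, and the second one the values -1
    and 0, on the first two fields. *)
Lemma dual_fields_decomp (v : 'I_3 -> 'rV[C]_2) w :
  (forall i, ev (d i) (v i) = 0) -> \sum_i v i = 0 ->
  (forall i, ev (d i) (v (i + 1)) = 1) ->
  w = - ev (d 1) w *: v 0 + ev (d 0) w *: v 1.
Proof.
move=> vd vs v1; have e01 : ev (d 0) (v 1) = 1 by rewrite -(v1 0) add0r.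
have e12 : ev (d 1) (v 2) = 1 by rewrite -(v1 1) succ3.
have e10 : ev (d 1) (v 0) = - 1.
  have -> : v 0 = - v 1 - v 2.
    by apply/eqP; rewrite -subr_eq0 opprD !opprK addrA -sum3 vs.
  by rewrite evDr !evNr e12 (vd 1) oppr0 add0r.
apply: (wedge_separates d_indep); rewrite evDr !evZr ?(vd 0) ?(vd 1) ?e01 ?e10.
  by rewrite mulr0 add0r mulr1.
by rewrite mulr0 addr0 mulrN1 opprK.
Qed.

End Triple.
End FormAlgebra.

(** * Relabelled frames and rescaled closed forms *)
Section FramePermutation.
Context {R : realType} {n : nat}.
Local Notation C := (Cplx R).
Local Notation V := 'rV[C]_n.
Implicit Types (m : V -> 'I_n -> 'I_n -> 'I_n -> C) (f g : 'I_n -> V) (u : V).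

Lemma coframe0 m y f u : frame_at m y f -> (forall i, (u *m coframe f) 0 i = 0) -> u = 0.
Proof.
move=> ff h; rewrite (frame_decomp u ff); apply: big1 => i _.
by rewrite h scale0r.
Qed.

(** The components of an idempotent in a frame of idempotents are 0 or 1, so
    that two such frames differ by a relabelling. *)
Lemma frame_permutation m y f g : algebra_at m y -> frame_at m y f -> frame_at m y g ->
  exists2 s : 'I_n -> 'I_n, injective s & forall i, g i = f (s i).
Proof.
move=> yA ff gg; pose a i j : C := (g i *m coframe f) 0 j.
have aa i j : a i j * a i j = a i j.
  by rewrite -(coframeM _ _ _ ff yA) gg.1 eqxx.
have a0 i i' j : i != i' -> a i j * a i' j = 0.
  by move=> /negbTE ii; rewrite -(coframeM _ _ _ ff yA) gg.1 ii mul0mx mxE.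
have a_neq0 i : exists j, a i j != 0.
  apply/not_existsP => h; have /eqP := frame_neq0 i gg; apply.
  by apply: (coframe0 ff) => j; apply/eqP; apply: contra_notT (h j).
have [s sP] := choice a_neq0.
have s_inj : injective s.
  move=> i i' ss; have [//|ii] := eqVneq i i'; have /eqP := a0 i i' (s i) ii.
  by rewrite mulf_eq0 (negbTE (sP i)) ss (negbTE (sP i')).
exists s => // i; rewrite [LHS](frame_decomp _ ff) (bigD1 (s i))//= big1.
  rewrite addr0 -/(a i (s i)) (_ : a i (s i) = 1) ?scale1r//.
  by apply: (mulfI (sP i)); rewrite mulr1 aa.
move=> j jsi; rewrite -/(a i j); have [t _ st] := injF_bij s_inj.
have ti : i != t j by apply: contra_neq jsi => ->; rewrite st.
have /eqP := a0 _ _ j ti; rewrite mulf_eq0; have := sP (t j); rewrite st => /negbTE ->.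
by rewrite orbF => /eqP ->; rewrite scale0r.
Qed.

End FramePermutation.

Section ScaledClosedForms.
Context {R : realType}.
Local Notation C := (Cplx R).
Implicit Types (c : 'rV[C]_2 -> C) (d : 'rV[C]_2 -> 'rV[C]_2) (x w : 'rV[C]_2).

Definition grad c x : 'rV[C]_2 := row2 (pd 0 c x) (pd 1 c x).

Lemma mul_add2C (K : fieldType) (a b s t : K) : a * s + b * t = s * a + t * b.
Proof. by rewrite mulrC [b * t]mulrC. Qed.

Lemma ev_grad c x w : differentiable c x -> ev (grad c x) w = 'd c x w.
Proof.
move=> cd; apply: etrans (esym (diff_pd w cd)); rewrite evE !row2E sum2.
exact: mul_add2C.
Qed.

Lemma extd_near d d' x : (\forall y \near x, d y = d' y) -> extd d x = extd d' x.
Proof.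
move=> dd; have E i j : pd i (fun y => d y 0 j) x = pd i (fun y => d' y 0 j) x.
  by apply: pd_near; apply: filterS dd => y ->.
by rewrite /extd !E.
Qed.

Lemma scaled_extd_algebra (K : fieldType) (c a b p q r t : K) :
  r - t = 0 ->
  c * r + a * p - (c * t + b * q) = p * a - q * b.
Proof. by move=> /eqP; rewrite subr_eq0 => /eqP ->; ring. Qed.

Lemma extd_scaled c d x : differentiable c x -> differentiable d x -> extd d x = 0 ->
  extd (fun y => c y *: d y) x = wedge (grad c x) (d x).
Proof.
move=> cd dd d0; have E i j : pd i (fun y => (c y *: d y) 0 j) x =
    c x * pd i (fun y => d y 0 j) x + d x 0 j * pd i c x.
  apply: etrans (pdM i cd (row_diff j dd)); apply: (congr1 (fun f => pd i f x)).
  by apply/funext => y; rewrite mxE.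
rewrite /extd !E /wedge !row2E.
exact: (scaled_extd_algebra (K := C) (c x) (d x 0 1) (d x 0 0) (pd 0 c x) (pd 1 c x) d0).
Qed.

(** Multiplying a web with closed normalized forms by a function [c] changes
    its connection form from 0 to the logarithmic differential of [c]. *)
Lemma chern_form_scaled (sigma : 'I_3 -> 'rV[C]_2 -> 'rV[C]_2) c d0 d1 x w :
  differentiable c x -> differentiable d0 x -> differentiable d1 x ->
  extd d0 x = 0 -> extd d1 x = 0 -> wedge (d0 x) (d1 x) != 0 -> c x != 0 ->
  (\forall y \near x, sigma 0 y = c y *: d0 y) ->
  (\forall y \near x, sigma 1 y = c y *: d1 y) ->
  ev (chern_form sigma x) w = 'd c x w / c x.
Proof.
move=> cd dd0 dd1 e0 e1 W c0 s0 s1.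
have s0x : sigma 0 x = c x *: d0 x by exact: nbhs_singleton s0.
have s1x : sigma 1 x = c x *: d1 x by exact: nbhs_singleton s1.
rewrite /chern_form /web_h (extd_near s0) (extd_near s1) s0x s1x.
rewrite (extd_scaled cd dd0 e0) (extd_scaled cd dd1 e1) wedgeZ -(ev_grad w cd).
move: (grad c x) (c x) (d0 x) (d1 x) W c0 => g k a b W k0.
rewrite (_ : _ - _ = k^-1 *: g); first by rewrite evZl mulrC.
move: W; rewrite /wedge => W.
by apply: row2P; rewrite !mxE; field; apply/andP.
Qed.

End ScaledClosedForms.

(** * The booklet web in local coordinates *)
Section BookletForms.
Context {R : realType} {M : cmanifold R 3} (F : frobenius M) (S : set M).
Local Notation C := (Cplx R).
Local Notation P := 'rV[C]_2.
Local Notation V := 'rV[C]_3.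
Implicit Types (f g : 'I_3 -> V) (u : V).

Lemma unit_frame_sum (m : V -> 'I_3 -> 'I_3 -> 'I_3 -> C) y f u :
  frame_at m y f -> (forall v, prodv m y u v = v) -> u = \sum_i f i.
Proof.
move=> ff u1; rewrite [LHS](frame_decomp _ ff); apply: eq_bigr => i _.
by rewrite (coframe1 i ff u1) scale1r.
Qed.

Lemma coframe_equal (m : V -> 'I_3 -> 'I_3 -> 'I_3 -> C) y f u (k : C) :
  frame_at m y f -> (forall i, (u *m coframe f) 0 i = k) -> u = k *: \sum_i f i.
Proof.
move=> ff uk; rewrite [LHS](frame_decomp _ ff) scaler_sumr.
by apply: eq_bigr => i _; rewrite uk.
Qed.

Variables (D : set P) (psi : P -> M).
Hypothesis lp : local_param S D psi.

Let psi_cont y : D y -> {for y, continuous psi}.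
Proof. by case: lp => _ _ h _ _; exact: h. Qed.

Let psi_diff a y : D y -> cdom a (psi y) -> differentiable (cmap a \o psi) y.
Proof. by case: lp => _ _ _ _ h Dy ay; exact: (h _ _ Dy ay).1. Qed.

Lemma push_tangent y w : D y -> tangent (psi y) (push psi y w).
Proof.
move=> Dy a b ay by_; exact: (push_jac (psi_cont Dy) ay by_ w (psi_diff Dy ay)).
Qed.

(** The unity is the sum of the idempotents, so adding a multiple of it does not
    change the difference of two components. *)
Lemma booklet_plane_coframe a y (g : 'I_3 -> tvec M) i w : D y -> cdom a (psi y) ->
  idempotent_frame F (psi y) g ->
  booklet_plane F (psi y) g i (push psi y w) <->
  (push psi y w a *m coframe (g^~ a)) 0 (i + 1) =
  (push psi y w a *m coframe (g^~ a)) 0 (i + 2).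
Proof.
move=> Dy ay gg; have ga := idempotent_frame_chart gg ay.
have u1 := unit_chart F ay; have uE := unit_frame_sum ga u1.
have /andP[/andP[i1 i2] i12] := succ_neq3 i.
split=> [[c [d /(_ _ ay) ->]]|E].
  have h j : j != i -> ((c *: field_at (fr_unit F) (psi y) a + d *: g i a) *m
      coframe (g^~ a)) 0 j = c.
    move=> /negbTE ji; rewrite mulmxDl -!scalemxAl (coframe_row i ga) mxE [X in X + _]mxE.
    by rewrite (coframe1 j ga u1) mulr1 !mxE ji andbF mulr0 addr0.
  by rewrite !h.
set u := push psi y w; pose th j := (u a *m coframe (g^~ a)) 0 j.
exists (th (i + 1)), (th i - th (i + 1)).
apply: (tangent_teq ay); first exact: push_tangent.
  by apply: tangentD; apply: tangentZ; [exact: fr_unit_tensor|exact: gg.1].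
have h j : j != i -> th j = th (i + 1).
  move=> ji; have [->//|j1] := eqVneq j (i + 1).
  have [[E1 _]|[E1 _]] := remaining3 (l := i) (j := j) (k := i + 1)
    ltac:(by rewrite eq_sym) ltac:(by rewrite eq_sym) j1.
    by rewrite E1 eqxx in j1.
  by rewrite E1; exact: esym E.
rewrite [LHS](frame_decomp _ ga) uE scaler_sumr (bigD1 i)//= [in RHS](bigD1 i)//=.
rewrite scalerBl addrC [RHS]addrAC addrCA addrA addrK addrC; congr (_ + _).
by apply: eq_bigr => j ji; rewrite -/(th j) (h j ji).
Qed.

Hypothesis S_transverse : transverse_to_unit F S.

(** Were the two forms dependent, some nonzero vector tangent to [S] would have
    equal components in the idempotent frame, hence be a multiple of the
    unity. *)
Lemma transverse_independent a y f (b0 b1 : P) : D y -> cdom a (psi y) ->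
  frame_at (fr_mult F a) (cmap a (psi y)) f ->
  (forall w, ev b0 w = (push psi y w a *m coframe f) 0 1 -
                       (push psi y w a *m coframe f) 0 2) ->
  (forall w, ev b1 w = (push psi y w a *m coframe f) 0 2 -
                       (push psi y w a *m coframe f) 0 0) ->
  wedge b0 b1 != 0.
Proof.
move=> Dy ay ff h0 h1; apply/negP => /eqP /wedge_degenerate[w [w0 e0 e1]].
have Spy : S (psi y).
  case: lp => Do _ _ oD _; have [U [_ UE]] := oD _ Do (fun _ => id).
  by have : (psi @` D) (psi y) by [exists y]; rewrite UE => -[].
move: e0 e1; rewrite h0 h1 => /eqP; rewrite subr_eq0 => /eqP e0.
move=> /eqP; rewrite subr_eq0 => /eqP e1.
set u := push psi y w a in e0 e1; pose k : C := (u *m coframe f) 0 0.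
have uk : u = k *: field_at (fr_unit F) (psi y) a.
  rewrite (unit_frame_sum ff (unit_chart F ay)); apply: (coframe_equal ff).
  by elim/forall3; rewrite /k ?e0 ?e1.
have k0 : k != 0.
  apply: contraNneq w0 => k0; apply/eqP; case: lp => _ _ _ _ h.
  by apply: (h _ _ Dy ay).2; rewrite -/u uk k0 scale0r.
apply: (S_transverse.2 _ Spy); exists D, psi, y, (k^-1 *: w); split=> //.
apply: (tangent_teq ay); [exact: fr_unit_tensor|exact: push_tangent|].
have -> : push psi y (k^-1 *: w) a = k^-1 *: u by exact: linearZ.
by rewrite uk scalerA mulVf// scale1r.
Qed.

End BookletForms.

Section AdaptedForms.
Context {R : realType} {M : cmanifold R 3} (F : frobenius M) (S : set M).
Local Notation C := (Cplx R).
Local Notation P := 'rV[C]_2.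
Local Notation V := 'rV[C]_3.
Variables (D : set P) (psi : P -> M).

(** Forms that vanish on the web directions, as [booklet_plane_coframe] shows;
    being closed, they normalize the web with zero connection form. *)
Definition adapted_forms a (e : 'I_3 -> V -> V) (delta : 'I_3 -> P -> P) y :=
  [/\ D y, cdom a (psi y),
      frame_at (fr_mult F a) (cmap a (psi y)) (e^~ (cmap a (psi y))),
      forall i, differentiable (delta i) y /\ extd (delta i) y = 0
    & forall i w, ev (delta i y) w =
        (push psi y w a *m coframe (e^~ (cmap a (psi y)))) 0 (i + 1) -
        (push psi y w a *m coframe (e^~ (cmap a (psi y)))) 0 (i + 2)].

Hypothesis lp : local_param S D psi.

Lemma ev_ext (a b : P) : (forall w, ev a w = ev b w) -> a = b.
Proof.
move=> ab; apply: row2P; [have := ab (row2 1 0)|have := ab (row2 0 1)];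
  by rewrite !evE !row2E !mulr1 !mulr0 ?addr0 ?add0r.
Qed.

Lemma cyclic_differences (G : zmodType) (s t u : G) : (s - t) + (t - u) + (u - s) = 0.
Proof. by rewrite !subrKA subrr. Qed.

Lemma adapted_sum a e delta y : adapted_forms a e delta y -> \sum_i delta i y = 0.
Proof.
case=> _ _ _ _ dE; apply: ev_ext => w; rewrite sum3 !evDl !dE !succ3 !add0r.
have -> : ev (0 : P) w = 0 by rewrite evE !mxE !mul0r addr0.
exact: cyclic_differences.
Qed.

Lemma adapted_indep a e delta y : transverse_to_unit F S -> adapted_forms a e delta y ->
  wedge (delta 0 y) (delta 1 y) != 0.
Proof.
move=> St [Dy ay ff _ dE]; apply: (transverse_independent lp St Dy ay ff).
  by move=> w; rewrite dE !add0r.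
by move=> w; rewrite dE !succ3.
Qed.

(** The forms are pull-backs of the differences of the closed coordinate forms of
    the extended frame. *)
Theorem adapted_forms_near a x f : D x -> cdom a (psi x) ->
  frame_at (fr_mult F a) (cmap a (psi x)) f ->
  exists e delta, (forall i, e i (cmap a (psi x)) = f i) /\
  exists2 r : R, 0 < r & \forall y \near x, adapted_forms a e delta y /\
    forall i v, prodv (fr_mult F a) (cmap a (psi y)) v v = v -> rnorm (v - f i) < r ->
      v = e i (cmap a (psi y)).
Proof.
move=> Dx ax ff; have [e [ef [r r0 nE]]] := canonical_coframe ax ff.
case: (lp) => Do _ psic _ psid.
pose phi := cmap a \o psi; have phid y : D y -> cdom a (psi y) -> differentiable phi y.
  by move=> Dy ay; exact: (psid _ _ Dy ay).1.
pose th i z k : C := coframe (e^~ z) k (i + 1) - coframe (e^~ z) k (i + 2).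
exists e, (fun i => pullback phi (th i)); split=> //; exists r => //.
have nD y : D y -> \forall z \near y, D z by move=> Dy; exact: open_nbhs_nbhs.
have na y : D y -> cdom a (psi y) -> \forall z \near y, cdom a (psi z).
  by move=> Dy ay; exact: near_chart_psi (psic _ Dy) ay.
have np y : D y -> cdom a (psi y) -> \forall z \near y, differentiable phi z.
  by move=> Dy ay; apply: filterS (filterI (nD y Dy) (na y Dy ay)) => z [Dz]; exact: phid.
have phic : phi @ x --> phi x by exact: differentiable_continuous (phid _ Dx ax).
have nx := phic _ nE; rewrite nbhs_simpl /= in nx.
apply: filterS (filterI (nD x Dx) (filterI (na x Dx ax) nx)) => y [Dy [ay]].
case=> _ fy cd cc cu; split=> [|i v vv vf]; last exact: cu.
have thd i k : differentiable (fun z => th i z k) (phi y).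
  exact: (differentiableB (cd k (i + 1)) (cd k (i + 2))).
split=> // [i|i w].
  split; first exact: (pullback_diff (np y Dy ay) (thd i)).
  apply: (pullback_closed (np y Dy ay) (thd i)) => l k.
  rewrite (pdB l (cd k (i + 1)) (cd k (i + 2))) (pdB k (cd l (i + 1)) (cd l (i + 2))).
  by rewrite (cc (i + 1) l k) (cc (i + 2) l k).
rewrite (ev_pullback _ w (phid _ Dy ay)) !mxE -sumrB.
by apply: eq_bigr => k _; rewrite mulrBr.
Qed.

End AdaptedForms.

(** * Normalized descriptions of the web *)
Section Presentations.
Context {R : realType} {M : cmanifold R 3} (F : frobenius M) (S : set M).
Local Notation C := (Cplx R).
Local Notation P := 'rV[C]_2.
Local Notation V := 'rV[C]_3.
Implicit Types (D : set P) (psi : P -> M).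

Lemma local_param_sub D D1 psi : local_param S D psi -> open D1 -> D1 `<=` D ->
  local_param S D1 psi.
Proof.
move=> [Do inj cnt op im] D1o D1D; split=> // [y z|y D1y|D' D'o D'D|y a D1y ay].
- by rewrite !inE => /D1D Dy /D1D Dz; apply: inj; rewrite inE.
- exact: cnt (D1D _ D1y).
- by apply: op => // y /D'D /D1D.
- exact: im (D1D _ D1y) ay.
Qed.

(** The forms of [adapted_forms_near], on the open set of the points at which they
    are adapted. *)
Theorem presentation_exists p (E : 'I_3 -> tvec M) : transverse_to_unit F S -> S p ->
  idempotent_frame F p E ->
  exists D psi sigma v, web_presentation F S D psi sigma v /\ (psi @` D) p.
Proof.
move=> St Sp Ef; have [D [psi [lp [x Dx xp]]]] := St.1 p Sp.
have [a ap] := chart_cover p; have fa := idempotent_frame_chart Ef ap.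
rewrite -xp in ap fa.
have [e [delta [_ [r _ nE]]]] := adapted_forms_near lp Dx ap fa.
pose D1 := interior (adapted_forms F D psi a e delta).
have D1A : D1 `<=` adapted_forms F D psi a e delta by exact: interior_subset.
have D1D : D1 `<=` D by move=> y /D1A[].
have D1x : D1 x by apply: filterS nE => y [].
have D1o : open D1 by exact: open_interior.
have lp1 := local_param_sub lp D1o D1D.
exists D1, psi, delta, (fun i y => dual_fields (delta^~ y) i); split; last by exists x.
split=> // [i y D1y|y D1y|y D1y|y D1y].
- by have [_ _ _ h _] := D1A _ D1y; exact: (h i).1.
- have [Dy ay ff _ dE] := D1A _ D1y.
  pose g i := tlift a (psi y) (e i (cmap a (psi y))).
  have gf : idempotent_frame F (psi y) g by exact: idempotent_frame_lift.
  exists g; split=> // i w.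
  have ge : g^~ a = e^~ (cmap a (psi y)) by apply/funext => j; exact: jac_id.
  have bp := booklet_plane_coframe lp i w Dy ay gf; rewrite ge in bp.
  by rewrite dE; split=> [/eqP|/bp->]; rewrite ?subrr// subr_eq0 => /eqP/bp.
- exact: adapted_sum (D1A _ D1y).
- exact: dual_fieldsP (adapted_sum (D1A _ D1y)) (adapted_indep lp St (D1A _ D1y)).
Qed.

Lemma coframe_relabel (m : V -> 'I_3 -> 'I_3 -> 'I_3 -> C) y (f g : 'I_3 -> V)
    (s : 'I_3 -> 'I_3) (u : V) i : frame_at m y f -> frame_at m y g ->
  (forall i, g i = f (s i)) -> (u *m coframe g) 0 i = (u *m coframe f) 0 (s i).
Proof.
move=> ff gg gs; apply: (scaler_frame_inj (i := i) gg).
by rewrite -(prodv_frame u i gg) gs (prodv_frame u (s i) ff).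
Qed.

Lemma ev_diff (t : P -> P) x w : differentiable t x -> differentiable (fun y => ev (t y) w) x.
Proof.
move=> td; rewrite (_ : (fun y => _) =
    (fun y => t y 0 0 * w 0 0 + t y 0 1 * w 0 1)); last by apply/funext => y; rewrite evE.
apply: differentiableD; apply: differentiableM; [exact: row_diff| |exact: row_diff|];
  exact: differentiable_cst.
Qed.

Lemma wedge_diff (t t' : P -> P) x : differentiable t x -> differentiable t' x ->
  differentiable (fun y => wedge (t y) (t' y)) x.
Proof.
move=> td td'; apply: differentiableB; apply: differentiableM; exact: row_diff.
Qed.

Lemma diff_neq0_near (f : P -> C) x : differentiable f x -> f x != 0 ->
  \forall y \near x, f y != 0.
Proof.
move=> fd f0; exact: (@cvg_neq0 _ _ (nbhs x) _ f (f x) (differentiable_continuous fd) f0).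
Qed.

Variables (D : set P) (psi : P -> M) (sigma v : 'I_3 -> P -> P).
Hypothesis St : transverse_to_unit F S.
Hypothesis W : web_presentation F S D psi sigma v.
Variables (a : chart M) (e : 'I_3 -> V -> V) (delta : 'I_3 -> P -> P).
Local Notation adapted := (adapted_forms F D psi a e delta).

(** The idempotent frames that define the two families of forms at the point
    differ by a relabelling, and forms with the same kernel are proportional. *)
Lemma presentation_kernel y : adapted y ->
  exists2 s : 'I_3 -> 'I_3, injective s &
    forall i, wedge (sigma i y) (delta (s i) y) = 0.
Proof.
move=> [Dy ay ff _ dE]; have [lp _ ker _ _] := W.
have [g [gf gk]] := ker _ Dy; have ga := idempotent_frame_chart gf ay.
have yA : algebra_at (fr_mult F a) (cmap a (psi y)) by apply: chart_algebra; exists (psi y).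
have [s s_inj gs] := frame_permutation yA ff ga; exists s => // i.
apply: wedge_kernel => w; rewrite dE => /eqP; rewrite subr_eq0 => /eqP E.
apply/gk/(booklet_plane_coframe lp i w Dy ay gf).
have /andP[/andP[i1 i2] i12] := succ_neq3 i.
have rel j := coframe_relabel (push psi y w a) j ff ga gs.
apply: (etrans (rel (i + 1))); apply: etrans (esym (rel (i + 2))).
have := @remaining3 (s i) (s (i + 1)) (s (i + 2)).
rewrite !(inj_eq s_inj) eq_sym i1 eq_sym i2 i12 => /(_ isT isT isT).
case=> -[-> ->]; [exact: E|exact: esym E].
Qed.

Lemma presentation_nonzero y i : D y -> exists w, ev (sigma i y) w != 0.
Proof.
have [_ _ _ _ h] := W; move=> /h[_ _ h1]; exists (v (i + 1) y).
by rewrite h1 oner_neq0.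
Qed.

Section Triple.
Variables (y : P) (s : 'I_3 -> 'I_3).
Hypotheses (Ay : adapted y) (s_inj : injective s).

Lemma relabelled_sum : \sum_i delta (s i) y = 0.
Proof. exact: etrans (esym (reindex_inj (P := predT) s_inj)) (adapted_sum Ay). Qed.

Lemma relabelled_indep i j : i != j -> wedge (delta (s i) y) (delta (s j) y) != 0.
Proof.
have [lp _ _ _ _] := W; move=> ij.
apply: (triple_indep (adapted_sum Ay) (adapted_indep lp St Ay)).
by rewrite (inj_eq s_inj).
Qed.

Lemma relabelled_neq0 i : exists w, ev (delta (s i) y) w != 0.
Proof.
have /andP[/andP[i1 _] _] := succ_neq3 i.
exact: wedge_neq0_ev (relabelled_indep i1).
Qed.

(** There is only one linear relation between the forms of a triple, so the three
    factors of proportionality agree. *)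
Lemma common_factor : (forall i, wedge (sigma i y) (delta (s i) y) = 0) ->
  exists k : C, forall i, sigma i y = k *: delta (s i) y.
Proof.
move=> sd; have /choice[c cP] : forall i, exists k : C, sigma i y = k *: delta (s i) y.
  move=> i; have [w w0] := relabelled_neq0 i.
  by exists (ev (sigma i y) w / ev (delta (s i) y) w); exact: wedge_proportional.
have [_ _ _ sum0 _] := W; have [Dy _ _ _ _] := Ay.
exists (c 0) => i; rewrite (cP i); congr (_ *: _).
apply: (triple_coef relabelled_sum (relabelled_indep (i := 0) (j := 1) isT)).
by rewrite -[RHS](sum0 _ Dy); apply: eq_bigr => j _; rewrite cP.
Qed.

End Triple.

(** The relabelling is locally constant, because a form which is not a multiple
    of another one stays so nearby. *)
Theorem presentation_scaled x : (\forall y \near x, adapted y) ->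
  exists2 s : 'I_3 -> 'I_3, injective s & exists c : P -> C,
    [/\ differentiable c x, c x != 0 &
        \forall y \near x, forall i, sigma i y = c y *: delta (s i) y].
Proof.
move=> nA; have Ax : adapted x by exact: nbhs_singleton nA.
have [Dx _ _ dd _] := Ax; have [lp sd _ _ _] := W.
have [s s_inj sx] := presentation_kernel Ax.
exists s => //.
have [k kE] := common_factor Ax s_inj sx.
have k0 : k != 0.
  have [w] := presentation_nonzero 0 Dx; apply: contraNneq => k0.
  by rewrite kE k0 scale0r evE !mxE !mul0r addr0.
have apart i l : l != s i -> \forall y \near x, wedge (sigma i y) (delta l y) != 0.
  move=> ls; apply: diff_neq0_near; first exact: (wedge_diff (sd i _ Dx) (dd l).1).
  rewrite kE -[delta l x]scale1r wedgeZ mulr1 mulf_neq0//.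
  apply: (triple_indep (adapted_sum Ax) (adapted_indep lp St Ax)).
  by rewrite eq_sym.
have nsep : \forall y \near x, forall il : 'I_3 * 'I_3, il.2 != s il.1 ->
    wedge (sigma il.1 y) (delta il.2 y) != 0.
  apply: (filter_forall (nbhs_filter x)) => -[i l]; have [->|ls] := eqVneq l (s i).
    by apply: filterE => y.
  by apply: filterS (apart i l ls).
have nrel : \forall y \near x, forall i, wedge (sigma i y) (delta (s i) y) = 0.
  apply: filterS (filterI nA nsep) => y [Ay sep] i.
  have [s' s'_inj s'y] := presentation_kernel Ay.
  have [<-|ss] := eqVneq (s' i) (s i); first exact: s'y.
  by have := sep (i, s' i) ss; rewrite /= s'y eqxx.
have [w w0] := relabelled_neq0 Ax s_inj 0.
have dd0 : differentiable (fun y => ev (delta (s 0) y) w) x by exact: ev_diff (dd (s 0)).1.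
have nw := diff_neq0_near dd0 w0.
(* The factor is the ratio of the values on a vector not killed near x. *)
exists (fun y => ev (sigma 0 y) w / ev (delta (s 0) y) w); split.
- by apply: differentiableM; [exact: ev_diff (sd 0 _ Dx)|exact: differentiableV].
- by rewrite kE evZl mulfK.
apply: filterS (filterI nA (filterI nrel nw)) => y [Ay [rel wy]] i.
have [l lE] := common_factor Ay s_inj rel.
by rewrite [in RHS]lE evZl mulfK.
Qed.

End Presentations.

(** * Parallel transport *)
Section Transport.
Context {R : realType} {M : cmanifold R 3} (F : frobenius M) (S : set M).
Local Notation C := (Cplx R).
Local Notation P := 'rV[C]_2.
Local Notation V := 'rV[C]_3.

Lemma scaled_rate (K : fieldType) (d c k : K) : c != 0 -> d / c * (k * c) = k * d.
Proof. by move=> c0; rewrite mulrCA divfK. Qed.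

Lemma has_deriv_scale (I : set R) (u : R -> C) t (w k : C) :
  has_deriv I u t w -> has_deriv I (fun s => k * u s) t (k * w).
Proof.
move=> uw; rewrite /has_deriv.
rewrite (_ : (fun s => _) = (fun s => k * ((((s - t)%:C)%C : C)^-1 *: (u s - u t)))).
  exact: (cvgM (cvg_cst k) uw).
by apply/funext => s; rewrite -mulrBr; exact: mulrCA.
Qed.

Lemma coframe_comb (m : V -> 'I_3 -> 'I_3 -> 'I_3 -> C) y (f : 'I_3 -> V) (u : V)
    (eta : 'I_3 -> C) (k : C) j :
  frame_at m y f -> (forall w, prodv m y u w = w) ->
  ((\sum_i eta i *: f i - k *: u) *m coframe f) 0 j = eta j - k.
Proof.
move=> ff u1; rewrite mulmxBl mulmx_suml mxE [X in _ + X]mxE -scalemxAl [X in _ - X]mxE.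
rewrite (coframe1 j ff u1) mulr1 summxE (bigD1 j)//= big1 => [|i ij].
  by rewrite addr0 -scalemxAl (coframe_row j ff) !mxE !eqxx mulr1.
by rewrite -scalemxAl (coframe_row i ff) !mxE eq_sym (negbTE ij) andbF mulr0.
Qed.

Hypothesis St : transverse_to_unit F S.

(** The difference would be a multiple of the unity tangent to [S]; by
    transversality it vanishes. *)
Lemma tangent_mod_unit p u u' (k : C) : S p -> surf_tangent S p u -> surf_tangent S p u' ->
  teq p u' (fun a => u a + k *: field_at (fr_unit F) p a) -> teq p u u'.
Proof.
move=> Sp us us' E; have [D [psi [lp [x Dx xp]]]] := St.1 p Sp.
rewrite -xp in us us'.
have [w uw] := surf_tangent_push lp Dx us; have [w' uw'] := surf_tangent_push lp Dx us'.
rewrite xp in uw uw'.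
have [k0|k0] := eqVneq k 0; first by move=> a ap; rewrite (E a ap) k0 scale0r addr0.
case: (St.2 _ Sp); exists D, psi, x, (k^-1 *: (w' - w)); split=> // a ap.
have -> : push psi x (k^-1 *: (w' - w)) a = k^-1 *: (push psi x w' a - push psi x w a).
  by rewrite /push linearZ linearB.
rewrite -(uw a ap) -(uw' a ap) (E a ap) addrC addKr scalerA mulVf// scale1r.
by [].
Qed.

Variables (I : set R) (alpha : R -> M).
Hypothesis alpha_S : forall t, I t -> S (alpha t).
Hypothesis alpha_curve : curve I alpha.
Variable E : 'I_3 -> R -> tvec M.
Hypothesis E_frame : idempotent_frame_along F I alpha E.
Variables (eta : 'I_3 -> C) (xi : R -> tvec M).
Hypothesis xi_proj : forall t, I t -> projection_along_unit F S (alpha t)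
  (fun a => \sum_i eta i *: E i t a) (xi t).

Local Notation kappa l := (eta (l + 1) - eta (l + 2)).

(** On the projected field, the adapted forms take constant values: they do not
    see the unity, and the idempotent components are constant. *)
Lemma adapted_on_projection D psi a e delta y s : local_param S D psi ->
  adapted_forms F D psi a e delta y -> I s -> psi y = alpha s ->
  (forall i, E i s a = e i (cmap a (psi y))) ->
  exists2 w, teq (alpha s) (xi s) (push psi y w) &
    forall l, ev (delta l y) w = kappa l.
Proof.
move=> lp [Dy ay ff _ dE] Is ys Ee; have [xs [k xk]] := xi_proj Is.
rewrite -ys in xs; have [w xw] := surf_tangent_push lp Dy xs.
rewrite -ys; exists w => // l.
have aE : push psi y w a =
    \sum_i eta i *: e i (cmap a (psi y)) - k *: field_at (fr_unit F) (psi y) a.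
  rewrite -(xw a ay); rewrite -ys in xk; have := xk a ay.
  under eq_bigr do rewrite Ee.
  by move=> ->; rewrite addrK.
rewrite dE aE !(coframe_comb _ _ _ ff (unit_chart F ay)).
by rewrite opprB addrA subrK.
Qed.

Lemma dnbhs_within_le t (Q : set R) : within I (nbhs t) Q -> within I (t^') Q.
Proof. by rewrite /within /=; apply: (@filterS _ (nbhs t)) => s h _. Qed.

(** Near the given parameter, sigma_i is c times the adapted form labelled s i,
    whose value on the projected field is the constant kappa (s i). Hence the
    coordinates of the field are constant multiples of c along the curve, and
    the Chern form is d c / c. *)
Theorem projection_forms_vanish D psi sigma v t : I t ->
  web_presentation F S D psi sigma v -> (psi @` D) (alpha t) ->
  chern_forms_vanish psi D sigma v I alpha xi t.
Proof.
move=> It W [x Dx xt]; have [lp sd _ sum0 vP] := W.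
have FG : Filter (within I (nbhs t)) by exact: within_filter.
have FG' : Filter (within I (t^')) by exact: within_filter.
have [a ap] := chart_cover (alpha t).
have fa := idempotent_frame_chart (E_frame.1 _ It) ap.
have [alpha_cont alpha_diff] := alpha_curve It.
have [q aq] := alpha_diff _ ap; rewrite -xt in ap fa alpha_cont.
have [e [delta [ef [r r0 nE]]]] := adapted_forms_near lp Dx ap fa.
have nA : \forall y \near x, adapted_forms F D psi a e delta y.
  by apply: filterS nE => y [].
have Ax : adapted_forms F D psi a e delta x by exact: nbhs_singleton nA.
have [_ _ _ dd _] := Ax.
have [s s_inj [c [cd c0 cE]]] := presentation_scaled St W nA.
have Sa : \forall z \near within I (nbhs t), S (alpha z).
  by apply: filterS (withinT I (nbhs_filter t)) => z; exact: alpha_S.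
have [h hx hb] := lift_near (FG := FG) lp Dx alpha_cont Sa.
have ht : h t = x.
  have [Dh hE] := nbhs_singleton hb It; case: lp => _ inj _ _ _.
  by apply: inj; rewrite ?inE// hE xt.
have hx' : h @ within I (t^') --> x by move=> Q /hx; exact: dnbhs_within_le.
have hd : exists x' : P, has_deriv I h t x'.
  case: (lp) => _ _ _ _ /(_ _ _ Dx ap)[phid phinj].
  have hq : (fun z => (((z - t)%:C)%C : C)^-1 *:
      ((cmap a \o psi) (h z) - (cmap a \o psi) x) : V) @ within I (t^') --> q.
    apply: (cvg_near_eq (FG := FG') aq).
    apply: filterS (dnbhs_within_le hb) => z [_ hz].
    by rewrite /= hz xt.
  have [x' hx''] := quotient_immersion (FG := FG') hx' phid phinj hq.
  by exists x'; rewrite /has_deriv ht.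
have [x' hd'] := hd.
(* xi^1 = - sigma 1 (xi) and xi^2 = sigma 0 (xi), by [dual_fields_decomp]. *)
exists h, (fun z => - kappa (s 1) * c (h z)), (fun z => kappa (s 0) * c (h z)), x'.
have chd : has_deriv I (c \o h) t ('d c x x').
  by rewrite -ht; apply: has_deriv_chain hd'; rewrite ht.
have chE : ev (chern_form sigma (h t)) x' = 'd c x x' / c x.
  rewrite ht; apply: chern_form_scaled cd (dd (s 0)).1 (dd (s 1)).1
    (dd (s 0)).2 (dd (s 1)).2 _ c0 _ _.
  - exact: (relabelled_indep St W Ax s_inj (i := 0) (j := 1) isT).
  - by apply: filterS cE => y ->.
  - by apply: filterS cE => y ->.
have rate k : has_deriv I (fun z => k * c (h z)) t
    (ev (chern_form sigma (h t)) x' * (k * c (h t))).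
  have -> : ev (chern_form sigma (h t)) x' * (k * c (h t)) = k * 'd c x x'.
    rewrite chE ht; exact: scaled_rate c0.
  exact: (@has_deriv_scale I (c \o h) t ('d c x x') k chd).
split; last by split; [exact: hd'|exact: (rate (- kappa (s 1)))|exact: (rate (kappa (s 0)))].
have near_E : \forall z \near within I (nbhs t), forall i, rnorm (E i z a - E i t a) < r.
  apply: (filter_forall FG) => i; rewrite xt in ap.
  exact: (cvg_rnorm _ _).1 (E_frame.2 i t a It ap) r r0.
have near_x := @filterI _ _ (nbhs_filter x).
have near_h := hx _ (near_x _ _ nE (near_x _ _ cE (diff_neq0_near cd c0))).
have near_I := withinT I (nbhs_filter t).
have meet := @filterI _ (within I (nbhs t)) FG.
apply: (@filterS _ (within I (nbhs t)) FG _ _ _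
  (meet _ _ near_h (meet _ _ hb (meet _ _ near_E near_I)))).
move=> z [[[Az uniq] [cEz cz]] [[Dz hz] [Ez Iz]]]; split=> //.
have [_ az _ _ _] := Az.
have Ee i : E i z a = e i (cmap a (psi (h z))).
  apply: uniq (Ez i); rewrite hz in az *.
  by have [_ /(_ _ az)[-> _]] := E_frame.1 _ Iz; rewrite eqxx.
have [w xw dw] := adapted_on_projection lp Az Iz hz Ee.
have indep : wedge (sigma 0 (h z)) (sigma 1 (h z)) != 0.
  rewrite !cEz wedgeZ !mulf_neq0//.
  exact: (relabelled_indep St W Az s_inj (i := 0) (j := 1) isT).
have [v0 vs v1] := vP _ Dz.
have wE := dual_fields_decomp (d := sigma^~ (h z)) (v := v^~ (h z)) indep w v0 vs v1.
rewrite !cEz !evZl !dw in wE.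
by rewrite mulNr ![kappa _ * _]mulrC -wE.
Qed.

End Transport.

Theorem theorem4 (R : realType) (M : cmanifold R 3) (F : frobenius M)
    (Fss : semisimple_frobenius F)
    (S : set M) (S_transverse : transverse_to_unit F S)
    (I : set R) (I_interval : is_interval I) (I0 : I 0)
    (I_nontrivial : exists2 t, I t & t != 0)
    (alpha : R -> M) (alpha_S : forall t, I t -> S (alpha t))
    (alpha_curve : curve I alpha)
    (alpha_regular : forall t, I t -> regular_point F S (alpha t))
    (e : 'I_3 -> R -> tvec M) (e_frame : idempotent_frame_along F I alpha e)
    (v : tvec M) (v_tangent : surf_tangent S (alpha 0) v)
    (eta : 'I_3 -> Cplx R)
    (v_eta : teq (alpha 0) v (fun a => \sum_i eta i *: e i 0 a))
    (xi : R -> tvec M)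
    (xi_proj : forall t, I t ->
       projection_along_unit F S (alpha t)
         (fun a => \sum_i eta i *: e i t a) (xi t)) :
  chern_parallel_transport F S I alpha v xi.
Proof.
split.
  have [xi_tangent [k xi_k]] := xi_proj _ I0.
  apply: (tangent_mod_unit S_transverse (alpha_S _ I0) xi_tangent v_tangent (k := k)).
  by move=> a ap; rewrite (v_eta a ap) (xi_k a ap).
move=> t It; split.
  exact: presentation_exists S_transverse (alpha_S _ It) (e_frame.1 _ It).
move=> D psi sigma w W.
exact: (projection_forms_vanish S_transverse alpha_S alpha_curve e_frame xi_proj It W).
Qed.
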